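(* There exists a universal constant $C_0>0$ such that, for every $0<a\leq b$ and every integer $n\geq 2$, $$\mu(a,b,n)\le \frac{C_0\,a}{1+b^2}.$$ Moreover, for every $0<a\le b$, $T>0$ and integer $n\ge 2$, there exist a $2T$-periodic rank-one control $S_*=c_*c_*^\top$ (with $c_*$ taking values in $\mathbb{R}^n$) such that $$2a\,\mathrm{Id}_n\leq \int_t^{t+2T}S_*(\tau)\,d\tau\leq 2b\,\mathrm{Id}_n\qquad\text{for all }t\geq 0,$$ and an initial condition $\omega_0\in\mathbb{S}^{n-1}$ such that $$\omega_*(t)=\frac{\Phi_{S_*}(t,0)\omega_0}{\|\Phi_{S_*}(t,0)\omega_0\|}$$ is a $2T$-periodic trajectory, and both controls $t\in[0,T]\mapsto S_*(t)$ and $t\in[0,T]\mapsto S_*(t+T)$, together with the respective initial conditions $\omega_0$ and $\omega_*(T)$, are minimizers of the optimal control problem (OCP) on $[0,T]$.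
   Context: For an integer $n\ge 1$, $0<a\le b$ and $T>0$, let $\mathrm{Sym}_n^+(a,b,T)$ be the set of integrable functions $S$ on $[0,T]$ with values in the positive semi-definite symmetric real $n\times n$ matrices with $a\,\mathrm{Id}_n\le\int_0^T S(\tau)\,d\tau\le b\,\mathrm{Id}_n$ (as quadratic forms). For $S\in \mathrm{Sym}_n^+(a,b,T)$ and $\omega_0\in\mathbb{S}^{n-1}$ (the unit sphere of $\mathbb{R}^n$), let $\omega:[0,T]\to\mathbb{S}^{n-1}$ be the solution of $\dot\omega=-S\omega+(\omega^\top S\omega)\omega$, $\omega(0)=\omega_0$, and set $J(S,\omega_0):=\int_0^T\omega^\top S\omega\,dt$. The optimal control problem (OCP) on $[0,T]$ is to minimize $J(S,\omega_0)$ over all $S\in\mathrm{Sym}_n^+(a,b,T)$ and $\omega_0\in\mathbb{S}^{n-1}$; a minimizer is a pair $(S,\omega_0)$ attaining the infimum. The value of the infimum does not depend on $T$ and is denoted $\mu(a,b,n)$. For a locally integrable $S$ on $[0,\infty)$, $\Phi_S(t,0)$ is the value at time $t$ of the solution of $\dot M=-SM$, $M(0)=\mathrm{Id}_n$. *)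

(* Defs.v *)
From HB Require Import structures.
From mathcomp Require Export all_boot all_order all_algebra.
From mathcomp Require Export all_classical all_reals all_analysis.
Export Order.TTheory GRing.Theory Num.Theory.
Export numFieldNormedType.Exports.
Set Implicit Arguments.
Unset Strict Implicit.
Unset Printing Implicit Defensive.
Local Open Scope classical_set_scope.
Local Open Scope ring_scope.

(* Time-dependent vectors and matrices are total functions on R; only their
   values on the time interval under consideration are constrained. *)

Definition qform (R : realType) (n : nat) (A : 'M[R]_n) (x : 'cV[R]_n) : R :=
  (x^T *m A *m x) 0 0.

(* The norm `|x| of MathComp-Analysis on column vectors is the sup norm. *)
Definition enorm (R : realType) (n : nat) (x : 'cV[R]_n) : R :=
  Num.sqrt (\sum_(i < n) x i 0 ^+ 2).

Definition unit_sphere (R : realType) (n : nat) : set 'cV[R]_n :=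
  [set x | enorm x = 1].

Definition loewner_le (R : realType) (n : nat) (A B : 'M[R]_n) : Prop :=
  forall x : 'cV[R]_n, qform A x <= qform B x.

Definition psd (R : realType) (n : nat) (A : 'M[R]_n) : Prop :=
  A^T = A /\ forall x : 'cV[R]_n, 0 <= qform A x.

Definition mx_integrable (R : realType) (m n : nat) (D : set R)
    (F : R -> 'M[R]_(m, n)) : Prop :=
  forall i j, (@lebesgue_measure R).-integrable D (fun t => (F t i j)%:E).

Definition mx_integral (R : realType) (m n : nat) (D : set R)
    (F : R -> 'M[R]_(m, n)) : 'M[R]_(m, n) :=
  \matrix_(i, j) \int[@lebesgue_measure R]_(t in D) (F t i j).

(* Solutions of ODEs are in the sense of Caratheodory: as the coefficients are
   only integrable in time, x' = f(t), x(0) = x0 on [0, T] means that x is the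
   (absolutely continuous) primitive of the integrable function f. *)
Definition primitive_on (R : realType) (m n : nat) (T : R)
    (x0 : 'M[R]_(m, n)) (f x : R -> 'M[R]_(m, n)) : Prop :=
  mx_integrable `[0, T] f /\
  forall t, 0 <= t <= T -> x t = x0 + mx_integral `[0, t] f.

(* Sym_n^+(a, b, T) *)
Definition admissible (R : realType) (n : nat) (a b T : R)
    (S : R -> 'M[R]_n) : Prop :=
  [/\ forall t, 0 <= t <= T -> psd (S t),
      mx_integrable `[0, T] S,
      loewner_le a%:M (mx_integral `[0, T] S) &
      loewner_le (mx_integral `[0, T] S) b%:M].

Definition sphere_trajectory (R : realType) (n : nat) (T : R)
    (S : R -> 'M[R]_n) (w0 : 'cV[R]_n) (w : R -> 'cV[R]_n) : Prop :=
  (forall t, 0 <= t <= T -> unit_sphere (w t)) /\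
  primitive_on T w0
    (fun t => - (S t *m w t) + qform (S t) (w t) *: w t) w.

Definition cost (R : realType) (n : nat) (T : R)
    (S : R -> 'M[R]_n) (w : R -> 'cV[R]_n) : R :=
  \int[@lebesgue_measure R]_(t in `[0, T]) qform (S t) (w t).

(* v = J(S, w0). The trajectory issued from w0 is unique on [0, T], so J is
   represented by its graph. *)
Definition has_cost (R : realType) (n : nat) (T : R)
    (S : R -> 'M[R]_n) (w0 : 'cV[R]_n) (v : R) : Prop :=
  exists2 w, sphere_trajectory T S w0 w & v = cost T S w.

(* The infimum of the problem on [0, T]; its value does not depend on T. *)
Definition ocp_inf (R : realType) (a b : R) (n : nat) (T : R) : R :=
  inf [set v | exists (S : R -> 'M[R]_n) (w0 : 'cV[R]_n),
    [/\ admissible a b T S, unit_sphere w0 & has_cost T S w0 v]].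

Definition ocp_minimizer (R : realType) (n : nat) (a b T : R)
    (S : R -> 'M[R]_n) (w0 : 'cV[R]_n) : Prop :=
  [/\ admissible a b T S, unit_sphere w0 & has_cost T S w0 (ocp_inf a b n T)].

(* Phi t = Phi_S(t, 0) for all t >= 0 *)
Definition is_flow (R : realType) (n : nat)
    (S Phi : R -> 'M[R]_n) : Prop :=
  forall T, 0 < T -> primitive_on T 1%:M (fun t => - (S t *m Phi t)) Phi.

Definition periodic_on_nonneg (R : realType) (V : Type) (p : R)
    (f : R -> V) : Prop :=
  forall t, 0 <= t -> f (t + p) = f t.

(* Main.v *)
(* After normalizing the trace of the controls by a time change, only the
   increments of the primitive of S matter: (int S, w, int w^T S w) satisfies
   second-order increment estimates that survive pointwise ultralimits, so that
   a minimizing sequence converges to a minimizer with bounded control. Write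
   S = c c^T + C with C w = 0: the second part does not act on w, and its
   integral is, by Caratheodory's theorem and compactness, a finite sum of
   matrices d d^T with d orthogonal to some w(t). Stopping the trajectory at
   that w(t) for a while with the control d d^T yields a minimizer of rank one.
   Applying a reflection exchanging w(0) and w(T) on every other interval of
   length T makes it 2T-periodic, and exp(- int w^T S w) w solves the linear
   equation. The upper bound comes from a control rotating w in a plane at
   constant speed. *)

From HB Require Import structures.
Require Import Defs.
From mathcomp Require Import all_boot all_order all_algebra.
From mathcomp Require Import all_classical all_reals all_analysis.
From mathcomp Require Import measurable_realfun ring lra.
Import Order.TTheory GRing.Theory Num.Theory numFieldNormedType.Exports.
Local Open Scope classical_set_scope.
Local Open Scope ring_scope.

Set Implicit Arguments.
Unset Strict Implicit.
Unset Printing Implicit Defensive.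

Implicit Types R : realType.

(** * Integrals over compact intervals *)

(** Controls are merely integrable, so a minimizing sequence may concentrate in time, and the
    product [S w] does not pass to weak limits term by term. The trace of a positive matrix bounds
    its entries, so normalizing it makes all primitives uniformly Lipschitz; freezing the state at
    the left end of a time step makes the equations linear in the increments of the primitive, up to
    a quadratic error. A function with quadratic increments is constant: this restores the integral
    equations of the limit and of the linear lift. Caratheodory's theorem keeps the number of pauses
    at n^2 for all meshes, so that their times and matrices can converge one by one. The rank has to
    be exactly one at each time, hence control and pause vectors are kept nonzero; they are kept
    bounded too, so that Picard iteration contracts on the whole half-line. In the upper bound,
    rotating through a total angle 2 th costs 2 th al, where al is at most 2 p / b and p at most 2
    th; an angle of order sqrt (a / b) then gives a / b^2. *)

Definition integ R (f : R -> R) (s t : R) : R :=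
  \int[@lebesgue_measure R]_(x in `[s, t]) f x.

Definition integrable_on R (f : R -> R) (s t : R) : Prop :=
  (@lebesgue_measure R).-integrable `[s, t] (fun x => (f x)%:E).

Lemma integrable_onS R (f : R -> R) (s t s' t' : R) :
  s <= s' -> t' <= t -> integrable_on f s t -> integrable_on f s' t'.
Proof.
move=> ss tt; apply: integrableS => //.
by apply: subset_itv; rewrite bnd_simp.
Qed.

Lemma integrable_on_bounded R (f : R -> R) (s t C : R) :
  measurable_fun `[s, t] f -> (forall x, s <= x <= t -> `|f x| <= C) ->
  integrable_on f s t.
Proof.
move=> mf fC; apply: measurable_bounded_integrable => //.
  have := @lebesgue_measure_itv R `[s, t] => /= ->.
  by case: ifP => _; rewrite ?ltry// -EFinB ltry.
exists C; split; first exact: num_real.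
by move=> M CM x /=; rewrite in_itv/= => /fC /le_trans; apply; exact: ltW.
Qed.

Lemma integ_split R (f : R -> R) (s u t : R) :
  s <= u -> u <= t -> integrable_on f s t ->
  integ f s t = integ f s u + integ f u t.
Proof.
move=> su ut itf.
have := @Rintegral_itvB R f (BLeft s) (BRight t) u itf.
rewrite !bnd_simp => /(_ su ut) /eqP; rewrite subr_eq /integ => /eqP ->.
rewrite addrC; congr (_ + _); rewrite Rintegral_itv_obnd_cbnd//.
apply: integrableS itf => //; apply: subset_itv; rewrite bnd_simp//.
Qed.

Lemma integrable_onD R (f g : R -> R) (s t : R) :
  integrable_on f s t -> integrable_on g s t ->
  integrable_on (fun x => f x + g x) s t.
Proof. by move=> itf itg; exact: (integrableD _ itf itg). Qed.

Lemma integrable_onZ R (f : R -> R) (k s t : R) :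
  integrable_on f s t -> integrable_on (fun x => k * f x) s t.
Proof. by move=> itf; have := integrableZl _ k itf; apply. Qed.

Lemma integrable_onN R (f : R -> R) (s t : R) :
  integrable_on f s t -> integrable_on (fun x => - f x) s t.
Proof. by move=> itf; exact: (integrableN itf). Qed.

Lemma integrable_onB R (f g : R -> R) (s t : R) :
  integrable_on f s t -> integrable_on g s t ->
  integrable_on (fun x => f x - g x) s t.
Proof. by move=> itf itg; apply: integrable_onD => //; exact: integrable_onN. Qed.

Lemma integrable_on_cst R (c s t : R) :
  integrable_on (fun=> c) s t.
Proof. by apply: (@integrable_on_bounded _ _ _ _ `|c|). Qed.

Lemma integrable_on_sum R (I : Type) (r : seq I) (P : pred I)
    (f : I -> R -> R) (s t : R) :
  (forall i, P i -> integrable_on (f i) s t) ->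
  integrable_on (fun x => \sum_(i <- r | P i) f i x) s t.
Proof.
move=> itf; elim: r => [|i r IH].
  under eq_fun do rewrite big_nil; exact: integrable_on_cst.
under eq_fun do rewrite big_cons.
by case: (boolP (P i)) => // Pi; apply: integrable_onD => //; exact: itf.
Qed.

Lemma integrable_on_measurable R (f : R -> R) (s t : R) :
  integrable_on f s t -> measurable_fun `[s, t] f.
Proof. by move=> /integrableP[] /measurable_EFinP. Qed.

Lemma integrable_onM_bounded R (f g : R -> R) (s t C : R) :
  integrable_on f s t -> measurable_fun `[s, t] g ->
  (forall x, s <= x <= t -> `|g x| <= C) ->
  integrable_on (fun x => f x * g x) s t.
Proof.
move=> itf mg gC; have mf := integrable_on_measurable itf.
have := @le_integrable _ _ R (@lebesgue_measure R) `[s, t] _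
  (fun x => (f x * g x)%:E) (fun x => (C * f x)%:E); apply => //.
- by apply/measurable_EFinP; exact: measurable_funM.
- move=> x /= ; rewrite in_itv/= => xst; rewrite lee_fin !normrM mulrC.
  rewrite ler_wpM2r//; apply: (le_trans (gC _ xst)); exact: ler_norm.
- exact: integrable_onZ.
Qed.

Lemma integD R (f g : R -> R) (s t : R) :
  integrable_on f s t -> integrable_on g s t ->
  integ (fun x => f x + g x) s t = integ f s t + integ g s t.
Proof. by move=> *; rewrite /integ RintegralD. Qed.

Lemma integB R (f g : R -> R) (s t : R) :
  integrable_on f s t -> integrable_on g s t ->
  integ (fun x => f x - g x) s t = integ f s t - integ g s t.
Proof. by move=> *; rewrite /integ RintegralB. Qed.

Lemma integZ R (f : R -> R) (k s t : R) :
  integrable_on f s t ->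
  integ (fun x => k * f x) s t = k * integ f s t.
Proof. by move=> *; rewrite /integ RintegralZl. Qed.

Lemma integ_cst R (c s t : R) : s <= t ->
  integ (fun=> c) s t = c * (t - s).
Proof.
move=> st; rewrite /integ Rintegral_cst//; congr (_ * _).
have := @lebesgue_measure_itv R `[s, t] => /= ->.
by rewrite lte_fin; case: ltgtP st => //= ->; rewrite subrr.
Qed.

Lemma integ_nil R (f : R -> R) (s : R) : integ f s s = 0.
Proof. by rewrite /integ set_itv1 Rintegral_set1. Qed.

Lemma integ_sum R (I : Type) (r : seq I) (P : pred I)
    (f : I -> R -> R) (s t : R) :
  (forall i, P i -> integrable_on (f i) s t) ->
  integ (fun x => \sum_(i <- r | P i) f i x) s t =
  \sum_(i <- r | P i) integ (f i) s t.
Proof.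
move=> itf; elim: r => [|i r IH].
  under [X in integ X]eq_fun do rewrite big_nil.
  by rewrite big_nil /integ Rintegral_cst// mul0r.
under [X in integ X]eq_fun do rewrite big_cons.
rewrite big_cons; case: (boolP (P i)) => // Pi.
by rewrite integD ?IH//; [exact: itf|exact: integrable_on_sum].
Qed.

Lemma le_integ R (f g : R -> R) (s t : R) :
  integrable_on f s t -> integrable_on g s t ->
  (forall x, s <= x <= t -> f x <= g x) -> integ f s t <= integ g s t.
Proof.
move=> itf itg fg; by apply: le_Rintegral => // x /=; rewrite in_itv/=; exact: fg.
Qed.

Lemma integ_ge0 R (f : R -> R) (s t : R) :
  (forall x, s <= x <= t -> 0 <= f x) -> 0 <= integ f s t.
Proof. by move=> f0; apply: Rintegral_ge0 => x /=; rewrite in_itv/=; exact: f0. Qed.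

Lemma integrable_on_norm R (f : R -> R) (s t : R) :
  integrable_on f s t -> integrable_on (fun x => `|f x|) s t.
Proof. by move=> itf; have := integrable_norm itf; apply. Qed.

Lemma norm_integ_le R (f g : R -> R) (s t : R) :
  integrable_on f s t -> integrable_on g s t ->
  (forall x, s <= x <= t -> `|f x| <= g x) -> `|integ f s t| <= integ g s t.
Proof.
move=> itf itg fg; rewrite /integ (le_trans (le_normr_Rintegral _ itf))//.
by apply: le_integ => //; exact: integrable_on_norm.
Qed.

Lemma norm_integ_le_cst R (f : R -> R) (C s t : R) :
  s <= t -> integrable_on f s t ->
  (forall x, s <= x <= t -> `|f x| <= C) -> `|integ f s t| <= C * (t - s).
Proof.
move=> st itf fC; rewrite -integ_cst//.
by apply: norm_integ_le => //; exact: integrable_on_cst.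
Qed.

Lemma eq_integ R (f g : R -> R) (s t : R) :
  (forall x, s <= x <= t -> f x = g x) -> integ f s t = integ g s t.
Proof.
move=> fg; apply: eq_Rintegral => x; rewrite inE/= in_itv/=; exact: fg.
Qed.

Lemma eq_integrable_on R (f g : R -> R) (s t : R) :
  (forall x, s <= x <= t -> f x = g x) -> integrable_on f s t ->
  integrable_on g s t.
Proof.
move=> fg; apply: eq_integrable => // x; rewrite inE/= in_itv/= => /fg ->//.
Qed.

(** The difference lives on the single point [t], a null set. Controls below are glued from pieces
    defined on half-open intervals, so agreement is available only off the right endpoint. *)
Lemma eq_integ_endpoint R (f g : R -> R) (s t : R) :
  s <= t -> (forall x, s <= x < t -> f x = g x) -> integrable_on f s t ->
  integrable_on g s t /\ integ f s t = integ g s t.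
Proof.
move=> st fg itf.
pose d := fun x : R => (g t - f t) * \1_[set t] x.
have mI : measurable_fun `[s, t] (\1_[set t] : R -> R).
  exact: measurable_indic.
have itd : integrable_on d s t.
  apply: (@integrable_on_bounded _ _ _ _ `|g t - f t|).
    by apply: measurable_funM => //.
  move=> x _; rewrite normrM ler_piMr// indicE.
  by case: (_ \in _); rewrite ?normr1 ?normr0.
have d0 : integ d s t = 0.
  rewrite /d integZ//; last first.
    apply: (@integrable_on_bounded _ _ _ _ 1) => // x _.
    by rewrite indicE; case: (_ \in _); rewrite ?normr1 ?normr0.
  rewrite /integ /Rintegral integral_indic//.
  rewrite (_ : _ `&` _ = [set t]); last first.
    apply/seteqP; split=> x /= => [[]//|->]; split => //.
    by rewrite /= in_itv/= st lexx.
  by have /= -> := lebesgue_measure_set1 t; rewrite /= mulr0.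
have gE x : s <= x <= t -> f x + d x = g x.
  move=> /andP[sx xt]; rewrite /d indicE.
  have [->|xt'] := eqVneq x t.
    by rewrite mem_set// mulr1 addrC subrK.
  rewrite memNset ?mulr0 ?addr0; last by apply/eqP.
  by apply: fg; rewrite sx lt_neqAle xt' xt.
split; first by apply: (eq_integrable_on gE); exact: integrable_onD.
by rewrite -(eq_integ gE) integD// d0 addr0.
Qed.

(** Over N + 1 equal steps the quadratic bounds add up to C t^2 / (N + 1), which is arbitrarily
    small. *)
Lemma norm_increment_quadratic R (h : R -> R) (C T : R) :
  (forall s t : R, 0 <= s -> s <= t -> t <= T -> `|h t - h s| <= C * (t - s) ^+ 2) ->
  forall t : R, 0 <= t <= T -> h t = h 0.
Proof.
move=> hC t /andP[t0 tT].
have H N : `|h t - h 0| <= C * t ^+ 2 / N.+1%:R.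
  have step k : (k <= N.+1)%N -> 
     `|h (t / N.+1%:R * k%:R) - h 0| <= k%:R * (C * (t / N.+1%:R) ^+ 2).
    elim: k => [_|k IH kN]; first by rewrite mulr0 subrr normr0 mul0r.
    rewrite -[k.+1%:R]natr1 [in leRHS]mulrDl mul1r.
    have -> : h (t / N.+1%:R * (k%:R + 1)) - h 0 =
      (h (t / N.+1%:R * k%:R) - h 0) +
      (h (t / N.+1%:R * (k%:R + 1)) - h (t / N.+1%:R * k%:R)) by ring.
    apply: (le_trans (ler_normD _ _)); apply: lerD; first exact/IH/ltnW.
    have tN : 0 <= t / N.+1%:R by rewrite divr_ge0.
    apply: le_trans (hC _ _ _ _ _) _.
    - by rewrite mulr_ge0.
    - by rewrite ler_wpM2l// lerDl.
    - rewrite natr1; apply: le_trans tT.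
      by rewrite -mulrA ler_piMr// mulrC ler_pdivrMr// mul1r ler_nat.
    - by rewrite (_ : _ - _ = t / N.+1%:R)//; ring.
  have := step _ (leqnn _); rewrite divfK// => /le_trans; apply.
  by rewrite le_eqVlt; apply/orP; left; apply/eqP; field; rewrite addrC natr1.
apply/eqP; rewrite -subr_eq0 -normr_le0; apply/ler_addgt0Pl => e e0; rewrite addr0.
(* With this [N], C t^2 / e < N + 1, so the bound of [H] falls below [e]. *)
pose N := Num.truncn (C * t ^+ 2 / e).
apply: (le_trans (H N)); rewrite ler_pdivrMr// -ler_pdivrMl// mulrC.
exact/ltW/truncnS_gt.
Qed.

(** * Lipschitz functions as primitives of integrable densities *)

Lemma lebesgue_stieltjes_measure_oc R (f : cumulative R R) (a b : R) :
  a <= b -> lebesgue_stieltjes_measure f `]a, b] = (f b - f a)%:E.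
Proof.
move=> ab; rewrite /lebesgue_stieltjes_measure /measure_extension.
by rewrite measurable_mu_extE/=; [rewrite wlength_itv_bnd|exact: is_ocitv].
Qed.

Lemma lipschitz1_continuous R (G : R -> R) :
  (forall x y, x <= y -> `|G y - G x| <= y - x) -> continuous G.
Proof.
move=> G1 x; apply/cvgrPdist_le => e e0; near=> y.
have xye : `|x - y| <= e by near: y; apply: cvgr_dist_le.
apply: le_trans xye.
have [xy|/ltW yx] := leP x y.
  by rewrite distrC (distrC x) (ger0_norm (_ : 0 <= y - x)) ?subr_ge0// G1.
by rewrite (ger0_norm (_ : 0 <= x - y)) ?subr_ge0// G1.
Unshelve. all: by end_near. Qed.

(* The Lebesgue-Stieltjes measures of [G] and [id - G] add up to the Lebesgue
   measure, so the former is dominated by the latter. *)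
Lemma stieltjes_density R (G : R -> R) (T : R) : 0 <= T ->
  (forall x y, x <= y -> 0 <= G y - G x <= y - x) ->
  exists g : R -> R, (@lebesgue_measure R).-integrable setT (EFin \o g) /\
    forall t, 0 <= t <= T -> G t = G 0 + integ g 0 t.
Proof.
move=> T0 HG.
have cG : continuous G.
  apply: lipschitz1_continuous => x y xy; have /andP[h1 h2] := HG _ _ xy.
  by rewrite ger0_norm.
have cH : continuous (fun x => x - G x).
  by move=> x; apply: cvgB; [exact: cvg_id|exact: cG].
have ndG : nondecreasing G.
  by move=> x y xy; have /andP[h1 _] := HG _ _ xy; rewrite -subr_ge0.
have ndH : nondecreasing (fun x => x - G x).
  move=> x y xy; have /andP[_ h2] := HG _ _ xy; rewrite -subr_ge0.
  by rewrite (_ : _ - _ = (y - x) - (G y - G x)) ?subr_ge0//; ring.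
pose Gc : cumulative R R := HB.pack G
  (isCumulative.Build R _ R G ndG (right_continuousW cG)).
pose Hc : cumulative R R := HB.pack (fun x => x - G x)
  (isCumulative.Build R _ R (fun x => x - G x) ndH (right_continuousW cH)).
pose nG := lebesgue_stieltjes_measure Gc.
pose nH := lebesgue_stieltjes_measure Hc.
have nGE a b : a <= b -> nG `]a, b]%classic = (G b - G a)%:E.
  exact: lebesgue_stieltjes_measure_oc.
have nHE a b : a <= b -> nH `]a, b]%classic = (b - G b - (a - G a))%:E.
  exact: lebesgue_stieltjes_measure_oc.
(* Lebesgue measure is determined by its values on half-open intervals, where the two Stieltjes
   measures add up to the length. *)
have addE A : measurable A -> lebesgue_measure A = (nG A + nH A)%E.
  move=> mA; rewrite -(measure_addE nG nH); apply: lebesgue_measure_unique => //.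
  move=> X /ocitvP[->|[x x12 ->]]; first by rewrite !measure0.
  rewrite -[RHS]/(measure_add nG nH `]x.1, x.2]%classic) measure_addE.
  rewrite /lebesgue_measure lebesgue_stieltjes_measure_oc ?(ltW x12)//.
  transitivity ((G x.2 - G x.1)%:E + (x.2 - G x.2 - (x.1 - G x.1))%:E)%E.
    by rewrite -EFinD /=; congr (_%:E); ring.
  by congr (_ + _)%E; apply/esym; [exact/nGE/ltW|exact/nHE/ltW].
(* Cutting down to []0, T]] gives total mass G T - G 0, hence a finite measure to which the
   Radon-Nikodym theorem applies. *)
have mD : measurable (`]0, T]%classic : set (measurableTypeR R)) by [].
pose nD := mrestr nG mD.
have nD_fin : fin_num_fun nD.
  apply: lty_fin_num_fun.
  have h : nD setT = nG `]0, T]%classic.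
    by rewrite /nD /mrestr; congr nG; exact: setTI.
  have : (nD setT < +oo)%E by rewrite h (nGE _ _ T0) ltry.
  exact.
pose nF : {finite_measure set (measurableTypeR R) -> \bar R} :=
  HB.pack nD (Measure_isFinite.Build _ _ _ nD nD_fin).
have dom : nF `<< (@lebesgue_measure R).
  apply/null_content_dominatesP => A mA A0; rewrite /= /nD /mrestr.
  have mAD : measurable (A `&` `]0, T]%classic) by exact: measurableI.
  have : (@lebesgue_measure R) (A `&` `]0, T]%classic) = 0.
    by apply: (subset_measure0 _ _ _ A0) => //; exact: mA.
  rewrite addE// => /eqP; rewrite padde_eq0 ?measure_ge0//.
  by move=> /andP[/eqP].
pose f := Radon_Nikodym_SigmaFinite.f nF (@lebesgue_measure R).
have ff : forall x, f x \is a fin_num.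
  exact: Radon_Nikodym_SigmaFinite.f_fin_num.
have itf : (@lebesgue_measure R).-integrable setT f.
  exact: Radon_Nikodym_SigmaFinite.f_integrable.
have fE A : measurable A -> nF A = (\int[lebesgue_measure]_(x in A) f x)%E.
  exact: Radon_Nikodym_SigmaFinite.f_integral.
exists (fine \o f); split.
  apply: eq_integrable itf => // x _ /=; by rewrite fineK.
move=> t /andP[t0 tT].
have itg : integrable_on (fine \o f) 0 t.
  apply: (@integrableS _ _ _ _ setT) => //.
  apply: eq_integrable itf => // x _ /=; by rewrite fineK.
rewrite /integ -Rintegral_itv_obnd_cbnd; last first.
  apply: integrableS itg => //; apply: subset_itv; by rewrite bnd_simp.
rewrite /Rintegral.
under eq_integral do rewrite /= fineK//.
rewrite -fE// /= /nD /mrestr.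
rewrite (_ : _ `&` _ = `]0, t]%classic); last first.
  apply/seteqP; split=> x /=; rewrite !in_itv/=; first by case.
  by move=> /andP[-> xt]; rewrite xt (le_trans xt).
by rewrite (nGE _ _ t0)/= addrC subrK.
Qed.

(** Sampling the difference quotient along 1 / (k + 1) gives an ordinary sequence, along which
    closed conditions such as positivity pass to the derivative. *)
Lemma derivable_quotient_cvg R (G : R -> R) (x d : R) :
  derivable G x 1 -> derive1 G x = d ->
  (fun k : nat => k.+1%:R * (G (x + k.+1%:R^-1) - G x)) @ \oo --> d.
Proof.
move=> dG; rewrite derive1E /derive => <-.
have /cvgr_dnbhsP/(_ (fun k : nat => k.+1%:R^-1)) := dG.
have h : (forall n : nat, n.+1%:R^-1 != 0 :> R) /\
    (fun n : nat => n.+1%:R^-1) @ \oo --> (0 : R).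
  by split=> [k|]; [rewrite invr_neq0|exact: cvg_harmonic].
move=> /(_ h); apply: cvg_trans; apply: near_eq_cvg; near=> k.
by rewrite invrK /= [_%:A]mulr1 addrC addrC (addrC x).
Unshelve. all: by end_near. Qed.

(** Adding slope K + 1 to [F] makes it nondecreasing and dividing by 2 (K + 1) makes it 1-Lipschitz,
    so that [stieltjes_density] applies. The convergence of the quotients is Lebesgue's
    differentiation theorem, through [FTC1]. *)
Lemma lipschitz_density R (F : R -> R) (K T : R) : 0 < T ->
  (forall s t, 0 <= s -> s <= t -> t <= T -> `|F t - F s| <= K * (t - s)) ->
  exists f : R -> R, [/\ measurable_fun setT f, integrable_on f 0 T,
    forall t, 0 <= t <= T -> F t = F 0 + integ f 0 t &
    {ae @lebesgue_measure R, forall t, 0 < t < T ->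
      (fun k : nat => k.+1%:R * (F (t + k.+1%:R^-1) - F t)) @ \oo --> f t}].
Proof.
move=> T0 FK.
have K0 : 0 <= K.
  have := FK 0 T (lexx _) (ltW T0) (lexx _).
  by move=> /(le_trans (normr_ge0 _)); rewrite subr0 pmulr_lge0.
(* K + 1 instead of K keeps the divisor positive when K = 0. *)
pose M := 2 * (K + 1); have M0 : 0 < M by rewrite /M; lra.
(* Clamping to [[0, T]] extends [F] to the line and keeps the Lipschitz bound. *)
pose c x : R := Num.max 0 (Num.min x T).
have c0 x : 0 <= c x by rewrite le_max lexx.
have cT x : c x <= T by rewrite ge_max (ltW T0) ge_min lexx orbT.
have cM x y : x <= y -> 0 <= c y - c x <= y - x.
  move=> xy; rewrite /c; case: (leP x T) => xT; case: (leP y T) => yT.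
  - by case: (leP 0 x) => x0; case: (leP 0 y) => y0; lra.
  - by rewrite (max_r (ltW T0)); case: (leP 0 x) => x0; lra.
  - lra.
  - by rewrite (max_r (ltW T0)); lra.
have cE x : 0 <= x <= T -> c x = x.
  by move=> /andP[x0 xT]; rewrite /c (min_l xT) (max_r x0).
pose G x := (F (c x) + (K + 1) * c x) / M.
have GM x y : x <= y -> 0 <= G y - G x <= y - x.
  move=> /cM /andP[cxy cyx]; have := FK _ _ (c0 x) _ (cT y).
  rewrite -subr_ge0 => /(_ cxy); rewrite ler_norml => /andP[h1 h2].
  have -> : G y - G x = (F (c y) - F (c x) + (K + 1) * (c y - c x)) / M.
    by rewrite /G; field; rewrite gt_eqF.
  rewrite divr_ge0 ?(ltW M0)//=; last by nra.
  rewrite ler_pdivrMr//; apply: le_trans (_ : (c y - c x) * M <= _).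
    by rewrite /M; nra.
  by rewrite ler_pM2r.
have [g [itg gE]] := stieltjes_density (ltW T0) GM.
have itgS s t : integrable_on g s t by exact: integrableS itg.
have mg : measurable_fun setT g.
  by move/integrableP: itg => [/measurable_EFinP].
have FE t : 0 <= t <= T -> F t = M * G t - (K + 1) * t.
  by move=> /cE tT; rewrite /G tT; field; rewrite gt_eqF.
exists (fun x => M * g x - (K + 1)); split.
- by apply: measurable_funB => //; exact: measurable_funM.
- apply: integrable_onB; [exact: integrable_onZ|exact: integrable_on_cst].
- move=> t tT; rewrite integB; [|exact: integrable_onZ|exact: integrable_on_cst].
  have /andP[t0 tT'] := tT.
  rewrite integZ// integ_cst// (FE _ tT) (FE 0) ?lexx ?(ltW T0)//.
  by rewrite (gE _ tT); ring.
have locg : locally_integrable setT g by apply: open_integrable_locally => //; exact: openT.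
have := @FTC1 R g (BLeft 0) (fun y => itgS 0 y) locg.
apply: filterS; first exact: (ae_filter_ringOfSetsType (@lebesgue_measure R)).
move=> t /= + /andP[t0 tT].
rewrite lte_fin => /(_ t0)[dG dE].
have cv := derivable_quotient_cvg dG dE.
have {}cv : (fun k : nat => M * (k.+1%:R * (integ g 0 (t + k.+1%:R^-1) - integ g 0 t))
    - (K + 1)) @ \oo --> M * g t - (K + 1).
  by apply: cvgB; [apply: cvgM => //|]; exact: cvg_cst.
move: cv.
apply: cvg_trans; apply: near_eq_cvg; near=> k.
have kT : t + k.+1%:R^-1 <= T.
  rewrite -lerBrDl ltW//; near: k.
  by apply: (cvgr_lt 0 (@cvg_harmonic R)); rewrite subr_gt0.
have k0 : 0 < k.+1%:R^-1 :> R by rewrite invr_gt0.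
have kt : 0 <= t + k.+1%:R^-1 <= T by rewrite kT andbT addr_ge0 ?ltW.
have tt : 0 <= t <= T by rewrite (ltW t0) (ltW tT).
rewrite (FE _ kt) (FE _ tt) (gE _ kt) (gE _ tt); set I := integ _ _ _; set J := integ _ _ _.
by field; rewrite addrC natr1.
Unshelve. all: by end_near. Qed.

(** * Affine changes of variable *)

Lemma measurable_affine R (p q : R) :
  measurable_fun setT (fun x : R => p * x + q).
Proof. by apply: measurable_funD => //; exact: measurable_funM. Qed.

(** Lebesgue measure is [p] times its pushforward under x -> p x + q, since both agree on half-open
    intervals. *)
Lemma ge0_integral_affine R (p q : R) (D : set R) (g : R -> \bar R) :
  0 < p -> measurable D -> measurable_fun D g -> (forall x, D x -> 0 <= g x)%E ->
  (\int[@lebesgue_measure R]_(x in D) g x =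
   p%:E * \int[@lebesgue_measure R]_(x in (fun x => p * x + q)%R @^-1` D)
     (g (p * x + q)%R))%E.
Proof.
move=> p0 mD mg g0.
pose phi : measurableTypeR R -> measurableTypeR R := fun x => p * x + q.
have mphi : measurable_fun (setT : set (measurableTypeR R)) phi.
  exact: measurable_affine.
pose nuphi : {measure set (measurableTypeR R) -> \bar R} :=
  pushforward (@lebesgue_measure R) phi.
pose nu := nuphi mphi.
have p0' : 0 <= p by exact: ltW.
pose nu' : {measure set (measurableTypeR R) -> \bar R} :=
  mscale (NngNum p0') nu.
have nuE A : measurable A -> lebesgue_measure A = nu' A.
  move=> mA; apply: lebesgue_measure_unique => // _ [[a b]] _ <- /=.
  rewrite /mscale /= /pushforward.
  have -> : phi @^-1` `]a, b]%classic = `](a - q) / p, (b - q) / p]%classic.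
    apply/seteqP; split=> x /=; rewrite !in_itv/= /phi ltr_pdivrMr// ler_pdivlMr//;
    by rewrite ltrBlDr lerBrDr (mulrC p).
  rewrite !lebesgue_measure_itv/= !lte_fin ltr_pM2r ?invr_gt0// ltrD2r.
  case: ifP => _; rewrite ?mule0// -EFinM; congr (_%:E); field.
  by rewrite gt_eqF.
rewrite (eq_measure_integral nu'); last by move=> A mA _; exact: nuE.
rewrite ge0_integral_mscale//=; congr (_ * _)%E.
by rewrite ge0_integral_pushforward//= => x; rewrite inE; exact: g0.
Qed.

Lemma affine_preimage_itv R (p q u v : R) : 0 < p ->
  (fun x => p * x + q) @^-1` `[p * u + q, p * v + q]%classic = `[u, v]%classic.
Proof.
by move=> p0; apply/seteqP; split=> x /=; rewrite !in_itv/= !lerD2r !ler_pM2l.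
Qed.

(** The nonnegative case is applied to the positive and negative parts, both of finite integral. *)
Lemma integ_affine R (f : R -> R) (p q u v : R) : 0 < p ->
  integrable_on f (p * u + q) (p * v + q) ->
  integrable_on (fun x => f (p * x + q)) u v /\
  p * integ (fun x => f (p * x + q)) u v = integ f (p * u + q) (p * v + q).
Proof.
move=> p0 itf.
have mf := integrable_on_measurable itf.
have itfp : integrable_on (fun x => f (p * x + q)) u v.
  apply/integrableP; split.
    apply/measurable_EFinP; apply: (measurable_comp _ _ mf) => //.
    - move=> y [x]; rewrite /= !in_itv/= => + <-.
      by rewrite !lerD2r !ler_pM2l.
    - exact: measurable_funTS (measurable_affine _ _).
  move/integrableP : itf => [_].
  rewrite (ge0_integral_affine q p0)//; last first.
    by apply/measurable_EFinP; exact: measurableT_comp.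
  rewrite affine_preimage_itv//=; set I := (\int[_]_(_ in _) _)%E.
  have I0 : (0 <= I)%E by exact: integral_ge0.
  rewrite ltey => h; rewrite ltey; apply: contra_neq h => ->.
  by rewrite gt0_muley// lte_fin.
split => //.
have [p0' mI] : p%:E \is a fin_num /\ measurable `[p * u + q, p * v + q] by [].
have finP : (\int[@lebesgue_measure R]_(x in `[u, v]) 
    ((fun x => (f (p * x + q))%:E)^\+ x) \is a fin_num)%E.
  exact: integrable_pos_fin_num.
have finN : (\int[@lebesgue_measure R]_(x in `[u, v]) 
    ((fun x => (f (p * x + q))%:E)^\- x) \is a fin_num)%E.
  exact: integrable_neg_fin_num.
have hP : (\int[@lebesgue_measure R]_(x in `[(p * u + q)%R, (p * v + q)%R])
      ((fun x => (f x)%:E)^\+ x) =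
    p%:E * \int[@lebesgue_measure R]_(x in `[u, v])
      ((fun x => (f (p * x + q)%R)%:E)^\+ x))%E.
  have mE : measurable_fun `[p * u + q, p * v + q] ((fun x => (f x)%:E)^\+%E).
    by apply: measurable_funepos; exact/measurable_EFinP.
  have := @ge0_integral_affine R p q _ _ p0 mI mE (fun x _ => funepos_ge0 _ x).
  rewrite affine_preimage_itv// => H; rewrite H; congr (_ * _)%E.
  by apply: eq_integral => x _; rewrite !funeposE.
have hN : (\int[@lebesgue_measure R]_(x in `[(p * u + q)%R, (p * v + q)%R])
      ((fun x => (f x)%:E)^\- x) =
    p%:E * \int[@lebesgue_measure R]_(x in `[u, v])
      ((fun x => (f (p * x + q)%R)%:E)^\- x))%E.
  have mE : measurable_fun `[p * u + q, p * v + q] ((fun x => (f x)%:E)^\-%E).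
    by apply: measurable_funeneg; exact/measurable_EFinP.
  have := @ge0_integral_affine R p q _ _ p0 mI mE (fun x _ => funeneg_ge0 _ x).
  rewrite affine_preimage_itv// => H; rewrite H; congr (_ * _)%E.
  by apply: eq_integral => x _; rewrite !funenegE.
have IE (g : R -> R) s t : integ g s t = fine (
    \int[@lebesgue_measure R]_(x in `[s, t]) ((fun x => (g x)%:E)^\+ x) -
    \int[@lebesgue_measure R]_(x in `[s, t]) ((fun x => (g x)%:E)^\- x))%E.
  by congr fine; exact: integralE.
rewrite !IE hP hN.
by rewrite -(fineK finP) -(fineK finN) -!EFinM -!EFinB /= mulrBr.
Qed.

(** * Quadratic forms and the vector field on the sphere *)

Definition dotp R (n : nat) (x y : 'cV[R]_n) : R := (x^T *m y) 0 0.

Definition bform R (n : nat) (A : 'M[R]_n) (x y : 'cV[R]_n) : R :=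
  (x^T *m A *m y) 0 0.

Lemma dotpE R (n : nat) (x y : 'cV[R]_n) :
  dotp x y = \sum_i x i 0 * y i 0.
Proof. by rewrite /dotp mxE; apply: eq_bigr => i _; rewrite mxE. Qed.

Lemma dotpC R (n : nat) (x y : 'cV[R]_n) : dotp x y = dotp y x.
Proof. by rewrite !dotpE; apply: eq_bigr => i _; rewrite mulrC. Qed.

Lemma bformE R (n : nat) (A : 'M[R]_n) (x y : 'cV[R]_n) :
  bform A x y = \sum_i \sum_j x i 0 * A i j * y j 0.
Proof.
rewrite /bform mxE exchange_big; apply: eq_bigr => j _.
by rewrite mxE big_distrl; apply: eq_bigr => i _; rewrite mxE.
Qed.

Lemma qform_bform R (n : nat) (A : 'M[R]_n) (x : 'cV[R]_n) :
  qform A x = bform A x x.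
Proof. by []. Qed.

Lemma qformE R (n : nat) (A : 'M[R]_n) (x : 'cV[R]_n) :
  qform A x = \sum_i \sum_j x i 0 * A i j * x j 0.
Proof. exact: bformE. Qed.

Lemma bform_dotp R (n : nat) (A : 'M[R]_n) (x y : 'cV[R]_n) :
  bform A x y = dotp x (A *m y).
Proof. by rewrite /bform /dotp mulmxA. Qed.

Lemma dotpDl R (n : nat) (x y z : 'cV[R]_n) :
  dotp (x + y) z = dotp x z + dotp y z.
Proof. by rewrite /dotp linearD mulmxDl mxE. Qed.

Lemma dotpDr R (n : nat) (x y z : 'cV[R]_n) :
  dotp x (y + z) = dotp x y + dotp x z.
Proof. by rewrite /dotp mulmxDr mxE. Qed.

Lemma dotpZl R (n : nat) (k : R) (x y : 'cV[R]_n) :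
  dotp (k *: x) y = k * dotp x y.
Proof. by rewrite /dotp linearZ -scalemxAl mxE. Qed.

Lemma dotpZr R (n : nat) (k : R) (x y : 'cV[R]_n) :
  dotp x (k *: y) = k * dotp x y.
Proof. by rewrite /dotp -scalemxAr mxE. Qed.

Lemma dotpNl R (n : nat) (x y : 'cV[R]_n) :
  dotp (- x) y = - dotp x y.
Proof. by rewrite -scaleN1r dotpZl mulN1r. Qed.

Lemma dotpNr R (n : nat) (x y : 'cV[R]_n) :
  dotp x (- y) = - dotp x y.
Proof. by rewrite dotpC dotpNl dotpC. Qed.

Lemma dotpBl R (n : nat) (x y z : 'cV[R]_n) :
  dotp (x - y) z = dotp x z - dotp y z.
Proof. by rewrite dotpDl dotpNl. Qed.

Lemma dotpBr R (n : nat) (x y z : 'cV[R]_n) :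
  dotp x (y - z) = dotp x y - dotp x z.
Proof. by rewrite dotpDr dotpNr. Qed.

Lemma dotp0r R (n : nat) (x : 'cV[R]_n) : dotp x 0 = 0.
Proof. by rewrite /dotp mulmx0 mxE. Qed.

Lemma dotp_mull R (n : nat) (A : 'M[R]_n) (x y : 'cV[R]_n) :
  dotp (A *m x) y = dotp x (A^T *m y).
Proof. by rewrite /dotp trmx_mul mulmxA. Qed.

Lemma dotp_ge0 R (n : nat) (x : 'cV[R]_n) : 0 <= dotp x x.
Proof. by rewrite dotpE sumr_ge0// => i _; rewrite -expr2 sqr_ge0. Qed.

Lemma dotp_eq0 R (n : nat) (x : 'cV[R]_n) : dotp x x = 0 -> x = 0.
Proof.
rewrite dotpE => /eqP; rewrite psumr_eq0 => [|i _]; last by rewrite -expr2 sqr_ge0.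
move=> /allP h; apply/colP => i; rewrite mxE.
by have := h i (mem_index_enum i); rewrite mulf_eq0 orbb => /eqP.
Qed.

Lemma dotp_mx R (n : nat) (x y : 'cV[R]_n) : x^T *m y = (dotp x y)%:M.
Proof. by rewrite [LHS]mx11_scalar. Qed.

Lemma mul_outer R (n : nat) (c d x : 'cV[R]_n) :
  c *m d^T *m x = dotp d x *: c.
Proof. by rewrite -mulmxA dotp_mx mul_mx_scalar. Qed.

Lemma enormE R (n : nat) (x : 'cV[R]_n) :
  enorm x = Num.sqrt (dotp x x).
Proof. by rewrite dotpE. Qed.

Lemma unit_sphereE R (n : nat) (x : 'cV[R]_n) :
  unit_sphere x <-> dotp x x = 1.
Proof.
rewrite /unit_sphere /= enormE; split => [h|->]; last by rewrite sqrtr1.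
by rewrite -(sqr_sqrtr (dotp_ge0 x)) h expr1n.
Qed.

Lemma unit_sphere_coord R (n : nat) (x : 'cV[R]_n) i :
  unit_sphere x -> `|x i 0| <= 1.
Proof.
move=> /unit_sphereE; rewrite dotpE => h.
rewrite -(@ler_pXn2r _ 2) ?nnegrE// expr1n real_normK ?num_real// -h (bigD1 i)//=.
by rewrite expr2 lerDl sumr_ge0// => j _; rewrite -expr2 sqr_ge0.
Qed.

Lemma qformD R (n : nat) (A B : 'M[R]_n) (x : 'cV[R]_n) :
  qform (A + B) x = qform A x + qform B x.
Proof. by rewrite /qform mulmxDr mulmxDl mxE. Qed.

Lemma qformB R (n : nat) (A B : 'M[R]_n) (x : 'cV[R]_n) :
  qform (A - B) x = qform A x - qform B x.
Proof. by rewrite /qform mulmxBr mulmxBl !mxE. Qed.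

Lemma qformZ R (n : nat) (k : R) (A : 'M[R]_n) (x : 'cV[R]_n) :
  qform (k *: A) x = k * qform A x.
Proof. by rewrite /qform -scalemxAr -scalemxAl mxE. Qed.

Lemma qform0 R (n : nat) (x : 'cV[R]_n) : qform (0 : 'M[R]_n) x = 0.
Proof. by rewrite /qform mulmx0 mul0mx mxE. Qed.

Lemma qform_scalar R (n : nat) (a : R) (x : 'cV[R]_n) :
  qform (a%:M : 'M[R]_n) x = a * dotp x x.
Proof. by rewrite /qform mul_mx_scalar -scalemxAl mxE. Qed.

Lemma qform_outer R (n : nat) (c x : 'cV[R]_n) :
  qform (c *m c^T) x = dotp c x ^+ 2.
Proof.
by rewrite qform_bform bform_dotp mul_outer dotpZr (dotpC x) expr2.
Qed.

Lemma bform_sym R (n : nat) (A : 'M[R]_n) (x y : 'cV[R]_n) :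
  A^T = A -> bform A x y = bform A y x.
Proof. by move=> As; rewrite !bform_dotp dotpC dotp_mull As. Qed.

Lemma qformDx R (n : nat) (A : 'M[R]_n) (x y : 'cV[R]_n) (k : R) :
  A^T = A ->
  qform A (x + k *: y) = qform A x + 2 * k * bform A x y + k ^+ 2 * qform A y.
Proof.
move=> As; rewrite !qform_bform !bform_dotp mulmxDr -scalemxAr.
rewrite !dotpDl !dotpDr !dotpZl !dotpZr -!bform_dotp (bform_sym y x As); ring.
Qed.

Lemma psd_CS R (n : nat) (A : 'M[R]_n) (x y : 'cV[R]_n) :
  psd A -> bform A x y ^+ 2 <= qform A x * qform A y.
Proof.
move=> [As A0]; have x0 := A0 x; have y0 := A0 y.
have [yz|yn0] := eqVneq (qform A y) 0.
  rewrite yz mulr0; case: (eqVneq (bform A x y) 0) => [->|b0].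
    by rewrite expr0n.
  (* When the form vanishes at [y] it is affine along [y]; if the mixed term were nonzero, its value
     at this point would be -1. *)
  have := A0 (x + (- (qform A x + 1) / (2 * bform A x y)) *: y).
  rewrite qformDx// yz mulr0 addr0.
  have -> : 2 * (- (qform A x + 1) / (2 * bform A x y)) * bform A x y
    = - (qform A x + 1) by field.
  by rewrite opprD addrA subrr sub0r oppr_ge0 ler10.
have y0' : 0 < qform A y by rewrite lt_neqAle eq_sym yn0.
(* The minimum of the form on the line x + k y; its value is the Gram determinant divided by the
   form at [y]. *)
have := A0 (x + (- bform A x y / qform A y) *: y).
rewrite qformDx//.
have -> : qform A x + 2 * (- bform A x y / qform A y) * bform A x y +
     (- bform A x y / qform A y) ^+ 2 * qform A y =
  (qform A x * qform A y - bform A x y ^+ 2) / qform A y by field.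
by rewrite pmulr_lge0 ?invr_gt0// subr_ge0.
Qed.

(** Cauchy-Schwarz between [A x] and [x]: the mixed term is the squared norm of [A x]. *)
Lemma psd_ker R (n : nat) (A : 'M[R]_n) (x : 'cV[R]_n) :
  psd A -> qform A x = 0 -> A *m x = 0.
Proof.
move=> pA Ax0; apply: dotp_eq0; apply/eqP; rewrite -sqrf_eq0; apply/eqP.
have := psd_CS (A *m x) x pA; rewrite Ax0 mulr0 bform_dotp => h.
by apply/eqP; rewrite eq_le h sqr_ge0.
Qed.

Lemma psd_diag_ge0 R (n : nat) (A : 'M[R]_n) i : psd A -> 0 <= A i i.
Proof.
move=> [_ /(_ (delta_mx i 0))]; rewrite qform_bform bform_dotp dotpE.
rewrite (bigD1 i)//= big1 => [|j ji]; last by rewrite mxE (negbTE ji) mul0r.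
rewrite mxE !eqxx mul1r addr0 mxE (bigD1 i)//= big1 => [|j ji]; last first.
  by rewrite mxE (negbTE ji) mulr0.
by rewrite mxE !eqxx mulr1 addr0.
Qed.

Lemma bform_delta R (n : nat) (A : 'M[R]_n) i j :
  bform A (delta_mx i 0) (delta_mx j 0) = A i j.
Proof.
rewrite bformE (bigD1 i)//= [X in _ + X]big1 => [|k ki]; last first.
  by apply: big1 => l _; rewrite mxE (negbTE ki) !mul0r.
rewrite addr0 (bigD1 j)//= big1 => [|l lj]; last by rewrite !mxE (negbTE lj) mulr0.
by rewrite !mxE !eqxx mul1r mulr1 addr0.
Qed.

Lemma psd_tr_ge0 R (n : nat) (A : 'M[R]_n) : psd A -> 0 <= \tr A.
Proof. by move=> pA; apply: sumr_ge0 => i _; exact: psd_diag_ge0. Qed.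

Lemma psd_diag_tr R (n : nat) (A : 'M[R]_n) i : psd A -> A i i <= \tr A.
Proof.
move=> pA; rewrite /mxtrace (bigD1 i)//= lerDl sumr_ge0// => j _.
exact: psd_diag_ge0.
Qed.

(** Cauchy-Schwarz on two basis vectors bounds the entry by the geometric mean of two diagonal
    entries. Controlling the trace thus controls the whole matrix, which is why time is normalized
    by the trace. *)
Lemma psd_entry R (n : nat) (A : 'M[R]_n) i j :
  psd A -> `|A i j| <= \tr A.
Proof.
move=> pA; have := psd_CS (delta_mx i 0) (delta_mx j 0) pA.
rewrite !qform_bform !bform_delta => h.
rewrite -(@ler_pXn2r _ 2) ?nnegrE// ?psd_tr_ge0// real_normK ?num_real//.
apply: (le_trans h); rewrite expr2.
by apply: ler_pM; rewrite ?psd_diag_ge0 ?psd_diag_tr.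
Qed.

Lemma psdD R (n : nat) (A B : 'M[R]_n) : psd A -> psd B -> psd (A + B).
Proof.
move=> [As A0] [Bs B0]; split; first by rewrite linearD /= As Bs.
by move=> x; rewrite qformD addr_ge0.
Qed.

Lemma psd0 R (n : nat) : psd (0 : 'M[R]_n).
Proof. by split => [|x]; rewrite ?trmx0 ?qform0. Qed.

Lemma psdZ R (n : nat) (k : R) (A : 'M[R]_n) :
  0 <= k -> psd A -> psd (k *: A).
Proof.
move=> k0 [As A0]; split; first by rewrite linearZ /= As.
by move=> x; rewrite qformZ mulr_ge0.
Qed.

Lemma psd_outer R (n : nat) (c : 'cV[R]_n) : psd (c *m c^T).
Proof.
split; first by rewrite trmx_mul trmxK.
by move=> x; rewrite qform_outer sqr_ge0.
Qed.

Lemma psd_scalar R (n : nat) (a : R) : 0 <= a -> psd (a%:M : 'M[R]_n).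
Proof.
move=> a0; split; first by rewrite tr_scalar_mx.
by move=> x; rewrite qform_scalar mulr_ge0// dotp_ge0.
Qed.

Lemma psd_congr R (n : nat) (P A : 'M[R]_n) :
  psd A -> psd (P^T *m A *m P).
Proof.
move=> [As A0]; split; first by rewrite !trmx_mul trmxK As mulmxA.
move=> x; have := A0 (P *m x).
by rewrite /qform trmx_mul !mulmxA.
Qed.

Lemma qform_congr R (n : nat) (P A : 'M[R]_n) (x : 'cV[R]_n) :
  qform (P^T *m A *m P) x = qform A (P *m x).
Proof. by rewrite /qform trmx_mul !mulmxA. Qed.

Lemma rank_outer R (n : nat) (c : 'cV[R]_n) :
  c != 0 -> \rank (c *m c^T) = 1%N.
Proof.
move=> c0; apply/eqP; rewrite eqn_leq; apply/andP; split.
  by apply: leq_trans (mulmx_max_rank _ _) _.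
rewrite lt0n mxrank_eq0; apply: contra_neq c0 => h.
have : (c *m c^T) *m c = 0 by rewrite h mul0mx.
rewrite mul_outer => /eqP; rewrite scaler_eq0 => /orP[/eqP|/eqP//].
exact: dotp_eq0.
Qed.

(** Convertible to the right-hand side in [sphere_trajectory]; at a unit vector it is the component
    of - A x tangent to the sphere. *)
Definition vfield R (n : nat) (A : 'M[R]_n) (x : 'cV[R]_n) : 'cV[R]_n :=
  - (A *m x) + qform A x *: x.

Lemma vfieldE R (n : nat) (A : 'M[R]_n) (x : 'cV[R]_n) i :
  vfield A x i 0 = - (\sum_j A i j * x j 0) + qform A x * x i 0.
Proof. by rewrite /vfield !mxE. Qed.

(** In the Lipschitz estimate of the field, n comes from the linear term, 2 n^2 from the variation
    of the quadratic form and n^2 from that of the factor [x]. The same constant bounds the field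
    itself. *)
Definition vfield_cst R (n : nat) : R := n%:R + 3 * n%:R ^+ 2.

Lemma vfield_cst_ge0 R (n : nat) : 0 <= vfield_cst R n.
Proof. by rewrite addr_ge0// mulr_ge0. Qed.

Lemma norm_sum_le R (n : nat) (f : 'I_n -> R) (d : R) :
  (forall i, `|f i| <= d) -> `|\sum_i f i| <= n%:R * d.
Proof.
move=> fd; apply: (le_trans (ler_norm_sum _ _ _)).
apply: (le_trans (ler_sum _ (fun i _ => fd i))).
by rewrite sumr_const card_ord mulr_natl.
Qed.

Lemma norm_qform_le R (n : nat) (A : 'M[R]_n) (x : 'cV[R]_n) :
  psd A -> (forall i, `|x i 0| <= 1) -> `|qform A x| <= n%:R ^+ 2 * \tr A.
Proof.
move=> pA x1; rewrite qformE expr2 -mulrA.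
apply: norm_sum_le => i; apply: norm_sum_le => j.
rewrite !normrM -[leRHS]mul1r -[leRHS]mulr1.
by rewrite !ler_pM ?mulr_ge0// psd_entry.
Qed.

Lemma qform_lipschitz R (n : nat) (A : 'M[R]_n) (x y : 'cV[R]_n) (d : R) :
  psd A -> (forall i, `|x i 0| <= 1) -> (forall i, `|y i 0| <= 1) ->
  (forall i, `|x i 0 - y i 0| <= d) ->
  `|qform A x - qform A y| <= 2 * n%:R ^+ 2 * \tr A * d.
Proof.
move=> pA x1 y1 xy; rewrite !qformE -sumrB.
have -> : 2 * n%:R ^+ 2 * \tr A * d = n%:R * (n%:R * (2 * \tr A * d)) by ring.
apply: norm_sum_le => i; rewrite -sumrB; apply: norm_sum_le => j.
have -> : x i 0 * A i j * x j 0 - y i 0 * A i j * y j 0 =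
  A i j * ((x i 0 - y i 0) * x j 0 + y i 0 * (x j 0 - y j 0)) by ring.
have -> : 2 * \tr A * d = \tr A * (d + d) by ring.
rewrite normrM ler_pM// ?psd_entry//.
apply: (le_trans (ler_normD _ _)); rewrite !normrM.
have d0 : 0 <= d by exact: le_trans (xy i).
apply: lerD; first by rewrite -[leRHS]mulr1 ler_pM.
by rewrite -[leRHS]mul1r ler_pM.
Qed.

Lemma norm_vfield_le R (n : nat) (A : 'M[R]_n) (x : 'cV[R]_n) i :
  psd A -> (forall i, `|x i 0| <= 1) -> `|vfield A x i 0| <= vfield_cst R n * \tr A.
Proof.
move=> pA x1; rewrite vfieldE; apply: (le_trans (ler_normD _ _)).
have t0 := psd_tr_ge0 pA.
have h1 : `|\sum_j A i j * x j 0| <= n%:R * \tr A.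
  apply: norm_sum_le => j; rewrite normrM -[leRHS]mulr1.
  by rewrite ler_pM// psd_entry.
have h2 : `|qform A x * x i 0| <= n%:R ^+ 2 * \tr A.
  by rewrite normrM -[leRHS]mulr1 ler_pM// norm_qform_le.
rewrite normrN /vfield_cst; apply: (le_trans (lerD h1 h2)).
have n0 : 0 <= n%:R ^+ 2 * \tr A by rewrite mulr_ge0.
by rewrite mulrDl; lra.
Qed.

Lemma vfield_lipschitz R (n : nat) (A : 'M[R]_n) (x y : 'cV[R]_n)
    (d : R) i :
  psd A -> (forall i, `|x i 0| <= 1) -> (forall i, `|y i 0| <= 1) ->
  (forall i, `|x i 0 - y i 0| <= d) ->
  `|vfield A x i 0 - vfield A y i 0| <= vfield_cst R n * \tr A * d.
Proof.
move=> pA x1 y1 xy; rewrite !vfieldE.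
have t0 := psd_tr_ge0 pA.
have d0 : 0 <= d by exact: le_trans (xy i).
have -> : - (\sum_j A i j * x j 0) + qform A x * x i 0
    - (- (\sum_j A i j * y j 0) + qform A y * y i 0) =
  - (\sum_j A i j * x j 0 - \sum_j A i j * y j 0) +
    ((qform A x - qform A y) * x i 0 + qform A y * (x i 0 - y i 0)) by ring.
have h1 : `|\sum_j A i j * x j 0 - \sum_j A i j * y j 0| <= n%:R * (\tr A * d).
  rewrite -sumrB; apply: norm_sum_le => j; rewrite -mulrBr normrM.
  by rewrite ler_pM// psd_entry.
have h2 : `|(qform A x - qform A y) * x i 0| <= 2 * n%:R ^+ 2 * \tr A * d.
  by rewrite normrM -[leRHS]mulr1 ler_pM// qform_lipschitz.
have h3 : `|qform A y * (x i 0 - y i 0)| <= n%:R ^+ 2 * \tr A * d.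
  by rewrite normrM ler_pM// norm_qform_le.
apply: (le_trans (ler_normD _ _)); rewrite normrN.
apply: (le_trans (lerD h1 (le_trans (ler_normD _ _) (lerD h2 h3)))).
by rewrite /vfield_cst le_eqVlt; apply/orP; left; apply/eqP; ring.
Qed.

(** * Trajectories and their second-order expansion *)

Lemma mx_integralE R (m n : nat) (F : R -> 'M[R]_(m, n)) (s t : R) i j :
  mx_integral `[s, t] F i j = integ (fun u => F u i j) s t.
Proof. by rewrite mxE. Qed.

Lemma qform_integral R (n : nat) (S : R -> 'M[R]_n) (x : 'cV[R]_n) (s t : R) :
  mx_integrable `[s, t] S ->
  integrable_on (fun u => qform (S u) x) s t /\
  qform (mx_integral `[s, t] S) x = integ (fun u => qform (S u) x) s t.
Proof.
move=> itS; have itSij i j : integrable_on (fun u => x i 0 * S u i j * x j 0) s t.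
  apply: (@eq_integrable_on _ (fun u => (x i 0 * x j 0) * S u i j)).
    by move=> u _; ring.
  exact/integrable_onZ/itS.
have E u : qform (S u) x = \sum_i \sum_j x i 0 * S u i j * x j 0 by exact: qformE.
split.
  under eq_fun do rewrite E; apply: integrable_on_sum => i _.
  by apply: integrable_on_sum => j _.
rewrite qformE; under [in RHS]eq_fun do rewrite E.
rewrite integ_sum => [|i _]; last by apply: integrable_on_sum => j _.
apply: eq_bigr => i _; rewrite integ_sum//; apply: eq_bigr => j _.
rewrite mx_integralE -[RHS](eq_integ (f := fun u => (x i 0 * x j 0) * S u i j)).
  by rewrite integZ; [ring|exact: itS].
by move=> u _; ring.
Qed.

(** With the state frozen the field is linear in the matrix, so integration passes inside. The
    first-order term of the expansion below thus depends on the control only through the increments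
    of its primitive. *)
Lemma vfield_integral R (n : nat) (S : R -> 'M[R]_n) (x : 'cV[R]_n) (s t : R) i :
  mx_integrable `[s, t] S ->
  integrable_on (fun u => vfield (S u) x i 0) s t /\
  vfield (mx_integral `[s, t] S) x i 0 = integ (fun u => vfield (S u) x i 0) s t.
Proof.
move=> itS; have [itq qE] := qform_integral x itS.
have itSj j : integrable_on (fun u => S u i j * x j 0) s t.
  under eq_fun do rewrite mulrC; exact/integrable_onZ/itS.
have itSx : integrable_on (fun u => \sum_j S u i j * x j 0) s t.
  by apply: integrable_on_sum => j _.
have itqx : integrable_on (fun u => qform (S u) x * x i 0) s t.
  by under eq_fun do rewrite mulrC; exact/integrable_onZ.
split; first by under eq_fun do rewrite vfieldE addrC; exact: integrable_onB.
under [X in _ = integ X _ _]eq_fun do rewrite vfieldE addrC.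
rewrite integB// vfieldE qE addrC; congr (_ - _).
  by rewrite mulrC -integZ//; apply: eq_integ => u _; rewrite mulrC.
rewrite integ_sum//; apply: eq_bigr => j _; rewrite mx_integralE.
rewrite mulrC -integZ; last exact: itS.
by apply: eq_integ => u _; rewrite mulrC.
Qed.

Lemma tr_integral R (n : nat) (S : R -> 'M[R]_n) (s t : R) :
  mx_integrable `[s, t] S ->
  integrable_on (fun u => \tr (S u)) s t /\
  \tr (mx_integral `[s, t] S) = integ (fun u => \tr (S u)) s t.
Proof.
move=> itS; split; first by apply: integrable_on_sum => i _; exact: itS.
rewrite integ_sum => [|i _]; last exact: itS.
by apply: eq_bigr => i _; rewrite mxE.
Qed.

Lemma mx_integrableS R (m n : nat) (F : R -> 'M[R]_(m, n)) (s t s' t' : R) :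
  s <= s' -> t' <= t -> mx_integrable `[s, t] F -> mx_integrable `[s', t'] F.
Proof. by move=> ss tt itF i j; exact: (integrable_onS ss tt (itF i j)). Qed.

Lemma mx_integral_split R (m n : nat) (F : R -> 'M[R]_(m, n)) (s u t : R) :
  s <= u -> u <= t -> mx_integrable `[s, t] F ->
  mx_integral `[s, t] F = mx_integral `[s, u] F + mx_integral `[u, t] F.
Proof.
move=> su ut itF; apply/matrixP => i j; rewrite !mxE; apply: integ_split => //.
exact: itF.
Qed.

Lemma mx_integral_nil R (m n : nat) (F : R -> 'M[R]_(m, n)) (s : R) :
  mx_integral `[s, s] F = 0.
Proof. by apply/matrixP => i j; rewrite mx_integralE integ_nil mxE. Qed.

Lemma psd_integral R (n : nat) (S : R -> 'M[R]_n) (s t : R) :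
  mx_integrable `[s, t] S -> (forall u, s <= u <= t -> psd (S u)) ->
  psd (mx_integral `[s, t] S).
Proof.
move=> itS pS; split.
  apply/matrixP => i j; rewrite mxE !mx_integralE; apply: eq_integ => u /pS[+ _].
  by move=> /matrixP/(_ j i); rewrite mxE.
move=> x; have [_ ->] := qform_integral x itS.
by apply: integ_ge0 => u /pS[].
Qed.

Lemma integ_continuous R (f : R -> R) (T : R) : 0 <= T ->
  integrable_on f 0 T -> {within `[0, T], continuous (integ f 0)}.
Proof. by move=> T0 itf; exact: parameterized_integral_continuous. Qed.

Lemma integ_measurable R (f : R -> R) (T : R) : 0 <= T ->
  integrable_on f 0 T -> measurable_fun `[0, T] (integ f 0).
Proof.
move=> T0 itf; apply: subspace_continuous_measurable_fun => //.
exact: integ_continuous.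
Qed.

Lemma measurable_eq_on R (f g : R -> R) (s t : R) :
  (forall x, s <= x <= t -> f x = g x) -> measurable_fun `[s, t] f ->
  measurable_fun `[s, t] g.
Proof.
move=> fg; apply: eq_measurable_fun => x; rewrite inE/= in_itv/=; exact: fg.
Qed.

Lemma primitive_measurable R (m n : nat) (T : R) (x0 : 'M[R]_(m, n))
    (f x : R -> 'M[R]_(m, n)) i j : 0 <= T ->
  primitive_on T x0 f x -> measurable_fun `[0, T] (fun t => x t i j).
Proof.
move=> T0 [itf xE].
apply: (@measurable_eq_on R (fun t => x0 i j + integ (fun u => f u i j) 0 t)).
  by move=> t /xE ->; rewrite mxE mx_integralE.
by apply: measurable_funD => //; exact: (integ_measurable T0 (itf i j)).
Qed.

Lemma primitive_increment R (m n : nat) (T : R) (x0 : 'M[R]_(m, n))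
    (f x : R -> 'M[R]_(m, n)) (s t : R) i j :
  primitive_on T x0 f x -> 0 <= s -> s <= t -> t <= T ->
  x t i j - x s i j = integ (fun u => f u i j) s t.
Proof.
move=> [itf xE] s0 st tT.
rewrite (xE t) ?(le_trans s0)// (xE s) ?s0 ?(le_trans st)// !mxE.
rewrite -!/(integ _ _ _) (integ_split s0 st); first by ring.
exact: integrable_onS (itf i j).
Qed.

Lemma primitive_start R (m n : nat) (T : R) (x0 : 'M[R]_(m, n))
    (f x : R -> 'M[R]_(m, n)) : 0 <= T -> primitive_on T x0 f x -> x 0 = x0.
Proof. by move=> T0 [_ /(_ 0)]; rewrite lexx T0 => ->//; rewrite mx_integral_nil addr0. Qed.

Lemma integrable_on_qform R (n : nat) (S : R -> 'M[R]_n)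
    (w : R -> 'cV[R]_n) (s t : R) :
  mx_integrable `[s, t] S -> (forall i, measurable_fun `[s, t] (fun u => w u i 0)) ->
  (forall u i, s <= u <= t -> `|w u i 0| <= 1) ->
  integrable_on (fun u => qform (S u) (w u)) s t.
Proof.
move=> itS mw w1.
have E u : qform (S u) (w u) = \sum_i \sum_j w u i 0 * S u i j * w u j 0.
  exact: qformE.
under eq_fun do rewrite E.
apply: integrable_on_sum => i _; apply: integrable_on_sum => j _.
apply: (integrable_onM_bounded (C := 1)) => // [|u /w1//].
under eq_fun do rewrite mulrC.
by apply: (integrable_onM_bounded (C := 1)) => // [|u /w1//]; exact: itS.
Qed.

Lemma integrable_on_vfield R (n : nat) (S : R -> 'M[R]_n)
    (w : R -> 'cV[R]_n) (s t : R) i :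
  mx_integrable `[s, t] S -> (forall i, measurable_fun `[s, t] (fun u => w u i 0)) ->
  (forall u i, s <= u <= t -> `|w u i 0| <= 1) ->
  integrable_on (fun u => vfield (S u) (w u) i 0) s t.
Proof.
move=> itS mw w1; under eq_fun do rewrite vfieldE addrC.
apply: integrable_onB.
  apply: (integrable_onM_bounded (C := 1)) => // [|u /w1//].
  exact: integrable_on_qform.
apply: integrable_on_sum => j _.
by apply: (integrable_onM_bounded (C := 1)) => // [|u /w1//]; exact: itS.
Qed.

(* Time-parametrization-friendly form of the dynamics: the triple (integral of
   the control, trajectory, running cost) solves the equations up to errors of
   second order in the time step. It involves no derivative and no integral,
   and so passes to pointwise limits. *)
Definition sewn R (n : nat) (T kap K : R) (F : R -> 'M[R]_n)
    (w : R -> 'cV[R]_n) (V : R -> R) : Prop :=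
  [/\ forall s t, 0 <= s -> s <= t -> t <= T ->
        psd (F t - F s) /\ \tr (F t - F s) = kap * (t - s),
      forall t, 0 <= t <= T -> unit_sphere (w t),
      forall s t i, 0 <= s -> s <= t -> t <= T ->
        `|w t i 0 - w s i 0 - vfield (F t - F s) (w s) i 0| <= K * (t - s) ^+ 2 &
      forall s t, 0 <= s -> s <= t -> t <= T ->
        `|V t - V s - qform (F t - F s) (w s)| <= K * (t - s) ^+ 2].

(** On [[s, t]] each coordinate moves by at most [vfield_cst R n * d]; inserting this in the
    Lipschitz estimates and integrating against the trace gives the square. The error is measured by
    the trace integral [d] and not by t - s, so it is unaffected by a change of time. *)
Lemma trajectory_second_order R (n : nat) (T : R) (S : R -> 'M[R]_n)
    (w0 : 'cV[R]_n) (w : R -> 'cV[R]_n) (s t : R) :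
  (forall u, 0 <= u <= T -> psd (S u)) -> mx_integrable `[0, T] S ->
  sphere_trajectory T S w0 w -> 0 <= s -> s <= t -> t <= T ->
  let d := integ (fun u => \tr (S u)) s t in
  (forall i, `|w t i 0 - w s i 0 - vfield (mx_integral `[s, t] S) (w s) i 0| <=
     (vfield_cst R n * d) ^+ 2) /\
  `|integ (fun u => qform (S u) (w u)) s t - qform (mx_integral `[s, t] S) (w s)|
    <= (vfield_cst R n * d) ^+ 2.
Proof.
move=> pS itS [w1 wP] s0 st tT d.
have itSst : mx_integrable `[s, t] S by exact: mx_integrableS itS.
have T0 : 0 <= T by rewrite (le_trans s0)// (le_trans st).
have inT u : s <= u <= t -> 0 <= u <= T.
  by move=> /andP[su ut]; rewrite (le_trans s0 su) (le_trans ut tT).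
have wc u i : s <= u <= t -> `|w u i 0| <= 1.
  by move=> /inT /w1 /unit_sphere_coord.
have mw i : measurable_fun `[s, t] (fun u => w u i 0).
  apply: (@measurable_funS _ _ _ _ `[0, T]%classic) => //.
  exact: primitive_measurable T0 wP.
have [ittr _] := tr_integral itSst.
have tr0 u : s <= u <= t -> 0 <= \tr (S u) by move=> /inT/pS; exact: psd_tr_ge0.
have c0 := vfield_cst_ge0 R n.
have d0 : 0 <= d by exact: integ_ge0.
have sst : s <= s <= t by rewrite lexx.
have wlip u i : s <= u <= t -> `|w u i 0 - w s i 0| <= vfield_cst R n * d.
  move=> /andP[su ut].
  rewrite (primitive_increment i 0 wP s0 su (le_trans ut tT)).
  have ittru : integrable_on (fun u => \tr (S u)) s u by exact: integrable_onS ittr.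
  apply: (@le_trans _ _ (integ (fun u => vfield_cst R n * \tr (S u)) s u)).
    apply: norm_integ_le.
    - apply: (integrable_onS _ _ (integrable_on_vfield i itSst mw wc)) => //.
    - exact: integrable_onZ.
    - move=> v /andP[sv vu]; have vst : s <= v <= t by rewrite sv (le_trans vu).
      by apply: norm_vfield_le => [|j]; [exact/pS/inT|exact: wc].
  rewrite integZ// ler_wpM2l// /d (integ_split su ut)//.
  by rewrite lerDl integ_ge0// => v /andP[uv vt]; rewrite tr0// vt (le_trans su).
have itd (h : R) : integrable_on (fun u => h * \tr (S u)) s t by exact: integrable_onZ.
split=> [i|].
  have [itv vE] := vfield_integral (w s) i itSst.
  have itvw := integrable_on_vfield i itSst mw wc.
  rewrite (primitive_increment i 0 wP s0 st tT) vE -integB//.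
  apply: (@le_trans _ _ (integ (fun u => vfield_cst R n * (vfield_cst R n * d) * \tr (S u)) s t)).
    apply: norm_integ_le => //; first exact: integrable_onB.
    move=> u ust; rewrite mulrAC.
    apply: vfield_lipschitz => [|j|j|j]; [exact/pS/inT|exact: wc|exact: wc|exact: wlip].
  by rewrite integZ// le_eqVlt; apply/orP; left; apply/eqP; rewrite -/d; ring.
have [itq qE] := qform_integral (w s) itSst.
have itqw := integrable_on_qform itSst mw wc.
rewrite qE -integB//.
apply: (@le_trans _ _ (integ (fun u => vfield_cst R n * (vfield_cst R n * d) * \tr (S u)) s t)).
  apply: norm_integ_le => //; first exact: integrable_onB.
  move=> u ust; rewrite mulrAC.
  apply: (le_trans (qform_lipschitz _ _ _ (fun j => wlip u j ust))) => //.
  - exact/pS/inT.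
  - by move=> j; exact: wc.
  - by move=> j; exact: wc.
  rewrite ler_wpM2r ?mulr_ge0// ler_wpM2r ?tr0// /vfield_cst.
  by have n0 := ler0n R n; have n2 := sqr_ge0 (n%:R : R); lra.
by rewrite integZ// le_eqVlt; apply/orP; left; apply/eqP; rewrite -/d; ring.
Qed.

(** Test the two matrix inequalities on the basis vectors and add up the diagonal entries. *)
Lemma admissible_trace R (n : nat) (a b T : R) (S : R -> 'M[R]_n) :
  admissible a b T S ->
  n%:R * a <= integ (fun u => \tr (S u)) 0 T <= n%:R * b.
Proof.
move=> [pS itS la lb]; have [_ <-] := tr_integral itS.
have dE i : bform (mx_integral `[0, T] S) (delta_mx i 0) (delta_mx i 0) =
   mx_integral `[0, T] S i i by exact: bform_delta.
have d1 (i : 'I_n) : dotp (delta_mx i 0) (delta_mx i 0) = 1 :> R.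
  have := bform_delta (1%:M : 'M[R]_n) i i.
  by rewrite bform_dotp mul1mx mxE eqxx.
have ha i : a <= mx_integral `[0, T] S i i.
  by have := la (delta_mx i 0); rewrite qform_scalar d1 mulr1 qform_bform dE.
have hb i : mx_integral `[0, T] S i i <= b.
  by have := lb (delta_mx i 0); rewrite qform_scalar d1 mulr1 qform_bform dE.
have sumE (c : R) : n%:R * c = \sum_(i < n) c by rewrite sumr_const card_ord mulr_natl.
by rewrite !sumE; apply/andP; split; apply: ler_sum => i _.
Qed.

(* The time change normalizes the trace of the control. *)
Lemma sewn_of_trajectory R (n : nat) (a b T : R) (S : R -> 'M[R]_n)
    (w0 : 'cV[R]_n) (w : R -> 'cV[R]_n) :
  0 < T -> 0 < a -> (0 < n)%N ->
  admissible a b T S -> sphere_trajectory T S w0 w ->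
  exists (kap : R) (F : R -> 'M[R]_n) (w' : R -> 'cV[R]_n) (V : R -> R),
    [/\ n%:R * a / T <= kap <= n%:R * b / T,
        sewn T kap ((vfield_cst R n * kap) ^+ 2) F w' V,
        F 0 = 0 /\ F T = mx_integral `[0, T] S &
        V 0 = 0 /\ V T = cost T S w].
Proof.
move=> T0 a0 n0 adm wS; have /andP[trL trU] := admissible_trace adm.
have [pS itS _ _] := adm; have T0' := ltW T0.
have [ittr _] := tr_integral itS.
set L := integ (fun u => \tr (S u)) 0 T in trL trU.
have L0 : 0 < L by apply: lt_le_trans trL; rewrite mulr_gt0// ltr0n.
pose kap := L / T.
have kap0 : 0 < kap by rewrite divr_gt0.
pose sg := integ (fun u => \tr (S u)) 0.
have sg_incr s t : 0 <= s -> s <= t -> t <= T ->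
    sg t - sg s = integ (fun u => \tr (S u)) s t.
  move=> s0 st tT; rewrite /sg (integ_split s0 st); first by ring.
  exact: integrable_onS ittr.
have sg_nd s t : 0 <= s -> s <= t -> t <= T -> sg s <= sg t.
  move=> s0 st tT; rewrite -subr_ge0 sg_incr// integ_ge0// => u /andP[su ut].
  by apply/psd_tr_ge0/pS; rewrite (le_trans s0)//= (le_trans ut).
have sg0 : sg 0 = 0 by rewrite /sg integ_nil.
have sgc : {within `[0, T], continuous sg} by exact: integ_continuous.
(* [sg] is flat wherever the trace vanishes, so [tau] is only a right inverse, picked through the
   intermediate value theorem. It may jump over flat parts, on which the control has zero integral;
   prescribing its values at 0 and [T] makes it span the whole interval. *)
have /choice[tau tauP] : forall x, exists t, 0 <= x <= T ->
    [/\ 0 <= t <= T, sg t = kap * x, x = 0 -> t = 0 & x = T -> t = T].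
  move=> x; have [->|x0] := eqVneq x 0.
    exists 0 => _; split=> //; first by rewrite lexx.
    by rewrite sg0 mulr0.
  have [->|xT] := eqVneq x T.
    exists T => _; split=> //; first by rewrite lexx andbT.
    by rewrite /kap divfK ?gt_eqF.
  have [xr|xr] := boolP (0 <= x <= T); last by exists 0.
  have /andP[x0' xT'] := xr.
  have [|t] := @IVT R sg 0 T (kap * x) T0' sgc.
    rewrite sg0 ge_min le_max -/L (mulr_ge0 (ltW kap0) x0')/= /kap.
    by apply/orP; right; rewrite -[sg T]/L mulrAC ler_pdivrMr// ler_pM2l.
  rewrite in_itv/= => tT tE; exists t => _.
  by split=> //; move/eqP; rewrite ?(negbTE x0) ?(negbTE xT).
(* A decrease of [tau] would contradict the monotonicity of [sg], since [sg] composed with [tau] is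
   strictly increasing. *)
have tau_nd x y : 0 <= x -> x <= y -> y <= T -> tau x <= tau y.
  move=> x0 xy yT.
  have [/andP[tx0 txT] sx _ _] := tauP x (introT andP (conj x0 (le_trans xy yT))).
  have [/andP[ty0 tyT] sy _ _] := tauP y (introT andP (conj (le_trans x0 xy) yT)).
  move: xy; rewrite le_eqVlt => /predU1P[->//|xy].
  rewrite leNgt; apply/negP => /ltW /(sg_nd _ _ ty0) => /(_ txT).
  by rewrite sx sy ler_pM2l// leNgt xy.
exists kap, (fun x => mx_integral `[0, tau x] S), (fun x => w (tau x)),
  (fun x => integ (fun u => qform (S u) (w u)) 0 (tau x)).
have tau0 : tau 0 = 0 by have [|_ _ ->] := tauP 0; rewrite ?lexx.
have tauT : tau T = T by have [|_ _ _ ->] := tauP T; rewrite ?lexx ?andbT.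
have Fincr x y : 0 <= x -> x <= y -> y <= T ->
    mx_integral `[0, tau y] S - mx_integral `[0, tau x] S =
    mx_integral `[tau x, tau y] S /\
    integ (fun u => \tr (S u)) (tau x) (tau y) = kap * (y - x).
  move=> x0 xy yT; have txy := tau_nd _ _ x0 xy yT.
  have [/andP[tx0 txT] sx _ _] := tauP x (introT andP (conj x0 (le_trans xy yT))).
  have [/andP[ty0 tyT] sy _ _] := tauP y (introT andP (conj (le_trans x0 xy) yT)).
  rewrite (mx_integral_split tx0 txy); last exact: mx_integrableS itS.
  by rewrite addrC addKr -sg_incr// sx sy mulrBr.
split.
- by rewrite /kap !ler_pM2r ?invr_gt0// trL.
- split.
  + move=> x y x0 xy yT; have [-> trE] := Fincr x y x0 xy yT.
    have txy := tau_nd _ _ x0 xy yT.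
    have [/andP[tx0 txT] _ _ _] := tauP x (introT andP (conj x0 (le_trans xy yT))).
    have [/andP[ty0 tyT] _ _ _] := tauP y (introT andP (conj (le_trans x0 xy) yT)).
    have itxy : mx_integrable `[tau x, tau y] S by exact: mx_integrableS itS.
    split; last by have [_ ->] := tr_integral itxy.
    apply: psd_integral => // u /andP[xu uy]; apply: pS.
    by rewrite (le_trans tx0)//= (le_trans uy).
  + by move=> x /tauP[tx _ _ _]; have [+ _] := wS; apply.
  + move=> x y i x0 xy yT; have [-> trE] := Fincr x y x0 xy yT.
    have txy := tau_nd _ _ x0 xy yT.
    have [/andP[tx0 txT] _ _ _] := tauP x (introT andP (conj x0 (le_trans xy yT))).
    have [/andP[ty0 tyT] _ _ _] := tauP y (introT andP (conj (le_trans x0 xy) yT)).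
    have [/(_ i) + _] := trajectory_second_order pS itS wS tx0 txy tyT.
    by rewrite trE mulrA exprMn.
  + move=> x y x0 xy yT; have [-> trE] := Fincr x y x0 xy yT.
    have txy := tau_nd _ _ x0 xy yT.
    have [/andP[tx0 txT] _ _ _] := tauP x (introT andP (conj x0 (le_trans xy yT))).
    have [/andP[ty0 tyT] _ _ _] := tauP y (introT andP (conj (le_trans x0 xy) yT)).
    have [_] := trajectory_second_order pS itS wS tx0 txy tyT.
    rewrite trE mulrA exprMn (integ_split tx0 txy).
      by rewrite [X in _ -> `|X - _| <= _]addrAC subrr add0r.
    apply: (integrable_onS (s := 0) (t := T)) => //.
    apply: integrable_on_qform => // [i|u i].
      by have [_ wP] := wS; exact: primitive_measurable wP.
    by move=> uT; apply: unit_sphere_coord; have [+ _] := wS; apply.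
- by rewrite tau0 tauT mx_integral_nil.
- by rewrite tau0 tauT integ_nil.
Qed.

(** * Existence of a minimizer *)

(** Compactness of a segment provides a cluster point, and for an ultrafilter a cluster point is a
    limit: of a set and its complement one belongs to the filter. *)
Lemma bounded_ultra_cvg R (I : Type) (U : set_system I) (u : I -> R) (C : R) :
  UltraFilter U -> (forall k, `|u k| <= C) -> exists l : R, u @ U --> l.
Proof.
move=> UU uC; have PU : ProperFilter U by exact: (@ultra_proper _ _ UU).
have [] := @segment_compact R (- C) C (u @ U).
  by rewrite /fmap /=; apply: filterS filterT => k _ /=; rewrite in_itv/= -ler_norml.
move=> l [_ lcl]; exists l => B nB.
have [//|/= nUB] := in_ultra_setVsetC (u @^-1` B) UU.
by have [x [/=]] := lcl (~` B) B nUB nB.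
Qed.

Lemma cvg_sumr R (I : Type) (U : set_system I) (J : Type) (r : seq J)
    (P : pred J) (f : J -> I -> R) (l : J -> R) :
  Filter U -> (forall j, f j @ U --> l j) ->
  (fun k => \sum_(j <- r | P j) f j k) @ U --> \sum_(j <- r | P j) l j.
Proof.
move=> FU fl; elim: r => [|j r IH].
  under eq_fun do rewrite big_nil; rewrite big_nil; exact: cvg_cst.
under eq_fun do rewrite big_cons; rewrite big_cons.
by case: (P j) => //; apply: cvgD.
Qed.

(** Stated entrywise so that limits of products, traces and forms reduce to limits of reals. *)
Definition mx_cvg R (I : Type) (U : set_system I) (m n : nat)
    (A : I -> 'M[R]_(m, n)) (L : 'M[R]_(m, n)) : Prop :=
  forall i j, (fun k => A k i j) @ U --> L i j.

Lemma mx_cvgB R (I : Type) (U : set_system I) (m n : nat)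
    (A B : I -> 'M[R]_(m, n)) (L M : 'M[R]_(m, n)) : Filter U ->
  mx_cvg U A L -> mx_cvg U B M -> mx_cvg U (fun k => A k - B k) (L - M).
Proof.
move=> FU AL BM i j; rewrite !mxE; under eq_fun do rewrite !mxE.
by apply: cvgB; [exact: AL|exact: BM].
Qed.

Lemma mx_cvg_cst R (I : Type) (U : set_system I) (m n : nat)
    (L : 'M[R]_(m, n)) : Filter U -> mx_cvg U (fun=> L) L.
Proof. by move=> FU i j; exact: cvg_cst. Qed.

Lemma mx_cvg_mulmx R (I : Type) (U : set_system I) (m n p : nat)
    (A : I -> 'M[R]_(m, n)) (B : I -> 'M[R]_(n, p))
    (L : 'M[R]_(m, n)) (M : 'M[R]_(n, p)) : Filter U ->
  mx_cvg U A L -> mx_cvg U B M -> mx_cvg U (fun k => A k *m B k) (L *m M).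
Proof.
move=> FU AL BM i j; rewrite mxE; under eq_fun do rewrite mxE.
by apply: cvg_sumr => l; apply: cvgM; [exact: AL|exact: BM].
Qed.

Lemma mx_cvg_tr R (I : Type) (U : set_system I) (m n : nat)
    (A : I -> 'M[R]_(m, n)) (L : 'M[R]_(m, n)) :
  mx_cvg U A L -> mx_cvg U (fun k => (A k)^T) L^T.
Proof. by move=> AL i j; rewrite mxE; under eq_fun do rewrite mxE; exact: AL. Qed.

Lemma mx_cvg_unique R (I : Type) (U : set_system I) (m n : nat)
    (A : I -> 'M[R]_(m, n)) (L M : 'M[R]_(m, n)) : ProperFilter U ->
  mx_cvg U A L -> mx_cvg U A M -> L = M.
Proof.
move=> PU AL AM; apply/matrixP => i j.
exact: (cvg_unique (@Rhausdorff R) (AL i j) (AM i j)).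
Qed.

Lemma cvg_mxtrace R (I : Type) (U : set_system I) (n : nat)
    (A : I -> 'M[R]_n) (L : 'M[R]_n) : Filter U ->
  mx_cvg U A L -> (fun k => \tr (A k)) @ U --> \tr L.
Proof. by move=> FU AL; apply: cvg_sumr. Qed.

Lemma cvg_qform R (I : Type) (U : set_system I) (n : nat)
    (A : I -> 'M[R]_n) (L : 'M[R]_n) (x : I -> 'cV[R]_n) (y : 'cV[R]_n) : Filter U ->
  mx_cvg U A L -> mx_cvg U x y -> (fun k => qform (A k) (x k)) @ U --> qform L y.
Proof.
move=> FU AL xy; apply: (@mx_cvg_mulmx _ _ _ _ _ _ _ _ (y^T *m L) y) => //.
by apply: mx_cvg_mulmx => //; exact: mx_cvg_tr.
Qed.

Lemma cvg_dotp R (I : Type) (U : set_system I) (n : nat)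
    (x y : I -> 'cV[R]_n) (l m : 'cV[R]_n) : Filter U ->
  mx_cvg U x l -> mx_cvg U y m -> (fun k => dotp (x k) (y k)) @ U --> dotp l m.
Proof.
move=> FU xl ym; apply: (@mx_cvg_mulmx _ _ _ _ _ _ _ _ l^T m) => //.
exact: mx_cvg_tr.
Qed.

Lemma cvg_vfield R (I : Type) (U : set_system I) (n : nat)
    (A : I -> 'M[R]_n) (L : 'M[R]_n) (x : I -> 'cV[R]_n) (y : 'cV[R]_n) i : Filter U ->
  mx_cvg U A L -> mx_cvg U x y -> (fun k => vfield (A k) (x k) i 0) @ U --> vfield L y i 0.
Proof.
move=> FU AL xy; rewrite vfieldE; under eq_fun do rewrite vfieldE.
apply: cvgD; first apply: cvgN.
  by apply: cvg_sumr => j; apply: cvgM; [exact: AL|exact: xy].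
by apply: cvgM; [exact: cvg_qform|exact: xy].
Qed.

Lemma cvg_le R (U : set_system nat) (f g : nat -> R) (l m : R) :
  ProperFilter U -> f @ U --> l -> g @ U --> m -> (forall k, f k <= g k) -> l <= m.
Proof. by move=> PU fl gm fg; apply: (ler_cvg_to fl gm); exact: filterE. Qed.

Lemma psd_cvg R (U : set_system nat) (n : nat)
    (A : nat -> 'M[R]_n) (L : 'M[R]_n) : ProperFilter U ->
  mx_cvg U A L -> (forall k, psd (A k)) -> psd L.
Proof.
move=> PU AL pA; split.
  apply: (mx_cvg_unique PU _ AL).
  suff -> : A = fun k => (A k)^T by exact: mx_cvg_tr.
  by apply/funext => k; have [->] := pA k.
move=> x; have h : (fun k => qform (A k) x) @ U --> qform L x.
  by apply: cvg_qform => //; exact: mx_cvg_cst.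
by apply: (cvg_le PU (cvg_cst (0 : R)) h) => k; have [_] := pA k.
Qed.

(** Each condition in [sewn] is closed and involves at most two times, so it passes to limits taken
    separately at every time; such limits exist because the data are bounded uniformly in [k]. *)
Lemma sewn_ultralimit R (n : nat) (T K a b : R) (m : R)
    (kap : nat -> R) (F : nat -> R -> 'M[R]_n) (w : nat -> R -> 'cV[R]_n)
    (V : nat -> R -> R) (kl ku : R) : 0 < T ->
  (forall k, kl <= kap k <= ku) ->
  (forall k, sewn T (kap k) K (F k) (w k) (V k)) ->
  (forall k, F k 0 = 0) -> (forall k, loewner_le a%:M (F k T)) ->
  (forall k, loewner_le (F k T) b%:M) ->
  (forall k, V k 0 = 0) -> (fun k => V k T) @ \oo --> m ->
  exists (kap' : R) (F' : R -> 'M[R]_n) (w' : R -> 'cV[R]_n) (V' : R -> R),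
    [/\ kl <= kap' <= ku, sewn T kap' K F' w' V',
        F' 0 = 0 /\ loewner_le a%:M (F' T) /\ loewner_le (F' T) b%:M &
        V' 0 = 0 /\ V' T = m].
Proof.
move=> T0 kapb sF F0 Fa Fb V0 VT.
(* One ultrafilter refining [\oo] gives limits at all times and for all entries simultaneously, and
   it preserves the given limit of the costs. *)
have [U [UU Uoo]] := ultraFilterLemma (@eventually_filter).
have PU : ProperFilter U by exact: (@ultra_proper _ _ UU).
have FU : Filter U by exact: filter_filter.
have T0' := ltW T0.
have T00 : (0 : R) <= 0 <= T by rewrite lexx.
have TT : 0 <= T <= T by rewrite T0' lexx.
have ku0 : 0 <= `|ku| by [].
have kapT k t : 0 <= t <= T -> kap k * t <= `|ku| * T.
  move=> /andP[t0 tT]; have /andP[_ h] := kapb k.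
  apply: le_trans (_ : `|ku| * t <= _); last by rewrite ler_wpM2l.
  by rewrite ler_wpM2r// (le_trans h)// ler_norm.
have FB k t i j : 0 <= t <= T -> `|F k t i j| <= `|ku| * T.
  move=> tT; have /andP[t0 tT'] := tT; have [+ _ _ _] := sF k.
  move=> /(_ 0 t (lexx _) t0 tT'); rewrite F0 !subr0 => -[pF trF].
  by rewrite (le_trans (psd_entry i j pF))// trF kapT.
(* The running cost is bounded through its own second-order estimate between 0 and [t]. *)
have VB k t : 0 <= t <= T -> `|V k t| <= `|K| * T ^+ 2 + n%:R ^+ 2 * (`|ku| * T).
  move=> tT; have /andP[t0 tT'] := tT; have [+ sw _ +] := sF k.
  move=> /(_ 0 t (lexx _) t0 tT') + /(_ 0 t (lexx _) t0 tT').
  rewrite F0 V0 !subr0 => -[pF trF] h.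
  rewrite -[V k t](subrK (qform (F k t) (w k 0))).
  apply: (le_trans (ler_normD _ _)); apply: lerD.
    apply: (le_trans h); apply: le_trans (_ : `|K| * t ^+ 2 <= _).
      by rewrite ler_wpM2r ?sqr_ge0// ler_norm.
    by rewrite ler_wpM2l// ler_pXn2r.
  apply: (le_trans (norm_qform_le pF _)).
    by move=> i; apply: unit_sphere_coord; exact: sw.
  by rewrite ler_wpM2l ?sqr_ge0// trF kapT.
have [kap' kapc] : exists l : R, kap @ U --> l.
  apply: (bounded_ultra_cvg (C := `|kl| + `|ku|) UU) => k.
  have /andP[h1 h2] := kapb k; rewrite ler_norml.
  have := ler_norm ku; have := ler_norm kl; have := ler_norm (- kl).
  by rewrite normrN => *; apply/andP; split; lra.
have /choice[F' Fc] : forall t, exists L, 0 <= t <= T -> mx_cvg U (fun k => F k t) L.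
  move=> t; have [tT|] := boolP (0 <= t <= T); last by exists 0.
  have h (p : 'I_n * 'I_n) : exists l : R, (fun k => F k t p.1 p.2) @ U --> l.
    by apply: (bounded_ultra_cvg UU) => k; exact: FB.
  have /choice[L LP] := h; exists (\matrix_(i, j) L (i, j)) => _ i j.
  by rewrite mxE; exact: (LP (i, j)).
have /choice[w' wc] : forall t, exists x, 0 <= t <= T -> mx_cvg U (fun k => w k t) x.
  move=> t; have [tT|] := boolP (0 <= t <= T); last by exists 0.
  have h (i : 'I_n) : exists l : R, (fun k => w k t i 0) @ U --> l.
    apply: (bounded_ultra_cvg (C := 1) UU) => k; apply: unit_sphere_coord.
    by have [_ + _ _] := sF k; apply.
  have /choice[L LP] := h; exists (\col_i L i) => _ i j.
  by rewrite ord1 mxE; exact: (LP i).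
have /choice[V' Vc] : forall t, exists x : R, 0 <= t <= T -> (fun k => V k t) @ U --> x.
  move=> t; have [tT|] := boolP (0 <= t <= T); last by exists 0.
  have [l lP] : exists l : R, (fun k => V k t) @ U --> l.
    by apply: (bounded_ultra_cvg UU) => k; exact: VB.
  by exists l.
have inT s t : 0 <= s -> s <= t -> t <= T -> 0 <= s <= T /\ 0 <= t <= T.
  by move=> s0 st tT; rewrite s0 (le_trans s0 st) (le_trans st tT) tT.
have cvgx x : (fun k => qform (F k T) x) @ U --> qform (F' T) x.
  by apply: cvg_qform; [exact: Fc|exact: mx_cvg_cst].
exists kap', F', w', V'; split.
- by apply/andP; split; [apply: (cvg_le PU (cvg_cst kl) kapc)|
     apply: (cvg_le PU kapc (cvg_cst ku))] => k; have /andP[] := kapb k.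
- split.
  + move=> s t s0 st tT; have [sI tI] := inT s t s0 st tT.
    have Fst := mx_cvgB FU (Fc t tI) (Fc s sI); split.
      by apply: (psd_cvg PU Fst) => k; have [+ _ _ _] := sF k; move=> /(_ s t s0 st tT)[].
    apply: (cvg_unique (@Rhausdorff R) (cvg_mxtrace FU Fst)).
    rewrite (_ : (fun k => \tr (F k t - F k s)) = (fun k => kap k * (t - s))).
      by apply: cvgM => //; exact: cvg_cst.
    by apply/funext => k; have [+ _ _ _] := sF k; move=> /(_ s t s0 st tT)[].
  + move=> t tT; apply/unit_sphereE.
    apply: (cvg_unique (@Rhausdorff R) (cvg_dotp FU (wc t tT) (wc t tT))).
    rewrite (_ : (fun k => dotp (w k t) (w k t)) = fun=> 1); first exact: cvg_cst.
    by apply/funext => k; apply/unit_sphereE; have [_ + _ _] := sF k; apply.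
  + move=> s t i s0 st tT; have [sI tI] := inT s t s0 st tT.
    have Fst := mx_cvgB FU (Fc t tI) (Fc s sI).
    have h : (fun k => w k t i 0 - w k s i 0 - vfield (F k t - F k s) (w k s) i 0) @ U
        --> w' t i 0 - w' s i 0 - vfield (F' t - F' s) (w' s) i 0.
      apply: cvgB; first by apply: cvgB; exact: wc.
      exact: cvg_vfield Fst (wc s sI).
    apply: (cvg_le PU (cvg_norm h) (cvg_cst (K * (t - s) ^+ 2))) => k.
    by have [_ _ + _] := sF k; apply.
  + move=> s t s0 st tT; have [sI tI] := inT s t s0 st tT.
    have Fst := mx_cvgB FU (Fc t tI) (Fc s sI).
    have h : (fun k => V k t - V k s - qform (F k t - F k s) (w k s)) @ U
        --> V' t - V' s - qform (F' t - F' s) (w' s).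
      apply: cvgB; first by apply: cvgB; exact: Vc.
      exact: cvg_qform Fst (wc s sI).
    apply: (cvg_le PU (cvg_norm h) (cvg_cst (K * (t - s) ^+ 2))) => k.
    by have [_ _ _ +] := sF k; apply.
- split.
    apply: (mx_cvg_unique PU (Fc 0 T00)).
    by under eq_fun do rewrite F0; exact: mx_cvg_cst.
  split=> x.
    apply: (cvg_le PU (cvg_cst (qform a%:M x)) (cvgx x)) => k; exact: Fa.
  apply: (cvg_le PU (cvgx x) (cvg_cst (qform b%:M x))) => k; exact: Fb.
- split.
    apply: (cvg_unique (@Rhausdorff R) (Vc 0 T00)).
    by rewrite /= (_ : (fun k => V k 0) = fun=> 0); [exact: cvg_cst|exact/funext].
  apply: (cvg_unique (@Rhausdorff R) (Vc T TT)).
  by move=> B /VT/Uoo.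
Qed.

(** * From increments back to a control *)

Lemma lipschitz_measurable R (f : R -> R) (K T : R) : 0 < T ->
  (forall s t, 0 <= s -> s <= t -> t <= T -> `|f t - f s| <= K * (t - s)) ->
  measurable_fun `[0, T] f.
Proof.
move=> T0 /(lipschitz_density T0)[g [_ itg fE _]].
apply: (@measurable_eq_on _ (fun t => f 0 + integ g 0 t)).
  by move=> t /fE.
by apply: measurable_funD => //; apply: integ_measurable => //; exact: ltW.
Qed.

Lemma psd_scalar_trace R (n : nat) (kap : R) : (0 < n)%N -> 0 <= kap ->
  psd ((kap / n%:R)%:M : 'M[R]_n) /\ \tr ((kap / n%:R)%:M : 'M[R]_n) = kap.
Proof.
move=> n0 k0; split; first by apply: psd_scalar; rewrite divr_ge0.
by rewrite mxtrace_scalar -[LHS]mulr_natr divfK// pnatr_eq0 -lt0n.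
Qed.

(** The trace makes the entries of [F] Lipschitz, so they have densities. Difference quotients of
    [F] are positive with trace [kap], and so are their limits. *)
Lemma increment_density R (n : nat) (T kap : R) (F : R -> 'M[R]_n) :
  0 < T -> (0 < n)%N -> F 0 = 0 ->
  (forall s t, 0 <= s -> s <= t -> t <= T ->
     psd (F t - F s) /\ \tr (F t - F s) = kap * (t - s)) ->
  exists S : R -> 'M[R]_n,
    [/\ forall t, psd (S t) /\ \tr (S t) = kap,
        forall i j, measurable_fun setT (fun t => S t i j) &
        forall t, 0 <= t <= T -> F t = mx_integral `[0, t] S].
Proof.
move=> T0 n0 F0 Finc.
have kap0 : 0 <= kap.
  have [pF] := Finc 0 T (lexx _) (ltW T0) (lexx _).
  by have := psd_tr_ge0 pF => + trE; rewrite trE subr0 pmulr_lge0.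
have [pB trB] := psd_scalar_trace n0 kap0; set B := _%:M in pB trB.
have Flip i j s t : 0 <= s -> s <= t -> t <= T ->
    `|F t i j - F s i j| <= kap * (t - s).
  move=> s0 st tT; have [pF <-] := Finc s t s0 st tT.
  by have := psd_entry i j pF; rewrite !mxE.
have h (p : 'I_n * 'I_n) := lipschitz_density T0 (Flip p.1 p.2).
have /choice[f fP] := h.
have : {ae @lebesgue_measure R, forall t, forall p : 'I_n * 'I_n, 0 < t < T ->
    (fun k : nat => k.+1%:R * (F (t + k.+1%:R^-1) p.1 p.2 - F t p.1 p.2)) @ \oo
      --> f p t}.
  apply: filter_forall => p; by have [_ _ _] := fP p.
move=> [A [mA A0 AP]].
(* [A] is a measurable null set; off it, inside []0, T[], all n^2 quotients converge. The density is
   used there and the default [B] elsewhere, so that the constraints hold at every time and not just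
   almost everywhere. *)
pose D := `]0, T[%classic `\` A.
have mD : measurable D by apply: measurableD.
have DP t : D t -> forall p : 'I_n * 'I_n,
    (fun k : nat => k.+1%:R * (F (t + k.+1%:R^-1) p.1 p.2 - F t p.1 p.2)) @ \oo
      --> f p t.
  move=> [/=]; rewrite in_itv/= => tT tA p.
  have : ~ (~` [set t | forall p : 'I_n * 'I_n, 0 < t < T ->
    (fun k : nat => k.+1%:R * (F (t + k.+1%:R^-1) p.1 p.2 - F t p.1 p.2)) @ \oo
      --> f p t]) t by move=> /AP.
  by move=> /contrapT /(_ p tT).
pose S t : 'M[R]_n := if t \in D then \matrix_(i, j) f (i, j) t else B.
have SE t i j : S t i j = f (i, j) t * \1_D t + B i j * (1 - \1_D t).
  rewrite /S indicE; case: (t \in D); last by rewrite mulr0 add0r subr0 mulr1.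
  by rewrite mxE mulr1 subrr mulr0 addr0.
have mS i j : measurable_fun setT (fun t => S t i j).
  under eq_fun do rewrite SE; have [mf _ _ _] := fP (i, j).
  have mI : measurable_fun setT (\1_D : R -> R) by exact: measurable_indic.
  apply: measurable_funD; first exact: measurable_funM.
  by apply: measurable_funM => //; exact: measurable_funB.
exists S; split => // [t|t /andP[t0 tT]].
  rewrite /S; case: ifPn => [/set_mem tD|_]; last by [].
  set M := \matrix_(_, _) _.
  have t0T : 0 < t < T by case: tD; rewrite /= in_itv.
  have /andP[t0 tT] := t0T.
  (* Past [T] the quotient is replaced by [B], so every [Q k] satisfies the constraints; for large
     [k] the test succeeds. *)
  pose Q k : 'M[R]_n := if t + k.+1%:R^-1 <= T
    then k.+1%:R *: (F (t + k.+1%:R^-1) - F t) else B.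
  have QM : mx_cvg \oo Q M.
    move=> i j; rewrite mxE.
    have := DP t tD (i, j); apply: cvg_trans; apply: near_eq_cvg; near=> k.
    rewrite /Q ifT; first by rewrite !mxE.
    rewrite -lerBrDl ltW//; near: k.
    by apply: (cvgr_lt 0 (@cvg_harmonic R)); rewrite subr_gt0.
  have Qp k : psd (Q k) /\ \tr (Q k) = kap.
    rewrite /Q; case: ifPn => // tkT.
    have [|||pF trF] := Finc t (t + k.+1%:R^-1); rewrite ?(ltW t0) ?lerDl//.
    split; first exact: psdZ.
    rewrite mxtraceZ trF addrAC subrr add0r.
    by rewrite mulrCA divff ?mulr1// pnatr_eq0.
  split; first by apply: (psd_cvg _ QM) => k; have [] := Qp k.
  apply: (cvg_unique (@Rhausdorff R) (cvg_mxtrace _ QM)).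
  rewrite /= (_ : (fun k => \tr (Q k)) = fun=> kap); first exact: cvg_cst.
  by apply/funext => k; have [] := Qp k.
apply/matrixP => i j; rewrite mx_integralE.
have [mf itf fE _] := fP (i, j).
have := fE t; rewrite t0 tT /= F0 mxE add0r => ->//.
congr fine; apply: ae_eq_integral => //.
- exact/measurable_EFinP/measurable_funTS.
- by apply/measurable_EFinP/measurable_funTS; exact: mS.
exists (A `|` ([set 0] `|` [set T])); split.
- by do !apply: measurableU.
- have m1 (r : R) : (@lebesgue_measure R) [set r] = 0 by exact: lebesgue_measure_set1.
  have m2 : (@lebesgue_measure R) ([set 0] `|` [set T]) = 0.
    by apply: (etrans (measureU0 _ _ (m1 T))) => //; exact: m1.
  by apply: (etrans (measureU0 _ _ m2)) => //; exact: measurableU.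
- move=> x /= /not_implyP[]; rewrite in_itv/= => /andP[x0 xt] fS.
  apply: contrapT => /not_orP[xA /not_orP[/eqP x0' /eqP xT]].
  apply: fS; congr EFin; rewrite /S mem_set ?mxE//; split => //=.
  by rewrite in_itv/= lt_neqAle eq_sym x0' x0 lt_neqAle xT (le_trans xt).
Unshelve. all: by end_near. Qed.

Lemma mx_integrable_bounded R (m n : nat) (F : R -> 'M[R]_(m, n)) (C s t : R) :
  (forall i j, measurable_fun setT (fun u => F u i j)) ->
  (forall u i j, s <= u <= t -> `|F u i j| <= C) -> mx_integrable `[s, t] F.
Proof.
move=> mF FC i j; apply: (@integrable_on_bounded _ _ _ _ C).
  exact: measurable_funTS.
by move=> u; exact: FC.
Qed.

(** The difference between [F] and the primitive has quadratic increments, hence is constant. *)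
Lemma primitive_of_second_order R (f F : R -> R) (T C : R) : 0 <= T ->
  integrable_on f 0 T ->
  (forall s t, 0 <= s -> s <= t -> t <= T ->
     `|F t - F s - integ f s t| <= C * (t - s) ^+ 2) ->
  forall t, 0 <= t <= T -> F t = F 0 + integ f 0 t.
Proof.
move=> T0 itf h t tT; have /andP[t0 tT'] := tT.
have := @norm_increment_quadratic R (fun t => F t - integ f 0 t) C T.
rewrite integ_nil subr0 => /(_ _ t tT) => <-; first by rewrite subrK.
move=> s u s0 su uT; rewrite (integ_split s0 su).
  rewrite (_ : _ - _ - _ = F u - F s - integ f s u); first exact: h.
  by ring.
exact: integrable_onS itf.
Qed.

Lemma trajectory_of_sewn R (n : nat) (T kap K : R) (F : R -> 'M[R]_n)
    (w : R -> 'cV[R]_n) (V : R -> R) :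
  0 < T -> (0 < n)%N -> F 0 = 0 -> sewn T kap K F w V ->
  exists S : R -> 'M[R]_n,
    [/\ forall t, psd (S t) /\ \tr (S t) = kap,
        forall i j, measurable_fun setT (fun t => S t i j),
        F T = mx_integral `[0, T] S,
        sphere_trajectory T S (w 0) w &
        V T - V 0 = cost T S w].
Proof.
move=> T0 n0 F0 [Finc w1 wF VF]; have T0' := ltW T0.
have [S [pS mS FS]] := increment_density T0 n0 F0 Finc.
have itS s t : mx_integrable `[s, t] S.
  apply: (mx_integrable_bounded (C := kap) mS) => u i j _.
  by have [pSu <-] := pS u; exact: psd_entry.
have kap0 : 0 <= kap by have [pS0 <-] := pS 0; exact: psd_tr_ge0.
have FSst s t : 0 <= s -> s <= t -> t <= T -> F t - F s = mx_integral `[s, t] S.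
  move=> s0 st tT; rewrite (FS t) ?(le_trans s0)// (FS s) ?s0 ?(le_trans st)//.
  by rewrite (mx_integral_split s0 st)// addrC addKr.
have wc u i : 0 <= u <= T -> `|w u i 0| <= 1 by move=> /w1 /unit_sphere_coord.
(* A Lipschitz constant of [w]: the field contributes the first term, and the quadratic error, as t
   - s <= T, the second. *)
pose C := vfield_cst R n * kap + `|K| * T.
have C0 : 0 <= C by rewrite addr_ge0 ?mulr_ge0// vfield_cst_ge0.
have wlip i s t : 0 <= s -> s <= t -> t <= T -> `|w t i 0 - w s i 0| <= C * (t - s).
  move=> s0 st tT; have [pF trF] := Finc s t s0 st tT.
  have sT : 0 <= s <= T by rewrite s0 (le_trans st).
  rewrite -[_ - _](subrK (vfield (F t - F s) (w s) i 0)).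
  apply: (le_trans (ler_normD _ _)).
  have h1 := wF s t i s0 st tT.
  have h2 := norm_vfield_le i pF (fun j => wc s j sT).
  apply: (le_trans (lerD h1 h2)); rewrite trF /C.
  have ts : 0 <= t - s by rewrite subr_ge0.
  have h3 : K * (t - s) ^+ 2 <= `|K| * T * (t - s).
    rewrite expr2 mulrA ler_wpM2r//; apply: le_trans (_ : `|K| * (t - s) <= _).
      by rewrite ler_wpM2r// ler_norm.
    by rewrite ler_wpM2l// lerBlDr (le_trans tT)// lerDl.
  by apply: (le_trans (lerD h3 (lexx _))); rewrite le_eqVlt; apply/orP; left; apply/eqP; ring.
have mw s t i : 0 <= s -> t <= T -> measurable_fun `[s, t] (fun u => w u i 0).
  move=> s0 tT; apply: (@measurable_funS _ _ _ _ `[0, T]%classic) => //.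
    by apply: subset_itv; rewrite bnd_simp.
  exact: lipschitz_measurable (wlip i).
have itv i : integrable_on (fun u => vfield (S u) (w u) i 0) 0 T.
  by apply: integrable_on_vfield => // j; exact: mw.
have itq : integrable_on (fun u => qform (S u) (w u)) 0 T.
  by apply: integrable_on_qform => // j; exact: mw.
have inT s t u : 0 <= s -> t <= T -> s <= u <= t -> 0 <= u <= T.
  by move=> s0 tT /andP[su ut]; rewrite (le_trans s0)//= (le_trans ut).
pose M := vfield_cst R n * kap * C.
have M0 : 0 <= M by rewrite !mulr_ge0// vfield_cst_ge0.
have wlip2 s t : 0 <= s -> s <= t -> t <= T -> forall u, s <= u <= t ->
    forall i, `|w s i 0 - w u i 0| <= C * (t - s).
  move=> s0 st tT u /andP[su ut] i; rewrite distrC.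
  by rewrite (le_trans (wlip i s u _ _ _)) ?ler_wpM2l ?lerB// (le_trans ut).
have wE i t : 0 <= t <= T -> w t i 0 = w 0 i 0 + integ (fun u => vfield (S u) (w u) i 0) 0 t.
  move: t; apply: (@primitive_of_second_order _ _ (fun t => w t i 0) _ (K + M) T0' (itv i)).
  move=> s t s0 st tT.
  have [itvs vE] := vfield_integral (w s) i (itS s t).
  have sT : 0 <= s <= T by rewrite s0 (le_trans st).
  have := wF s t i s0 st tT; rewrite (FSst s t s0 st tT) vE => h.
  have itvst : integrable_on (fun u => vfield (S u) (w u) i 0) s t.
    exact: integrable_onS (itv i).
  apply: (le_trans (ler_distD (integ (fun u => vfield (S u) (w s) i 0) s t) _ _)).
  rewrite mulrDl; apply: lerD h _; rewrite -integB// expr2 mulrA.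
  apply: norm_integ_le_cst => //; first exact: integrable_onB.
  move=> u ust; have [pSu trS] := pS u.
  rewrite /M -trS -mulrA; apply: vfield_lipschitz => // [j|j|j].
  - exact: wc.
  - exact/wc/(inT s t).
  - exact: wlip2 ust j.
exists S; split => //.
- by apply: FS; rewrite T0' lexx.
- split => //; split => [i j|t tT].
    by rewrite ord1; exact: itv.
  by apply/colP => i; rewrite !mxE; exact: wE.
- have VT : 0 <= T <= T by rewrite T0' lexx.
  suff -> : V T = V 0 + integ (fun u => qform (S u) (w u)) 0 T.
    by rewrite addrC addKr.
  apply: (@primitive_of_second_order _ _ _ _ (K + M) T0' itq) VT.
  move=> s t s0 st tT.
  have [itqs qE] := qform_integral (w s) (itS s t).
  have sT : 0 <= s <= T by rewrite s0 (le_trans st).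
  have := VF s t s0 st tT; rewrite (FSst s t s0 st tT) qE => h.
  have itqst : integrable_on (fun u => qform (S u) (w u)) s t.
    exact: integrable_onS itq.
  apply: (le_trans (ler_distD (integ (fun u => qform (S u) (w s)) s t) _ _)).
  rewrite mulrDl; apply: lerD h _; rewrite -integB// expr2 mulrA.
  apply: norm_integ_le_cst => //; first exact: integrable_onB.
  move=> u ust; have [pSu trS] := pS u.
  have wsc j : `|w s j 0| <= 1 by exact: wc.
  have wuc j : `|w u j 0| <= 1 by exact/wc/(inT s t).
  apply: (le_trans (qform_lipschitz pSu wsc wuc (wlip2 s t s0 st tT u ust))).
  have -> : M * (t - s) = vfield_cst R n * kap * (C * (t - s)) by rewrite /M; ring.
  rewrite trS ler_wpM2r ?mulr_ge0 ?subr_ge0// ler_wpM2r//.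
  by rewrite /vfield_cst; have n0' := ler0n R n; have n2 := sqr_ge0 (n%:R : R); lra.
Qed.

Lemma cost_ge0 R (n : nat) (T : R) (S : R -> 'M[R]_n) (w : R -> 'cV[R]_n) :
  (forall t, 0 <= t <= T -> psd (S t)) -> 0 <= cost T S w.
Proof. by move=> pS; apply: integ_ge0 => t /pS[_]; apply. Qed.

Definition cost_set R (a b : R) (n : nat) (T : R) : set R :=
  [set v | exists (S : R -> 'M[R]_n) (w0 : 'cV[R]_n),
    [/\ admissible a b T S, unit_sphere w0 & has_cost T S w0 v]].

Lemma cost_set_lbound R (a b : R) (n : nat) (T : R) :
  lbound (cost_set a b n T) 0.
Proof.
by move=> v [S [w0 [[pS _ _ _] _ [w _ ->]]]]; exact: cost_ge0.
Qed.

Lemma ocp_inf_le R (a b : R) (n : nat) (T : R) (S : R -> 'M[R]_n)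
    (w0 : 'cV[R]_n) (w : R -> 'cV[R]_n) :
  admissible a b T S -> unit_sphere w0 -> sphere_trajectory T S w0 w ->
  ocp_inf a b n T <= cost T S w.
Proof.
move=> adm w01 wS; apply: ge_inf; first by exists 0; exact: cost_set_lbound.
by exists S, w0; split => //; exists w.
Qed.

(** The control (a / T) Id leaves every unit vector at rest and costs a. It makes the set of costs
    nonempty, and settles the upper bound for small [b]. *)
Lemma ocp_inf_constant R (a b : R) (n : nat) (T : R) :
  0 < T -> 0 < a -> a <= b -> (0 < n)%N ->
  cost_set a b n T a.
Proof.
move=> T0 a0 ab n0; have T0' := ltW T0.
pose S (t : R) : 'M[R]_n := (a / T)%:M.
pose x : 'cV[R]_n := delta_mx (Ordinal n0) 0.
have x1 : dotp x x = 1.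
  have := bform_delta (1%:M : 'M[R]_n) (Ordinal n0) (Ordinal n0).
  by rewrite bform_dotp mul1mx mxE eqxx.
have itS : mx_integrable `[0, T] S by move=> i j; exact: integrable_on_cst.
have qE y : qform (mx_integral `[0, T] S) y = a * dotp y y.
  have [_ ->] := qform_integral y itS.
  by rewrite /S integ_cst// qform_scalar subr0; field; rewrite gt_eqF.
exists S, x; split; last first.
- exists (fun=> x); last first.
    rewrite /cost -/(integ _ _ _) /S integ_cst// qform_scalar x1.
    by field; rewrite gt_eqF.
  have v0 (t : R) : - (S t *m x) + qform (S t) x *: x = 0.
    by rewrite qform_scalar x1 mulr1 mul_scalar_mx addNr.
  split => [t _|]; first exact/unit_sphereE.
  split => [i j|t /andP[t0 tT]].
    apply: (@eq_integrable_on _ (fun=> 0)); last exact: integrable_on_cst.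
    by move=> u _; rewrite v0 mxE.
  apply/matrixP => i j; rewrite [in RHS]mxE mx_integralE.
  rewrite (@eq_integ _ _ (fun=> 0)); first by rewrite integ_cst// mul0r addr0.
  by move=> u _; rewrite v0 mxE.
- exact/unit_sphereE.
- split => //.
  + by move=> t _; apply: psd_scalar; rewrite divr_ge0// ltW.
  + by move=> y; rewrite qE qform_scalar.
  + by move=> y; rewrite qE qform_scalar ler_wpM2r// dotp_ge0.
Qed.

Lemma ocp_minimizer_exists R (a b : R) (n : nat) (T : R) :
  0 < T -> 0 < a -> a <= b -> (0 < n)%N ->
  exists (kap : R) (S : R -> 'M[R]_n) (w : R -> 'cV[R]_n),
    [/\ 0 < kap,
        forall t, psd (S t) /\ \tr (S t) = kap,
        forall i j, measurable_fun setT (fun t => S t i j),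
        admissible a b T S &
        sphere_trajectory T S (w 0) w /\ cost T S w = ocp_inf a b n T].
Proof.
move=> T0 a0 ab n0.
have hinf : has_inf (cost_set a b n T).
  split; first by exists a; exact: ocp_inf_constant.
  by exists 0; exact: cost_set_lbound.
(* The error constant is taken at the largest admissible trace rate n b / T, hence is common to all
   [k]. *)
have h k : exists D : R * (R -> 'M[R]_n) * (R -> 'cV[R]_n) * (R -> R),
    let: (kap, F, w, V) := D in
    [/\ n%:R * a / T <= kap <= n%:R * b / T,
        sewn T kap ((vfield_cst R n * (n%:R * b / T)) ^+ 2) F w V,
        F 0 = 0 /\ loewner_le a%:M (F T) /\ loewner_le (F T) b%:M &
        V 0 = 0 /\ ocp_inf a b n T <= V T < ocp_inf a b n T + k.+1%:R^-1].
  have k0 : 0 < k.+1%:R^-1 :> R by rewrite invr_gt0.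
  have [v [S [w0 [adm w01 [w wS vE]]]] vk] := inf_adherent k0 hinf.
  have [kap [F [w' [V [kapb sF [F0 FT] [V0 VT]]]]]] :=
    sewn_of_trajectory T0 a0 n0 adm wS.
  exists (kap, F, w', V); split => //.
  - have /andP[kl ku] := kapb.
    have kap0 : 0 <= kap by rewrite (le_trans _ kl)// divr_ge0 ?mulr_ge0// ltW.
    have Kle s t : (vfield_cst R n * kap) ^+ 2 * (t - s) ^+ 2 <=
        (vfield_cst R n * (n%:R * b / T)) ^+ 2 * (t - s) ^+ 2.
      have cK : vfield_cst R n * kap <= vfield_cst R n * (n%:R * b / T).
        by rewrite ler_wpM2l// vfield_cst_ge0.
      have c0 : 0 <= vfield_cst R n * kap by rewrite mulr_ge0// vfield_cst_ge0.
      by rewrite ler_wpM2r ?sqr_ge0// ler_pXn2r// nnegrE (le_trans c0).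
    have [s1 s2 s3 s4] := sF; split => //.
    + by move=> s t i s0 st tT; rewrite (le_trans (s3 s t i s0 st tT)).
    + by move=> s t s0 st tT; rewrite (le_trans (s4 s t s0 st tT)).
  - by rewrite FT; have [_ _ la lb] := adm.
  - by rewrite VT -vE vk andbT; split=> //; rewrite vE; exact: ocp_inf_le adm w01 wS.
have /choice[D DP] := h.
have VT : (fun k => (D k).2 T) @ \oo --> ocp_inf a b n T.
  apply: (@squeeze_cvgr _ _ _ _ (fun=> ocp_inf a b n T)
    (fun k => ocp_inf a b n T + k.+1%:R^-1)).
  - apply: filterE => k; have := DP k; case: (D k) => -[[kap F] w] V [_ _ _ [_ /andP[-> /ltW]]].
    by move=> ->.
  - exact: cvg_cst.
  - rewrite -[X in _ --> X]addr0; apply: cvgD; first exact: cvg_cst.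
    exact: cvg_harmonic.
have [|||||||kap [F [w [V [/andP[kl _] sF [F0 [la lb]] [V0 VE]]]]]] :=
  @sewn_ultralimit R n T ((vfield_cst R n * (n%:R * b / T)) ^+ 2) a b
    (ocp_inf a b n T) (fun k => (D k).1.1.1) (fun k => (D k).1.1.2)
    (fun k => (D k).1.2) (fun k => (D k).2) (n%:R * a / T) (n%:R * b / T) T0.
- by move=> k; have := DP k; case: (D k) => -[[? ?] ?] ? [].
- by move=> k; have := DP k; case: (D k) => -[[? ?] ?] ? [].
- by move=> k; have := DP k; case: (D k) => -[[? ?] ?] ? [_ _ []].
- by move=> k; have := DP k; case: (D k) => -[[? ?] ?] ? [_ _ [_ []]].
- by move=> k; have := DP k; case: (D k) => -[[? ?] ?] ? [_ _ [_ []]].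
- by move=> k; have := DP k; case: (D k) => -[[? ?] ?] ? [_ _ _ []].
- exact: VT.
have [S [pS mS FS wS cE]] := trajectory_of_sewn T0 n0 F0 sF.
exists kap, S, w; split => //.
(* The lower bound on the trace rate survives the limit; its positivity later provides a nonzero
   rank-one part at every time. *)
- by apply: lt_le_trans kl; rewrite divr_gt0// mulr_gt0// ltr0n.
- split; last 2 first.
  + by rewrite -FS.
  + by rewrite -FS.
  + by move=> t _; have [] := pS t.
  + apply: (mx_integrable_bounded (C := kap) mS) => u i j _.
    by have [pSu <-] := pS u; exact: psd_entry.
- by split => //; rewrite -cE V0 VE subr0.
Qed.

(** * Rank-one controls *)

(** The vector A v / sqrt (v^T A v); removing its outer product from [A] leaves a Schur complement.
    The factor is a real power because that function is total and measurable. *)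
Definition schur_vec R (n : nat) (A : 'M[R]_n) (v : 'cV[R]_n) : 'cV[R]_n :=
  (qform A v `^ (- 2^-1)) *: (A *m v).

(** Positivity of the remainder is Cauchy-Schwarz for the form [A]. Since the kernel of [A] is kept,
    successive eliminations do not undo each other. *)
Lemma schur_vecP R (n : nat) (A : 'M[R]_n) (v : 'cV[R]_n) :
  psd A -> 0 < qform A v ->
  let c := schur_vec A v in
  [/\ c != 0, psd (A - c *m c^T), (A - c *m c^T) *m v = 0 &
      forall x, A *m x = 0 -> (A - c *m c^T) *m x = 0 /\ dotp c x = 0].
Proof.
move=> pA q0 c; have [As A0] := pA.
have kE : qform A v `^ (- 2^-1) = (Num.sqrt (qform A v))^-1.
  by rewrite powRN powR12_sqrt// ltW.
have s0 : 0 < Num.sqrt (qform A v) by rewrite sqrtr_gt0.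
have sE : Num.sqrt (qform A v) ^+ 2 = qform A v by rewrite sqr_sqrtr// ltW.
have cx x : dotp c x = (Num.sqrt (qform A v))^-1 * bform A v x.
  by rewrite /c /schur_vec kE dotpZl dotp_mull As -bform_dotp.
have Ax0 x : A *m x = 0 -> dotp c x = 0.
  by move=> Ax; rewrite cx bform_dotp Ax dotp0r mulr0.
split.
- apply: contraTneq q0 => c0; have := cx v; rewrite c0 dotpC dotp0r => /esym/eqP.
  by rewrite mulf_eq0 invr_eq0 gt_eqF//= -qform_bform => /eqP ->; rewrite ltxx.
- split; first by rewrite linearB /= As trmx_mul trmxK.
  move=> x; rewrite qformB qform_outer cx exprMn exprVn sE subr_ge0.
  by rewrite mulrC ler_pdivrMr// mulrC psd_CS.
- rewrite mulmxBl mul_outer cx -qform_bform /c /schur_vec kE scalerA.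
  have -> : (Num.sqrt (qform A v))^-1 * qform A v * (Num.sqrt (qform A v))^-1 = 1.
    by rewrite -[X in _ * X * _]sE; field; rewrite gt_eqF.
  by rewrite scale1r subrr.
- by move=> x Ax; rewrite mulmxBl Ax mul_outer Ax0// scale0r subrr.
Qed.

(** Taking the first suitable vector of an explicit list, instead of choosing one, keeps the result
    measurable in time. *)
Fixpoint rank1_part R (n : nat) (A : 'M[R]_n) (vs : seq 'cV[R]_n) : 'cV[R]_n :=
  if vs is v :: vs' then
    if 0 < qform A v then schur_vec A v else rank1_part A vs'
  else 0.

Lemma rank1_part_some R (n : nat) (A : 'M[R]_n) (vs : seq 'cV[R]_n) :
  has (fun v => 0 < qform A v) vs ->
  exists2 v, 0 < qform A v & rank1_part A vs = schur_vec A v.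
Proof. by elim: vs => //= v vs IH; case: ifP => [q0 _|_ /=]; [exists v|exact: IH]. Qed.

Definition test_vecs R (n : nat) (x : 'cV[R]_n) : seq 'cV[R]_n :=
  x :: [seq delta_mx i 0 | i <- enum 'I_n].

(** If x^T A x > 0, eliminating along [x], the head of the list, puts [x] in the kernel of the
    remainder. Otherwise A x = 0 already and any later vector will do: one exists among the basis
    vectors because the trace is positive. *)
Lemma rank1_partP R (n : nat) (A : 'M[R]_n) (x : 'cV[R]_n) :
  psd A -> 0 < \tr A ->
  let c := rank1_part A (test_vecs x) in
  [/\ c != 0, psd (A - c *m c^T) & (A - c *m c^T) *m x = 0].
Proof.
move=> pA trA c.
have hs : has (fun v => 0 < qform A v) [seq delta_mx i 0 | i <- enum 'I_n].
  apply: contraTT trA => /hasPn h; rewrite -leNgt; apply: sumr_le0 => i _.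
  have := h (delta_mx i 0); rewrite qform_bform bform_delta -leNgt; apply.
  by apply/mapP; exists i; rewrite ?mem_enum.
rewrite /c /=; case: ifPn => [q0|]; first by have [] := schur_vecP pA q0.
rewrite -leNgt => q0; have Ax : A *m x = 0.
  by apply: psd_ker => //; apply/eqP; rewrite eq_le q0; have [_ ->] := pA.
have [v v0 ->] := rank1_part_some hs.
by have [h1 h2 _ /(_ x Ax)[h3 _]] := schur_vecP pA v0.
Qed.

(** Schur elimination along the basis, as in a Cholesky factorization. The orthogonality holds
    because each step keeps the kernel; it will turn B w(tau) = 0 into pause vectors orthogonal to
    w(tau). *)
Lemma psd_sum_outer R (n : nat) (A : 'M[R]_n) : psd A ->
  exists2 cs : seq 'cV[R]_n, A = \sum_(c <- cs) c *m c^T &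
    forall x, A *m x = 0 -> forall c, c \in cs -> dotp c x = 0.
Proof.
move=> pA.
suff h (s : seq 'I_n) : exists (cs : seq 'cV[R]_n) (B : 'M[R]_n),
    [/\ A = B + \sum_(c <- cs) c *m c^T, psd B,
        forall i, i \in s -> B *m (delta_mx i 0 : 'cV[R]_n) = 0 &
        forall x : 'cV[R]_n, A *m x = 0 -> B *m x = 0 /\ forall c, c \in cs -> dotp c x = 0].
  have [cs [B [AE _ B0 kA]]] := h (enum 'I_n).
  exists cs => [|x /kA[]//].
  rewrite AE (_ : B = 0) ?add0r//; apply/matrixP => i j; rewrite mxE.
  have := B0 j; rewrite mem_enum => /(_ isT) /colP /(_ i).
  rewrite !mxE (bigD1 j)//= mxE !eqxx mulr1 big1 ?addr0// => k kj.
  by rewrite mxE (negbTE kj) mulr0.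
elim: s => [|i s [cs [B [AE pB B0 kA]]]].
  by exists [::], A; split => //; rewrite big_nil addr0.
have [q0|] := ltP 0 (qform B (delta_mx i 0)); last first.
  move=> q0; exists cs, B; split => // j; rewrite inE => /predU1P[->|/B0//].
  by apply: psd_ker => //; apply/eqP; rewrite eq_le q0; have [_ ->] := pB.
have [c0 pC Cv kC] := schur_vecP pB q0; set c := schur_vec _ _ in c0 pC Cv kC.
exists (c :: cs), (B - c *m c^T); split => //.
- by rewrite big_cons addrA subrK.
- by move=> j; rewrite inE => /predU1P[->//|/B0 /kC[]].
- move=> x /kA[/kC[-> cx] csx]; split => // d; rewrite inE => /predU1P[->//|].
  exact: csx.
Qed.

Lemma measurable_fun_schur R (n : nat) (D : set R) (A : R -> 'M[R]_n)
    (v : R -> 'cV[R]_n) i : measurable D ->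
  (forall i j, measurable_fun D (fun t => A t i j)) ->
  (forall i, measurable_fun D (fun t => v t i 0)) ->
  measurable_fun D (fun t => qform (A t) (v t)) /\
  measurable_fun D (fun t => schur_vec (A t) (v t) i 0).
Proof.
move=> mD mA mv.
have mAv j : measurable_fun D (fun t => (A t *m v t) j 0).
  under eq_fun do rewrite mxE.
  by apply: measurable_sum => k; exact: measurable_funM.
have mq : measurable_fun D (fun t => qform (A t) (v t)).
  under eq_fun do rewrite qform_bform bform_dotp dotpE.
  by apply: measurable_sum => k; exact: measurable_funM.
split => //; rewrite /schur_vec; under eq_fun do rewrite mxE.
apply: measurable_funM => //.
by have := measurableT_comp (@measurable_powR R (- 2^-1)) mq; apply.
Qed.

Lemma measurable_fun_rank1_part R (n : nat) (D : set R) (A : R -> 'M[R]_n)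
    (vs : seq (R -> 'cV[R]_n)) i : measurable D ->
  (forall i j, measurable_fun D (fun t => A t i j)) ->
  (forall v, List.In v vs -> forall i, measurable_fun D (fun t => v t i 0)) ->
  measurable_fun D (fun t => rank1_part (A t) [seq v t | v <- vs] i 0).
Proof.
move=> mD mA; elim: vs => [_|v vs IH mvs] /=.
  exact: measurable_cst.
have mv i' : measurable_fun D (fun t => v t i' 0) by apply: mvs; left.
have mvs' : measurable_fun D (fun t => rank1_part (A t) [seq v t | v <- vs] i 0).
  by apply: IH => v' hv' i'; apply: mvs; right.
have [mq ms] := measurable_fun_schur i mD mA mv.
rewrite (_ : (fun t => _) = (fun t => if 0 < qform (A t) (v t) then
   schur_vec (A t) (v t) i 0 else rank1_part (A t) [seq v t | v <- vs] i 0)).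
  apply: measurable_fun_if => //.
  - exact: measurable_fun_ltr.
  - by apply: measurable_funS ms => //; exact: subIsetl.
  - by apply: measurable_funS mvs' => //; exact: subIsetl.
by apply/funext => t; case: ifP.
Qed.

(* The control splits as [S = c c^T + C], where [C] annihilates the state and
   hence contributes neither to the motion nor to the cost. *)
Lemma rank1_splitting R (n : nat) (T kap : R) (S : R -> 'M[R]_n)
    (w : R -> 'cV[R]_n) : 0 < kap ->
  (forall t, psd (S t) /\ \tr (S t) = kap) ->
  (forall i j, measurable_fun setT (fun t => S t i j)) ->
  (forall i, measurable_fun `[0, T] (fun t => w t i 0)) ->
  exists c : R -> 'cV[R]_n,
    [/\ forall i, measurable_fun `[0, T] (fun t => c t i 0),
        forall t i, `|c t i 0| <= kap + 1,
        forall t, c t != 0 &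
        forall t, psd (S t - c t *m (c t)^T) /\ (S t - c t *m (c t)^T) *m w t = 0].
Proof.
move=> kap0 pS mS mw.
exists (fun t => rank1_part (S t) (test_vecs (w t))).
have cP t : let c := rank1_part (S t) (test_vecs (w t)) in
   [/\ c != 0, psd (S t - c *m c^T) & (S t - c *m c^T) *m w t = 0].
  by have [pSt trS] := pS t; apply: rank1_partP => //; rewrite trS.
split.
- move=> i; pose vs := w :: [seq (fun=> delta_mx i 0) | i <- enum 'I_n].
  rewrite (_ : (fun t => _) = (fun t => rank1_part (S t) [seq v t | v <- vs] i 0)).
    apply: measurable_fun_rank1_part => //.
      by move=> i' j'; exact: measurable_funTS.
    move=> v [<-|]; first exact: mw.
    elim: (enum 'I_n) => //= j js IH [<- i'|/IH//]; exact: measurable_cst.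
  by apply/funext => t; rewrite /vs /test_vecs /= -map_comp.
- move=> t i; have [c0 pC _] := cP t; have [pSt trS] := pS t.
  set c := rank1_part _ _ in c0 pC *.
  (* Positivity of the remainder gives c_i^2 <= S_ii <= kap, and kap <= (kap + 1)^2 avoids a square
     root in the bound. *)
  have h : c i 0 ^+ 2 <= kap.
    have := psd_diag_ge0 i pC; rewrite !mxE big_ord1 !mxE subr_ge0 -expr2 => /le_trans.
    by apply; rewrite -trS; exact: psd_diag_tr.
  rewrite -(@ler_pXn2r _ 2) ?nnegrE ?addr_ge0 ?(ltW kap0)// real_normK ?num_real//.
  by apply: (le_trans h); nra.
- by move=> t; have [] := cP t.
- by move=> t; have [] := cP t.
Qed.

(** * Conic Caratheodory theorem and sums of matrices annihilating states *)

Lemma caratheodory_step R (m d : nat) (V : 'M[R]_(m.+1, d)) (l : 'rV[R]_m.+1) :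
  (d <= m)%N -> (forall i, 0 <= l 0 i) ->
  exists (l' : 'rV[R]_m.+1) (j : 'I_m.+1),
    [/\ forall i, 0 <= l' 0 i, l' 0 j = 0 & l' *m V = l *m V].
Proof.
move=> dm l0.
(* More than [d] rows in dimension [d] satisfy a linear relation; its sign is chosen so that some
   coefficient is positive. *)
have [u uV [j1 u1]] : exists2 u : 'rV[R]_m.+1, u *m V = 0 & exists j, 0 < u 0 j.
  have : kermx V != 0.
    rewrite -mxrank_eq0 mxrank_ker subn_eq0 -ltnNge ltnS.
    by rewrite (leq_trans (rank_leq_col V)).
  move=> /rowV0Pn[v /sub_kermxP vV v0].
  have [j vj] : exists j, v 0 j != 0.
    apply/existsP; apply: contraNT v0 => /existsPn h; apply/eqP/rowP => j.
    by have := h j; rewrite mxE negbK => /eqP.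
  have [vj0|vj0] := ltP 0 (v 0 j); first by exists v => //; exists j.
  exists (- v); first by rewrite mulNmx vV oppr0.
  by exists j; rewrite mxE oppr_gt0 lt_neqAle vj.
(* The smallest ratio is the largest multiple of [u] that can be subtracted while the weights stay
   nonnegative; it kills the weight [j]. *)
have [j uj jmin] := @arg_minP _ _ _ j1 (fun j => 0 < u 0 j) (fun j => l 0 j / u 0 j) u1.
have t0 : 0 <= l 0 j / u 0 j by rewrite divr_ge0// ltW.
exists (l - (l 0 j / u 0 j) *: u), j; split.
- move=> i; rewrite !mxE subr_ge0; have [ui|ui] := ltP 0 (u 0 i).
    by rewrite -ler_pdivlMr// jmin.
  by rewrite (le_trans (mulr_ge0_le0 t0 ui)).
- by rewrite !mxE divfK ?subrr// gt_eqF.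
- by rewrite mulmxBl -scalemxAl uV scaler0 subr0.
Qed.

(** One row is dropped at a time while more than [d] remain. This is the conic version, with no
    condition on the sum of the weights, hence [d] and not d + 1. *)
Lemma caratheodory R (d : nat) : forall (m : nat) (V : 'M[R]_(m, d)) (l : 'rV[R]_m),
  (forall i, 0 <= l 0 i) ->
  exists (m' : nat) (f : 'I_m' -> 'I_m) (l' : 'I_m' -> R),
    [/\ (m' <= d)%N, forall i, 0 <= l' i &
        l *m V = \sum_i l' i *: row (f i) V].
Proof.
elim=> [|m IH] V l l0.
  exists 0%N, id, (fun=> 0); split => //.
  by apply/rowP => j; rewrite !mxE big_ord0 summxE big_ord0.
have [md|dm] := leqP m.+1 d.
  exists m.+1, id, (fun i => l 0 i); split => //; apply/rowP => j.
  by rewrite !mxE summxE; apply: eq_bigr => i _; rewrite !mxE.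
have [l' [j [l'0 l'j <-]]] := caratheodory_step V dm l0.
have [|m' [f [mu [m'd mu0 muE]]]] := IH (row' j V) (col' j l').
  by move=> i; rewrite mxE.
exists m', (fun i => lift j (f i)), mu; split => //.
transitivity (col' j l' *m row' j V).
  apply/rowP => k; rewrite !mxE (bigD1_ord j)//= l'j mul0r add0r.
  by apply: eq_bigr => i _; rewrite !mxE.
rewrite muE; apply: eq_bigr => i _; congr (_ *: _).
by apply/rowP => k; rewrite !mxE.
Qed.

Lemma caratheodory_mx R (n m : nat) (E : 'I_m -> 'M[R]_n) :
  exists (m' : nat) (f : 'I_m' -> 'I_m) (mu : 'I_m' -> R),
    [/\ (m' <= n * n)%N, forall i, 0 <= mu i &
        \sum_i E i = \sum_i mu i *: E (f i)].
Proof.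
have [|m' [f [mu [h1 h2 h3]]]] :=
  @caratheodory R (n * n) m (\matrix_i mxvec (E i)) (const_mx 1).
  by move=> i; rewrite mxE.
exists m', f, mu; split => //; apply: (can_inj mxvecK).
rewrite !linear_sum /=; transitivity ((const_mx 1 : 'rV_m) *m \matrix_i mxvec (E i)).
  by apply/rowP => k; rewrite !mxE summxE; apply: eq_bigr => i _; rewrite !mxE mul1r.
by rewrite h3; apply: eq_bigr => i _; rewrite linearZ /= rowK.
Qed.

Definition compl_proj R (n : nat) (x : 'cV[R]_n) : 'M[R]_n := 1%:M - x *m x^T.

Lemma compl_proj_tr R (n : nat) (x : 'cV[R]_n) :
  (compl_proj x)^T = compl_proj x.
Proof. by rewrite /compl_proj linearB /= trmx1 trmx_mul trmxK. Qed.

Lemma compl_proj_ker R (n : nat) (x : 'cV[R]_n) :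
  unit_sphere x -> compl_proj x *m x = 0.
Proof.
by move=> /unit_sphereE x1; rewrite /compl_proj mulmxBl mul1mx mul_outer x1 scale1r subrr.
Qed.

(** Expanding the compression, every correction term contains the factor [D x]: two terms of size
    [e] and one, with the scalar x^T D x, of size n e. *)
Lemma compl_proj_congr_dist R (n : nat) (D : 'M[R]_n) (x : 'cV[R]_n) (e : R) i j :
  D^T = D -> unit_sphere x -> (forall i, `|(D *m x) i 0| <= e) ->
  `|(compl_proj x *m D *m compl_proj x) i j - D i j| <= (2 + n%:R) * e.
Proof.
move=> Ds x1 De.
have xD : x^T *m D = (D *m x)^T by rewrite trmx_mul Ds.
have -> : compl_proj x *m D *m compl_proj x = D - x *m (D *m x)^T - (D *m x) *m x^T
    + dotp x (D *m x) *: (x *m x^T).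
  rewrite /compl_proj mulmxBr mulmx1 mulmxBl mul1mx -!mulmxA xD mulmxBl mulmxA.
  rewrite [X in _ - (_ - X)](_ : _ = dotp x (D *m x) *: (x *m x^T)).
    by rewrite opprB addrA addrAC.
  by rewrite mulmxA mul_outer -scalemxAl dotpC.
have kd : `|dotp x (D *m x)| <= n%:R * e.
  rewrite dotpE; apply: norm_sum_le => k; rewrite normrM -[leRHS]mul1r.
  by rewrite ler_pM// unit_sphere_coord.
set y := D *m x in De kd *; have -> : (D - x *m y^T - y *m x^T + dotp x y *: (x *m x^T)) i j
    - D i j = - (x i 0 * y j 0) - y i 0 * x j 0 + dotp x y * (x i 0 * x j 0).
  by rewrite !mxE !big_ord1 !mxE; ring.
have e0 : 0 <= e by exact: le_trans (De i).
have xc k : `|x k 0| <= 1 by exact: unit_sphere_coord.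
have h1 : `|x i 0 * y j 0| <= e by rewrite normrM -[leRHS]mul1r ler_pM.
have h2 : `|y i 0 * x j 0| <= e by rewrite normrM -[leRHS]mulr1 ler_pM.
have h3 : `|dotp x y * (x i 0 * x j 0)| <= n%:R * e.
  rewrite !normrM -[leRHS]mulr1 ler_pM ?mulr_ge0//.
  by rewrite -[leRHS]mulr1 ler_pM.
rewrite mulrDl; apply: (le_trans (ler_normD _ _)); apply: lerD => //.
apply: (le_trans (ler_normB _ _)); rewrite normrN; lra.
Qed.

Lemma psd_entry_sum R (n m : nat) (B : 'I_m -> 'M[R]_n) k i j :
  (forall k, psd (B k)) -> `|B k i j| <= \tr (\sum_k B k).
Proof.
move=> pB; apply: (le_trans (psd_entry i j (pB k))).
rewrite raddf_sum (bigD1 k)//= lerDl sumr_ge0// => l _; exact: psd_tr_ge0.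
Qed.

(** Each increment of [A] over a mesh step nearly kills the state at its left end; compressing it to
    the orthogonal complement makes this exact at the price of O(1 / N^2), and there are N + 1
    steps. Caratheodory's theorem then leaves n^2 terms for every [N]. *)
Lemma grid_kernel_sum R (n : nat) (T c : R) (A : R -> 'M[R]_n)
    (w : R -> 'cV[R]_n) (N : nat) :
  0 <= T -> A 0 = 0 -> (forall t, 0 <= t <= T -> unit_sphere (w t)) ->
  (forall s t, 0 <= s -> s <= t -> t <= T -> psd (A t - A s)) ->
  (forall s t i, 0 <= s -> s <= t -> t <= T ->
     `|((A t - A s) *m w s) i 0| <= c * (t - s) ^+ 2) ->
  exists (tau : 'I_(n * n) -> R) (B : 'I_(n * n) -> 'M[R]_n),
    [/\ forall i, 0 <= tau i <= T, forall i, psd (B i),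
        forall i, B i *m w (tau i) = 0 &
        forall i j, `|(\sum_k B k) i j - A T i j| <=
          (2 + n%:R) * c * T ^+ 2 / N.+1%:R].
Proof.
move=> T0 A0 w1 pA Aw.
pose t (k : nat) : R := T / N.+1%:R * k%:R.
have h0 : 0 <= T / N.+1%:R by rewrite divr_ge0.
have t0 k : 0 <= t k by rewrite mulr_ge0.
have tS k : t k <= t k.+1 by rewrite ler_wpM2l// ler_nat.
have tT k : (k <= N.+1)%N -> t k <= T.
  by move=> kN; rewrite /t -mulrA ler_piMr// mulrC ler_pdivrMr// mul1r ler_nat.
have tSB k : t k.+1 - t k = T / N.+1%:R by rewrite /t -mulrBr -natrB// subSnn mulr1.
have tN : t N.+1 = T by rewrite /t divfK.
have tE0 : t 0%N = 0 by rewrite /t mulr0.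
pose D (k : 'I_N.+1) := A (t k.+1) - A (t k).
have DA : \sum_k D k = A T.
  rewrite /D -(big_mkord xpredT (fun k => A (t k.+1) - A (t k))).
  by rewrite telescope_sumr// tN tE0 A0 subr0.
pose P (k : 'I_N.+1) := compl_proj (w (t k)).
pose E k := P k *m D k *m P k.
have wk (k : 'I_N.+1) : unit_sphere (w (t k)) by apply: w1; rewrite t0 tT// ltnW.
have pD (k : 'I_N.+1) : psd (D k) by apply: pA => //; exact: tT.
have pE k : psd (E k).
  by rewrite /E -[X in X *m _ *m _]compl_proj_tr; exact/psd_congr/pD.
have Ew k : E k *m w (t k) = 0 by rewrite /E -mulmxA compl_proj_ker// mulmx0.
have Edist k i j : `|E k i j - D k i j| <= (2 + n%:R) * (c * (T / N.+1%:R) ^+ 2).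
  apply: compl_proj_congr_dist => //; first by have [] := pD k.
  by move=> l; rewrite -(tSB k); apply: Aw => //; exact: tT.
have [m' [f [mu [m'n mu0 muE]]]] := caratheodory_mx E.
(* Pads the terms, at most n^2 of them, with zero matrices, so that the index set is the same for
   all [N]. *)
pose g (i : 'I_(n * n)) : option 'I_m' := insub (i : nat).
exists (fun i => if g i is Some k then t (f k) else 0),
  (fun i => if g i is Some k then mu k *: E (f k) else 0).
split.
- move=> i; case: (g i) => [k|]; last by rewrite lexx.
  by rewrite t0 tT// ltnW.
- by move=> i; case: (g i) => [k|]; [exact: psdZ|exact: psd0].
- move=> i; case: (g i) => [k|]; last by rewrite mul0mx.
  by rewrite -scalemxAl Ew scaler0.
- move=> i j.
  have -> : \sum_(i < n * n) (if g i is Some k then mu k *: E (f k) else 0) = \sum_k E k.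
    rewrite muE.
    pose G k := if insub k is Some k' then mu k' *: E (f k') else (0 : 'M[R]_n).
    transitivity (\sum_(i < n * n) G i); first by [].
    transitivity (\sum_(i < m') G i); last first.
      by apply: eq_bigr => k _; rewrite /G valK.
    rewrite (big_ord_widen _ G m'n) [RHS]big_mkcond /=; apply: eq_bigr => k _.
    by case: ltnP => // km; rewrite /G insubF// ltnNge km.
  rewrite -DA !summxE -sumrB.
  apply: (le_trans (norm_sum_le (d := (2 + n%:R) * (c * (T / N.+1%:R) ^+ 2)) _)) => //.
  rewrite le_eqVlt; apply/orP; left; apply/eqP.
  have N0 : (N.+1%:R : R) != 0 by rewrite pnatr_eq0.
  by set M := N.+1%:R in N0 *; field.
Qed.

(** The times lie in a segment and each matrix is bounded by the trace of the sum, so both converge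
    along an ultrafilter as the mesh shrinks; continuity of [w] carries B_i w(tau_i) = 0 to the
    limit. *)
Lemma kernel_sum R (n : nat) (T c L : R) (A : R -> 'M[R]_n)
    (w : R -> 'cV[R]_n) :
  0 < T -> A 0 = 0 -> (forall t, 0 <= t <= T -> unit_sphere (w t)) ->
  (forall s t i, 0 <= s -> s <= t -> t <= T -> `|w t i 0 - w s i 0| <= L * (t - s)) ->
  (forall s t, 0 <= s -> s <= t -> t <= T -> psd (A t - A s)) ->
  (forall s t i, 0 <= s -> s <= t -> t <= T ->
     `|((A t - A s) *m w s) i 0| <= c * (t - s) ^+ 2) ->
  exists (tau : 'I_(n * n) -> R) (B : 'I_(n * n) -> 'M[R]_n),
    [/\ forall i, 0 <= tau i <= T, forall i, psd (B i),
        forall i, B i *m w (tau i) = 0 & \sum_i B i = A T].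
Proof.
move=> T0 A0 w1 wL pA Aw.
have /choice[tB htB] : forall N : nat, exists tB : ('I_(n * n) -> R) * ('I_(n * n) -> 'M[R]_n),
    [/\ forall i, 0 <= tB.1 i <= T, forall i, psd (tB.2 i),
        forall i, tB.2 i *m w (tB.1 i) = 0 &
        forall i j, `|(\sum_k tB.2 k) i j - A T i j| <= (2 + n%:R) * c * T ^+ 2 / N.+1%:R].
  move=> N; have [tau [B h]] := grid_kernel_sum N (ltW T0) A0 w1 pA Aw.
  by exists (tau, B).
pose e0 : R := (2 + n%:R) * c * T ^+ 2.
have [U [UU Uoo]] := ultraFilterLemma (@eventually_filter).
have PU : ProperFilter U by exact: (@ultra_proper _ _ UU).
have FU : Filter U by exact: filter_filter.
have oU (f : nat -> R) (l : R) : f @ \oo --> l -> f @ U --> l.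
  by move=> h A' /h; exact: Uoo.
have wL' s t i : 0 <= s <= T -> 0 <= t <= T -> `|w t i 0 - w s i 0| <= `|L| * `|t - s|.
  wlog st : s t / s <= t.
    move=> h hs ht; have [st|/ltW ts] := leP s t; first exact: h.
    by rewrite distrC (distrC t); exact: h.
  move=> /andP[s0 sT] /andP[t0 tT]; rewrite (le_trans (wL _ _ i s0 st tT))//.
  by rewrite [`|t - s|]ger0_norm ?subr_ge0// ler_wpM2r ?subr_ge0// ler_norm.
pose tau N i := (tB N).1 i; pose B N i := (tB N).2 i.
have /choice[tau' htau'] : forall i, exists l : R, (fun N => tau N i) @ U --> l.
  move=> i; apply: (@bounded_ultra_cvg R nat U _ T) => // N.
  by have [/(_ i)/andP[h1 h2] _ _ _] := htB N; rewrite ger0_norm.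
pose Z N := \sum_k B N k.
have pB N k : psd (B N k) by have [_ h _ _] := htB N; exact: h.
have Zd N i j : `|Z N i j - A T i j| <= e0 / N.+1%:R by have [_ _ _ h] := htB N; exact: h.
have trZ N : \tr (Z N) <= \tr (A T) + n%:R * `|e0|.
  rewrite -lerBlDl /mxtrace -sumrB; apply: (le_trans (ler_norm _)).
  apply: norm_sum_le => i; apply: (le_trans (Zd N i i)).
  apply: (le_trans (ler_norm _)); rewrite normrM ler_piMr// normfV.
  by rewrite invf_le1 normr_nat// ler1n.
have /choice[B' hB'] : forall i, exists L' : 'M[R]_n, mx_cvg U (fun N => B N i) L'.
  move=> k.
  have /choice[l hl] : forall ij : 'I_n * 'I_n, exists l : R, (fun N => B N k ij.1 ij.2) @ U --> l.
    move=> ij; apply: (@bounded_ultra_cvg R nat U _ (\tr (A T) + n%:R * `|e0|)) => // N.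
    exact: (le_trans (psd_entry_sum _ _ _ (pB N)) (trZ N)).
  by exists (\matrix_(i, j) l (i, j)) => i j; rewrite mxE; exact: (hl (i, j)).
exists tau', B'.
have tau'T i : 0 <= tau' i <= T.
  apply/andP; split.
    apply: (@cvg_le R U (fun=> 0) (fun N => tau N i)) => //; first exact: cvg_cst.
    by move=> N; have [/(_ i)/andP[]] := htB N.
  apply: (@cvg_le R U (fun N => tau N i) (fun=> T)) => //; first exact: cvg_cst.
  by move=> N; have [/(_ i)/andP[]] := htB N.
split => //; [move=> i|move=> i|].
- exact: psd_cvg (hB' i) (fun N => pB N i).
- have wc : mx_cvg U (fun N => w (tau N i)) (w (tau' i)).
    have cl : (fun N => `|L| * `|tau N i - tau' i|) @ U --> 0.
      rewrite -[X in _ --> X](mulr0 `|L|); apply: cvgM; first exact: cvg_cst.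
      rewrite -[X in _ --> X](@normr0 _ R); apply: (@cvg_norm _ R).
      by rewrite -[X in _ --> X](subrr (tau' i)); apply: cvgB => //; exact: cvg_cst.
    move=> k l; rewrite (ord1 l).
    rewrite -[X in _ --> X](subr0 (w (tau' i) k 0)); apply: (@squeeze_cvgr nat U _ R
      (fun N => w (tau' i) k 0 - `|L| * `|tau N i - tau' i|)
      (fun N => w (tau' i) k 0 + `|L| * `|tau N i - tau' i|)).
    - near=> N; rewrite -ler_distl.
      by apply: wL' => //; have [h _ _ _] := htB N; exact: h.
    - by apply: cvgB => //; exact: cvg_cst.
    - rewrite subr0 -[X in _ --> X](addr0 (w (tau' i) k 0)).
      by apply: cvgD => //; exact: cvg_cst.
  apply: (@mx_cvg_unique R nat U _ _ (fun N => B N i *m w (tau N i))) => //.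
    exact: mx_cvg_mulmx.
  rewrite (_ : (fun N => _) = fun=> 0); first exact: mx_cvg_cst.
  by apply/funext => N; have [_ _ h _] := htB N; exact: h.
apply: (@mx_cvg_unique R nat U _ _ Z) => k l.
  rewrite summxE (_ : (fun N => Z N k l) = (fun N => \sum_i B N i k l)).
    by apply: (@cvg_sumr R nat U) => j; exact: hB'.
  by apply/funext => N; rewrite summxE.
have c0 : (fun N => e0 / N.+1%:R) @ U --> 0.
  apply: oU; rewrite -[X in _ --> X](mulr0 e0); apply: cvgM; [exact: cvg_cst|exact: cvg_harmonic].
apply: (@squeeze_cvgr nat U _ R (fun N => A T k l - e0 / N.+1%:R)
  (fun N => A T k l + e0 / N.+1%:R)).
- by near=> N; rewrite -ler_distl.
- rewrite -[X in _ --> X](subr0 (A T k l)).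
  by apply: cvgB => //; exact: cvg_cst.
- rewrite -[X in _ --> X](addr0 (A T k l)).
  by apply: cvgD => //; exact: cvg_cst.
Unshelve. all: by end_near. Qed.

(** * Pauses in a trajectory *)

Definition rank1_pair R (n : nat) (T : R) (c w : R -> 'cV[R]_n) : Prop :=
  [/\ mx_integrable `[0, T] (fun t => c t *m (c t)^T),
      exists C, forall t i, `|c t i 0| <= C,
      forall t, c t != 0 &
      sphere_trajectory T (fun t => c t *m (c t)^T) (w 0) w].

Lemma integrable_on_split R (f : R -> R) (s u t : R) :
  s <= u -> u <= t -> integrable_on f s u -> integrable_on f u t -> integrable_on f s t.
Proof.
move=> su ut f1 f2.
have E : `[s, t]%classic = (`[s, u] `|` `]u, t])%classic :> set R.
  by rewrite -itv_bndbnd_setU// bnd_simp.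
have f2' : (@lebesgue_measure R).-integrable `]u, t] (fun x => (f x)%:E).
  by apply: integrableS f2 => //; apply: subset_itv; rewrite bnd_simp.
have /integrableP[m1 i1] := f1; have /integrableP[m2 i2] := f2'.
have m : measurable_fun (`[s, u] `|` `]u, t]) (fun x => (f x)%:E) by exact/measurable_funU.
apply/integrableP; rewrite E; split => //.
rewrite ge0_integral_setU//.
- exact: lte_add_pinfty.
- exact: measurableT_comp.
- rewrite disj_set2E; apply/eqP; rewrite -subset0 => x [] /=; rewrite !in_itv/=.
  by move=> /andP[_ xu] /andP[+ _]; rewrite ltNge xu.
Qed.

(* [f] run at double speed, interrupted at time [ts] by a pause of length [T / 2]
   with value [v]. *)
Definition stop_case R (T ts : R) (V : Type) (f : R -> V) (v : V) (t : R) : V :=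
  if t < ts / 2 then f (2 * t)
  else if t < ts / 2 + T / 2 then v else f (2 * t - T).

(** The factor 2 offsets the double speed, and the pause adds [k] for a duration T / 2. For k = 0
    the primitive is that of [f] read on the modified clock, which is what makes a paused trajectory
    a trajectory. *)
Lemma stop_integral R (T ts : R) (f : R -> R) (k : R) :
  0 < T -> 0 <= ts <= T -> integrable_on f 0 T ->
  let g := stop_case T ts (fun t => 2 * f t) k in
  [/\ integrable_on g 0 T,
      integ g 0 T = integ f 0 T + k * (T / 2) &
      k = 0 -> forall t, 0 <= t <= T -> integ g 0 t = integ f 0 (stop_case T ts id ts t)].
Proof.
move=> T0 tsT itf g; have /andP[ts0 tsT'] := tsT.
pose p := ts / 2; pose q := ts / 2 + T / 2.
have p0 : 0 <= p by rewrite /p; lra.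
have pq : p <= q by rewrite /p /q; lra.
have qT : q <= T by rewrite /q; lra.
(* The offset [r] is 0 before the pause and - T after it. *)
have piece (r u v : R) : u <= v -> 0 <= 2 * u + r -> 2 * v + r <= T ->
   (forall x, u <= x < v -> g x = 2 * f (2 * x + r)) ->
   integrable_on g u v /\ integ g u v = integ f (2 * u + r) (2 * v + r).
  move=> uv u0 vT gE.
  have [|i1 e1] := @integ_affine R f 2 r u v (ltr0Sn _ 1); first exact: integrable_onS itf.
  have h x : u <= x < v -> 2 * f (2 * x + r) = g x by move=> /gE.
  have [i2 e2] := eq_integ_endpoint uv h (integrable_onZ 2 i1).
  by split => //; rewrite -e2 integZ.
have left t : 0 <= t <= p -> integrable_on g 0 t /\ integ g 0 t = integ f 0 (2 * t).
  move=> /andP[t0 tp]; have := piece 0 0 t t0; rewrite !addr0 mulr0; apply => //.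
    by rewrite /p in tp; lra.
  move=> x /andP[x0 xt]; rewrite /g /stop_case addr0 ifT//.
  exact: lt_le_trans tp.
have mid t : p <= t <= q -> integrable_on g p t /\ integ g p t = k * (t - p).
  move=> /andP[pt tq].
  have h x : p <= x < t -> k = g x.
    move=> /andP[px xt]; rewrite /g /stop_case ltNge px/= ifT//.
    exact: lt_le_trans tq.
  have [i2 e2] := eq_integ_endpoint pt h (integrable_on_cst k p t).
  by split => //; rewrite -e2 integ_cst.
have right t : q <= t <= T -> integrable_on g q t /\ integ g q t = integ f ts (2 * t - T).
  move=> /andP[qt tT]; have := piece (- T) q t qt.
  have -> : 2 * q - T = ts by rewrite /q; field.
  apply => //; first by lra.
  move=> x /andP[qx xt]; rewrite /g /stop_case ltNge (le_trans pq qx)/=.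
  by rewrite ltNge qx.
have [ip ep] := left p (introT andP (conj p0 (lexx p))).
have [iq eq] := mid q (introT andP (conj pq (lexx q))).
have [ir er] := right T (introT andP (conj qT (lexx T))).
have ig : integrable_on g 0 T.
  by apply: integrable_on_split ir => //; [exact: le_trans pq|exact: integrable_on_split iq].
have dp : 2 * p = ts by rewrite /p; field.
have split3 : integ g 0 T = integ f 0 T + k * (T / 2).
  rewrite (integ_split (le_trans p0 pq) qT)// (integ_split p0 pq); last exact: integrable_onS ig.
  rewrite ep eq er dp (integ_split ts0 tsT' itf).
  have -> : 2 * T - T = T by ring.
  by rewrite /q -/p; ring.
split => // k0 t /andP[t0 tT]; rewrite /stop_case -/p -/q.
have [tp|pt] := ltP t p; first by have [] := left t (introT andP (conj t0 (ltW tp))).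
rewrite (integ_split p0 pt); last exact: integrable_onS ig.
rewrite ep dp.
have [tq|qt] := ltP t q.
  by have [_ ->] := mid t (introT andP (conj pt (ltW tq))); rewrite k0 mul0r addr0.
rewrite (integ_split pq qt); last exact: integrable_onS ig.
have [_ ->] := right t (introT andP (conj qt tT)); rewrite eq k0 mul0r add0r.
rewrite -integ_split//; last by apply: integrable_onS itf => //; lra.
by rewrite /q in qt; lra.
Qed.

(** While the state rests at w(ts), a control along [d], orthogonal to w(ts), neither moves it nor
    costs anything; it only adds to the integral. All states remain visited, so further pauses can
    follow. *)
Lemma stop_insertion R (n : nat) (T ts : R) (c w : R -> 'cV[R]_n)
    (d : 'cV[R]_n) :
  0 < T -> 0 <= ts <= T -> rank1_pair T c w -> d != 0 -> dotp d (w ts) = 0 ->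
  exists c' w' : R -> 'cV[R]_n,
    [/\ rank1_pair T c' w',
        mx_integral `[0, T] (fun t => c' t *m (c' t)^T) =
          mx_integral `[0, T] (fun t => c t *m (c t)^T) + d *m d^T,
        cost T (fun t => c' t *m (c' t)^T) w' = cost T (fun t => c t *m (c t)^T) w &
        forall t, 0 <= t <= T -> exists2 t', 0 <= t' <= T & w' t' = w t].
Proof.
move=> T0 tsT [itc [C cC] c0 [w1 [itv wE]]] d0 dw; have /andP[ts0 tsT'] := tsT.
have s2 : Num.sqrt 2 != 0 :> R by rewrite sqrtr_eq0 -ltNge.
have sT : Num.sqrt (2 / T) != 0 by rewrite sqrtr_eq0 -ltNge divr_gt0.
(* Coordinate form of the field of a rank-one control: scaling its vector by [s] multiplies the
   field by s^2. *)
have alg (s k D C' W : R) : s ^+ 2 = k ->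
    - (s * D * (s * C')) + (s * D) ^+ 2 * W = k * (- (D * C') + D ^+ 2 * W).
  by move=> <-; ring.
pose ps := stop_case T ts id ts.
(* The factor sqrt 2 accounts for the double speed, and sqrt (2 / T) makes the pause of length T / 2
   contribute exactly d d^T. *)
pose c' := stop_case T ts (fun t => Num.sqrt 2 *: c t) (Num.sqrt (2 / T) *: d).
pose w' t := w (ps t).
have psT t : 0 <= t <= T -> 0 <= ps t <= T.
  move=> /andP[t0 tT]; rewrite /ps /stop_case; case: ltP => h1; first by lra.
  by case: ltP => h2 //; lra.
(* If ts = 0 the first test fails at time 0, and the pause itself gives the value 0. *)
have ps0 : ps 0 = 0.
  rewrite /ps /stop_case mulr0; case: ltP => // h1; rewrite ifT; first by lra.
  by lra.
have outerE i j t : (c' t *m (c' t)^T) i j =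
    stop_case T ts (fun t => 2 * (c t *m (c t)^T) i j) ((2 / T) * (d *m d^T) i j) t.
  rewrite /c' /stop_case; do 2?case: ifP => _;
  rewrite !mxE !big_ord1 !mxE mulrACA -expr2 sqr_sqrtr//.
  by rewrite divr_ge0// ltW.
have qE t : qform (c' t *m (c' t)^T) (w' t) =
    stop_case T ts (fun t => 2 * qform (c t *m (c t)^T) (w t)) 0 t.
  rewrite qform_outer /w' /ps /c' /stop_case; do 2?case: ifP => _; rewrite ?qform_outer dotpZl.
  - by rewrite exprMn sqr_sqrtr.
  - by rewrite dw mulr0 expr0n.
  - by rewrite exprMn sqr_sqrtr.
have vE t i : vfield (c' t *m (c' t)^T) (w' t) i 0 =
    stop_case T ts (fun t => 2 * vfield (c t *m (c t)^T) (w t) i 0) 0 t.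
  rewrite /vfield mul_outer qform_outer /w' /ps /c' /stop_case.
  do 2?case: ifP => _; rewrite ?mul_outer ?qform_outer dotpZl !mxE.
  - by apply: alg; rewrite sqr_sqrtr.
  - by rewrite dw !mulr0 expr0n !mul0r oppr0 addr0.
  - by apply: alg; rewrite sqr_sqrtr.
exists c', w'; split.
- split.
  + move=> i j; have [h _ _] := stop_integral ((2 / T) * (d *m d^T) i j) T0 tsT (itc i j).
    by apply: eq_integrable_on h => t _; rewrite outerE.
  + exists (Num.sqrt 2 * C + Num.sqrt (2 / T) * \sum_i `|d i 0|) => t i.
    have s0 : 0 <= \sum_i `|d i 0| by rewrite sumr_ge0.
    have C0 : 0 <= C by exact: le_trans (cC t i).
    have di : `|d i 0| <= \sum_i `|d i 0| by rewrite (bigD1 i)//= lerDl sumr_ge0.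
    rewrite /c' /stop_case; do 2?case: ifP => _; rewrite mxE normrM ger0_norm ?sqrtr_ge0//.
    * by rewrite (le_trans (ler_wpM2l _ (cC _ i)))// lerDl mulr_ge0.
    * by rewrite (le_trans (ler_wpM2l _ di))// lerDr mulr_ge0.
    * by rewrite (le_trans (ler_wpM2l _ (cC _ i)))// lerDl mulr_ge0.
  + move=> t; rewrite /c' /stop_case; do 2?case: ifP => _; rewrite scaler_eq0 negb_or;
    by rewrite ?s2 ?sT ?c0 ?d0.
  + split; first by move=> t tT; exact/w1/psT.
    have v0 i := stop_integral 0 T0 tsT (itv i 0).
    split.
      move=> i j; rewrite (ord1 j); have [h _ _] := v0 i.
      by apply: eq_integrable_on h => t _; rewrite -vE.
    move=> t tT; apply/colP => i.
    transitivity (w 0 i 0 + integ (fun u => vfield (c u *m (c u)^T) (w u) i 0) 0 (ps t)).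
      by rewrite [LHS](congr1 (fun x : 'cV[R]_n => x i 0) (wE _ (psT t tT))) mxE mx_integralE.
    rewrite mxE mx_integralE /w' ps0; congr (_ + _).
    have [_ _ /(_ erefl _ tT) <-] := v0 i.
    by apply: eq_integ => u _; rewrite -vE.
- apply/matrixP => i j; rewrite [RHS]mxE !mx_integralE.
  have [_ + _] := stop_integral ((2 / T) * (d *m d^T) i j) T0 tsT (itc i j).
  rewrite (_ : 2 / T * _ * _ = (d *m d^T) i j) => [<-|].
    by apply: eq_integ => t _; rewrite outerE.
  by field; rewrite gt_eqF.
- have iq : integrable_on (fun t => qform (c t *m (c t)^T) (w t)) 0 T.
    apply: integrable_on_qform => //.
      by move=> i; apply: (primitive_measurable i 0 (ltW T0)); split; [exact: itv|exact: wE].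
    by move=> u i uT; apply/unit_sphere_coord/w1.
  rewrite /cost; have [_ + _] := stop_integral 0 T0 tsT iq; rewrite mul0r addr0 => h.
  by apply: etrans h; apply: eq_integ => t _; rewrite qE.
- move=> t /andP[t0 tT]; have [h|h] := ltP t ts.
    exists (t / 2); first by lra.
    rewrite /w' /ps /stop_case ifT; first by congr w; field.
    by rewrite ltr_pM2r.
  exists ((t + T) / 2); first by lra.
  rewrite /w' /ps /stop_case ifF; last by apply/negbTE; rewrite -leNgt; lra.
  rewrite ifF; last by apply/negbTE; rewrite -leNgt; lra.
  by congr w; rewrite /=; field.
Qed.

Lemma stops_insertion R (n : nat) (T : R) (ds : seq 'cV[R]_n)
    (c w : R -> 'cV[R]_n) :
  0 < T -> rank1_pair T c w ->
  (forall d, d \in ds -> exists2 t, 0 <= t <= T & dotp d (w t) = 0) ->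
  exists c' w' : R -> 'cV[R]_n,
    [/\ rank1_pair T c' w',
        mx_integral `[0, T] (fun t => c' t *m (c' t)^T) =
          mx_integral `[0, T] (fun t => c t *m (c t)^T) + \sum_(d <- ds) d *m d^T &
        cost T (fun t => c' t *m (c' t)^T) w' = cost T (fun t => c t *m (c t)^T) w].
Proof.
move=> T0; elim: ds c w => [|d ds IH] c w cw dsw.
  by exists c, w; rewrite big_nil addr0.
(* A zero vector adds nothing to the integral and is skipped, since a pause with it would make the
   control vanish. *)
have [d0|d0] := eqVneq d 0.
  have [|c' [w' h]] := IH _ _ cw; first by move=> e eds; apply: dsw; rewrite inE eds orbT.
  by exists c', w'; rewrite big_cons d0 mul0mx add0r.
have [t tT dt] := dsw d (mem_head _ _).
have [c1 [w1 [cw1 I1 J1 R1]]] := stop_insertion T0 tT cw d0 dt.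
have [|c' [w' [cw' I' J']]] := IH _ _ cw1.
  move=> e eds; have [|u uT eu] := dsw e; first by rewrite inE eds orbT.
  by have [u' u'T wu] := R1 u uT; exists u' => //; rewrite wu.
by exists c', w'; split => //; rewrite ?J' ?J1// I' I1 big_cons addrA.
Qed.

(** The rank-one part of a minimizer already has its motion and its cost; only the integral falls
    short, by that of the remainder C. The pauses restore exactly this deficit, so admissibility
    returns while the cost stays minimal. *)
Lemma ocp_rank1_minimizer R (a b : R) (n : nat) (T : R) :
  0 < T -> 0 < a -> a <= b -> (0 < n)%N ->
  exists c w : R -> 'cV[R]_n,
    [/\ rank1_pair T c w, admissible a b T (fun t => c t *m (c t)^T) &
        cost T (fun t => c t *m (c t)^T) w = ocp_inf a b n T].
Proof.
move=> T0 a0 ab n0; have T0' := ltW T0.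
have [kap [S [w [kap0 pS mS [_ itS la lb] [wS wJ]]]]] := ocp_minimizer_exists T0 a0 ab n0.
have [w1 wP] := wS.
have mw i : measurable_fun `[0, T] (fun t => w t i 0) := primitive_measurable i 0 T0' wP.
have [c [mc cC c0 pC]] := rank1_splitting kap0 pS mS mw.
have wc t i : 0 <= t <= T -> `|w t i 0| <= 1 by move=> /w1/unit_sphere_coord.
have itc : mx_integrable `[0, T] (fun t => c t *m (c t)^T).
  move=> i j; apply: (@integrable_on_bounded _ _ _ _ ((kap + 1) * (kap + 1))).
    rewrite (_ : (fun t => _) = fun t => c t i 0 * c t j 0); first exact: measurable_funM.
    by apply/funext => t; rewrite mxE big_ord1 mxE.
  by move=> t _; rewrite mxE big_ord1 mxE normrM ler_pM.
have mulE t : S t *m w t = c t *m (c t)^T *m w t.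
  by have [_ /eqP] := pC t; rewrite mulmxBl subr_eq0 => /eqP.
have qE t : qform (S t) (w t) = qform (c t *m (c t)^T) (w t).
  by rewrite !qform_bform !bform_dotp mulE.
have cw : rank1_pair T c w.
  split; [exact: itc|by exists (kap + 1)|exact: c0|split; first exact: w1].
  rewrite (_ : (fun t => _) = (fun t => - (S t *m w t) + qform (S t) (w t) *: w t))//.
  by apply/funext => t; rewrite mulE qE.
have itC : mx_integrable `[0, T] (fun t => S t - c t *m (c t)^T).
  move=> i j; apply: (@eq_integrable_on _ (fun t => S t i j - (c t *m (c t)^T) i j)).
    by move=> t _; rewrite !mxE.
  exact: (integrable_onB (itS i j) (itc i j)).
pose A t := mx_integral `[0, t] (fun t => S t - c t *m (c t)^T).
have AE s t : 0 <= s -> s <= t -> t <= T ->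
    A t - A s = mx_integral `[s, t] (fun t => S t - c t *m (c t)^T).
  move=> s0 st tT; rewrite /A (mx_integral_split s0 st) 1?addrC ?addKr//.
  exact: mx_integrableS itC.
have wL s t i : 0 <= s -> s <= t -> t <= T ->
    `|w t i 0 - w s i 0| <= vfield_cst R n * kap * (t - s).
  move=> s0 st tT; rewrite (primitive_increment _ _ wP s0 st tT).
  apply: norm_integ_le_cst => //; first by have [h _] := wP; exact: integrable_onS (h i 0).
  move=> u /andP[su ut]; have [pSu <-] := pS u.
  apply: norm_vfield_le => // j; apply: wc.
  by rewrite (le_trans s0 su) (le_trans ut tT).
have trC t : \tr (S t - c t *m (c t)^T) <= kap.
  by rewrite linearB /= (pS t).2 gerBl psd_tr_ge0//; exact: psd_outer.
pose L := vfield_cst R n * kap.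
have L0 : 0 <= L by rewrite mulr_ge0 ?vfield_cst_ge0// ltW.
have A0 : A 0 = 0 by rewrite /A mx_integral_nil.
have pA s t : 0 <= s -> s <= t -> t <= T -> psd (A t - A s).
  move=> s0 st tT; rewrite AE//; apply: psd_integral => [|u _]; last exact: (pC u).1.
  exact: mx_integrableS itC.
(* C(u) w(u) = 0 gives C(u) w(s) = C(u) (w(s) - w(u)), of order u - s; integrating yields the
   quadratic bound. *)
have Aw s t i : 0 <= s -> s <= t -> t <= T ->
    `|((A t - A s) *m w s) i 0| <= n%:R * (kap * L) * (t - s) ^+ 2.
  move=> s0 st tT; rewrite AE// !mxE.
  have itCst : mx_integrable `[s, t] (fun t => S t - c t *m (c t)^T) by exact: mx_integrableS itC.
  rewrite (eq_bigr (fun j => integ (fun u => w s j 0 * (S u - c u *m (c u)^T) i j) s t)); last first.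
    by move=> j _; rewrite mx_integralE mulrC -integZ; [|exact: (itCst i j)].
  rewrite -integ_sum => [|j _]; last exact: (integrable_onZ _ (itCst i j)).
  rewrite expr2 [leRHS]mulrA; apply: norm_integ_le_cst => //.
    by apply: integrable_on_sum => j _; exact: (integrable_onZ _ (itCst i j)).
  move=> u /andP[su ut]; have [pCu /(congr1 (fun x : 'cV[R]_n => x i 0))] := pC u.
  rewrite [X in X = _ -> _]mxE [X in _ = X -> _]mxE => Cw.
  rewrite -[X in `|X|]subr0 -[X in _ - X]Cw -sumrB -mulrA; apply: norm_sum_le => j.
  rewrite mulrC -mulrBr normrM -mulrA ler_pM//.
    exact: (le_trans (psd_entry i j pCu)).
  rewrite distrC (le_trans (wL _ _ _ s0 su (le_trans ut tT)))//.
  by rewrite ler_wpM2l// lerD2r.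
have [tau [B [tauT pB Bw BE]]] := kernel_sum T0 A0 w1 wL pA Aw.
have /choice[cs hcs] : forall i, exists cs : seq 'cV[R]_n, B i = \sum_(c <- cs) c *m c^T /\
    forall x, B i *m x = 0 -> forall c, c \in cs -> dotp c x = 0.
  by move=> i; have [cs h1 h2] := psd_sum_outer (pB i); exists cs.
have [|c' [w' [cw' I' J']]] := @stops_insertion R n T (flatten [seq cs i | i <- enum 'I_(n * n)]) c w T0 cw.
  move=> d /flatten_mapP[i _ di]; exists (tau i) => //.
  by apply: (hcs i).2 di.
exists c', w'; split => //; last first.
  by rewrite J' -wJ; apply: eq_integ => t _; rewrite qE.
have IS : mx_integral `[0, T] (fun t => c' t *m (c' t)^T) = mx_integral `[0, T] S.
  rewrite I' big_flatten big_map big_enum /=.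
  rewrite (eq_bigr B) => [|i _]; last by rewrite (hcs i).1.
  rewrite BE /A; apply/matrixP => i j; rewrite [LHS]mxE !mx_integralE.
  rewrite -(integD (itc i j) (itC i j)); apply: eq_integ => t _.
  by rewrite [X in _ + X]mxE [X in _ + (_ + X)]mxE addrC subrK.
have [itc' _ _ _] := cw'.
by split; rewrite ?IS// => t _; exact: psd_outer.
Qed.

(** * Periodic extension by a reflection *)

Lemma mx_integral_mul R (p m n q : nat) (L : 'M[R]_(p, m)) (N : 'M[R]_(n, q))
    (F : R -> 'M[R]_(m, n)) (s t : R) :
  mx_integrable `[s, t] F ->
  mx_integrable `[s, t] (fun u => L *m F u *m N) /\
  mx_integral `[s, t] (fun u => L *m F u *m N) = L *m mx_integral `[s, t] F *m N.
Proof.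
move=> itF.
have E (A : 'M[R]_(m, n)) i j : (L *m A *m N) i j = \sum_k \sum_l (L i l * N k j) * A l k.
  rewrite mxE; apply: eq_bigr => k _; rewrite mxE mulr_suml.
  by apply: eq_bigr => l _; rewrite mulrAC.
have it1 i j k l : integrable_on (fun u => L i l * N k j * F u l k) s t.
  exact: (integrable_onZ _ (itF l k)).
have it2 i j k : integrable_on (fun u => \sum_l L i l * N k j * F u l k) s t.
  by apply: integrable_on_sum => l _; exact: it1.
split.
  move=> i j; apply: (@eq_integrable_on _ (fun u => \sum_k \sum_l (L i l * N k j) * F u l k)).
    by move=> u _; rewrite E.
  by apply: integrable_on_sum => k _; exact: it2.
apply/matrixP => i j; rewrite E mx_integralE.
transitivity (integ (fun u => \sum_k \sum_l (L i l * N k j) * F u l k) s t).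
  by apply: eq_integ => u _; rewrite E.
rewrite integ_sum => [|k _]; last exact: it2.
apply: eq_bigr => k _; rewrite integ_sum => [|l _]; last exact: it1.
by apply: eq_bigr => l _; rewrite mx_integralE -integZ; [|exact: (itF l k)].
Qed.

Lemma mx_integral_shift R (m n : nat) (F : R -> 'M[R]_(m, n)) (h s t : R) :
  mx_integrable `[s + h, t + h] F ->
  mx_integrable `[s, t] (fun u => F (u + h)) /\
  mx_integral `[s, t] (fun u => F (u + h)) = mx_integral `[s + h, t + h] F.
Proof.
move=> itF.
have key i j := @integ_affine R (fun u => F u i j) 1 h s t ltr01.
split => [i j|].
  have := key i j; rewrite !mul1r => /(_ (itF i j))[h1 _].
  by apply: eq_integrable_on h1 => u _; rewrite mul1r.
apply/matrixP => i j; rewrite !mx_integralE.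
have := key i j; rewrite !mul1r => /(_ (itF i j))[_ <-].
by apply: eq_integ => u _; rewrite mul1r.
Qed.

Lemma eq_mx_integral_endpoint R (m n : nat) (F G : R -> 'M[R]_(m, n)) (s t : R) :
  s <= t -> (forall u, s <= u < t -> F u = G u) -> mx_integrable `[s, t] F ->
  mx_integrable `[s, t] G /\ mx_integral `[s, t] F = mx_integral `[s, t] G.
Proof.
move=> st FG itF.
have key i j := @eq_integ_endpoint R (fun u => F u i j) (fun u => G u i j) s t st
  (fun u h => congr1 (fun A : 'M[R]_(m, n) => A i j) (FG u h)) (itF i j).
split => [i j|]; first exact: (key i j).1.
by apply/matrixP => i j; rewrite !mx_integralE (key i j).2.
Qed.

Lemma mx_integrable_split R (m n : nat) (F : R -> 'M[R]_(m, n)) (s u t : R) :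
  s <= u -> u <= t -> mx_integrable `[s, u] F -> mx_integrable `[u, t] F ->
  mx_integrable `[s, t] F.
Proof. by move=> su ut F1 F2 i j; exact: integrable_on_split (F1 i j) (F2 i j). Qed.

(** Additivity of the integral, lap by lap; any horizon is covered by finitely many laps of length
    [T]. *)
Lemma primitive_on_glue R (m n : nat) (T : R) (f x : R -> 'M[R]_(m, n)) :
  0 < T ->
  (forall k : nat, mx_integrable `[k%:R * T, k.+1%:R * T] f) ->
  (forall (k : nat) t, k%:R * T <= t <= k.+1%:R * T ->
     x t = x (k%:R * T) + mx_integral `[k%:R * T, t] f) ->
  forall T', 0 < T' -> primitive_on T' (x 0) f x.
Proof.
move=> T0 itf xf.
have kT k : k%:R * T <= k.+1%:R * T by rewrite ler_pM2r// ler_nat.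
have kT0 (k : nat) : 0 <= k%:R * T by rewrite mulr_ge0// ltW.
have step : forall k : nat, primitive_on (k%:R * T) (x 0) f x.
  elim=> [|k [IHi IHx]].
    split.
      move=> i j; rewrite mul0r.
      apply: (integrable_on_bounded (C := `|f 0 i j|)).
        by rewrite set_itv1; exact: measurable_fun_set1.
      by move=> u; rewrite -eq_le => /eqP <-.
    by move=> t; rewrite mul0r -eq_le => /eqP <-; rewrite mx_integral_nil addr0.
  have it1 : mx_integrable `[0, k.+1%:R * T] f.
    exact: mx_integrable_split (kT0 k) (kT k) IHi (itf k).
  split => // t /andP[t0 tk]; have [tk'|/ltW kt] := leP t (k%:R * T).
    by apply: IHx; rewrite t0.
  rewrite (xf k) ?kt// IHx ?lexx ?kT0// -addrA -mx_integral_split//.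
  exact: mx_integrableS it1.
move=> T' T'0; have [it px] := step (Num.truncn (T' / T)).+1.
have le : T' <= (Num.truncn (T' / T)).+1%:R * T.
  by rewrite -ler_pdivrMr// ltW// truncnS_gt.
split; first exact: mx_integrableS it.
by move=> t /andP[t0 tT]; apply: px; rewrite t0 (le_trans tT).
Qed.

(** The Householder reflection along x - y: as both vectors are unit, |x - y|^2 = 2 <x - y, x>, so
    it sends [x] to [y]. Being an involution, it makes the extended motion close after two laps. *)
Lemma reflection R (n : nat) (x y : 'cV[R]_n) :
  unit_sphere x -> unit_sphere y ->
  exists Q : 'M[R]_n, [/\ Q^T = Q, Q *m Q = 1%:M & Q *m x = y].
Proof.
move=> /unit_sphereE x1 /unit_sphereE y1.
have [<-|xy] := eqVneq x y; first by exists 1%:M; rewrite trmx1 !mul1mx.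
pose u := x - y; pose N := dotp u u.
have N0 : N != 0 by apply: contraNneq xy => /dotp_eq0/eqP; rewrite subr_eq0.
have NE : N = 2 * dotp u x.
  by rewrite /N /u !dotpBl !dotpBr x1 y1 (dotpC y x); ring.
have uE : x - u = y by rewrite /u subKr.
move: (u) @N N0 NE uE => {}u N N0 NE uE.
exists (1%:M - (2 / N) *: (u *m u^T)); split.
- by rewrite linearB /= trmx1 linearZ /= trmx_mul trmxK.
- have PP : u *m u^T *m (u *m u^T) = N *: (u *m u^T).
    by rewrite mulmxA mul_outer scalemxAl.
  rewrite mulmxBr mulmx1 mulmxBl mul1mx -scalemxAl -scalemxAr PP !scalerA.
  rewrite -scalerBl -addrA -opprD -scalerDl [X in _ - X *: _](_ : _ = 0) ?scale0r ?subr0//.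
  by field.
- rewrite mulmxBl mul1mx -scalemxAl mul_outer scalerA.
  by rewrite mulrAC -NE divff// scale1r uE.
Qed.

Lemma truncn_lap R (T t : R) (k : nat) : 0 < T ->
  k%:R * T <= t < k.+1%:R * T -> Num.truncn (t / T) = k.
Proof.
move=> T0 /andP[h1 h2]; apply: truncn_def.
by rewrite ler_pdivlMr// h1/= ltr_pdivrMr.
Qed.

(** Equivariance of the dynamics under orthogonal maps, which makes the reflected pieces
    trajectories again. *)
Lemma vfield_congr R (n : nat) (P A : 'M[R]_n) (x : 'cV[R]_n) :
  P^T *m P = 1%:M -> vfield (P *m A *m P^T) (P *m x) = P *m vfield A x.
Proof.
move=> PP; have qE : qform (P *m A *m P^T) (P *m x) = qform A x.
  by rewrite -{1}[P]trmxK qform_congr mulmxA PP mul1mx.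
rewrite /vfield qE mulmxDr mulmxN scalemxAr; congr (- _ + _).
by rewrite -!mulmxA (mulmxA P^T) PP mul1mx.
Qed.

Lemma periodic_extension R (n : nat) (T : R) (c w : R -> 'cV[R]_n)
    (Q : 'M[R]_n) : 0 < T -> rank1_pair T c w ->
  Q^T = Q -> Q *m Q = 1%:M -> Q *m w 0 = w T ->
  exists c' w' : R -> 'cV[R]_n, let S t := c' t *m (c' t)^T in
    [/\ [/\ exists C, forall t i, `|c' t i 0| <= C, forall t, c' t != 0,
          periodic_on_nonneg (2 * T) c' & periodic_on_nonneg (2 * T) w'],
        forall T', 0 < T' ->
          mx_integrable `[0, T'] S /\ sphere_trajectory T' S (w 0) w',
        forall t, 0 <= t < T -> c' t = c t /\ w' t = w t,
        forall t, 0 <= t < T -> c' (t + T) = Q *m c t /\ w' (t + T) = Q *m w t &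
        w' 0 = w 0 /\ w' T = w T].
Proof.
move=> T0 [itc [C cC] c0 [w1 [itv wE]]] QT QQ Qw; have T0' := ltW T0.
(* The powers of the involution [Q]: only the parity of the lap counts, which yields the period
   [2 * T]. *)
pose P (k : nat) : 'M[R]_n := if odd k then Q else 1%:M.
have PT k : (P k)^T = P k by rewrite /P; case: ifP; rewrite ?trmx1.
have PP k : P k *m P k = 1%:M by rewrite /P; case: ifP; rewrite ?mulmx1.
have PTP k : (P k)^T *m P k = 1%:M by rewrite PT.
have PS k : P k *m Q = P k.+1 by rewrite /P /=; case: odd; rewrite ?QQ ?mul1mx.
pose lap t := Num.truncn (t / T).
pose c' t := P (lap t) *m c (t - (lap t)%:R * T).
pose w' t := P (lap t) *m w (t - (lap t)%:R * T).
have lapE (k : nat) t : k%:R * T <= t < k.+1%:R * T -> lap t = k by exact: truncn_lap.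
have kS (k : nat) : k.+1%:R * T = k%:R * T + T :> R by rewrite -natr1 mulrDl mul1r.
have c'E (k : nat) t : k%:R * T <= t < k.+1%:R * T -> c' t = P k *m c (t - k%:R * T).
  by move=> h; rewrite /c' (lapE k).
(* Valid up to the closed right end because Q w(0) = w(T) makes consecutive laps match; the formula
   [c'E] for the control is restricted to half-open laps. *)
have w'E (k : nat) t : k%:R * T <= t <= k.+1%:R * T -> w' t = P k *m w (t - k%:R * T).
  move=> /andP[h1]; rewrite le_eqVlt => /predU1P[->|h2]; last first.
    by rewrite /w' (lapE k)// h1.
  rewrite /w' (lapE k.+1); last by rewrite lexx kS (kS k.+1) kS ltrDl.
  by rewrite subrr kS addrC addKr -PS -mulmxA Qw.
pose S t := c' t *m (c' t)^T; pose S0 t := c t *m (c t)^T.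
have SE (k : nat) t : k%:R * T <= t < k.+1%:R * T ->
    S t = P k *m S0 (t - k%:R * T) *m (P k)^T.
  by move=> h; rewrite /S (c'E k)// trmx_mul !mulmxA.
have vE (k : nat) t : k%:R * T <= t < k.+1%:R * T ->
    vfield (S t) (w' t) = P k *m vfield (S0 (t - k%:R * T)) (w (t - k%:R * T)).
  move=> h; rewrite (SE k)// (w'E k); first exact: vfield_congr.
  by case/andP: h => -> /ltW.
have kk (k : nat) : k%:R * T <= k.+1%:R * T :> R by rewrite kS lerDl.
have shiftE (m : nat) (F : R -> 'M[R]_(n, m)) (k : nat) t : mx_integrable `[0, T] F ->
    k%:R * T <= t <= k.+1%:R * T ->
    mx_integrable `[k%:R * T, t] (fun u => F (u - k%:R * T)) /\
    mx_integral `[k%:R * T, t] (fun u => F (u - k%:R * T)) =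
    mx_integral `[0, t - k%:R * T] F.
  move=> itF /andP[h1 h2]; have := @mx_integral_shift R n m F (- (k%:R * T)) (k%:R * T) t.
  rewrite subrr; apply; apply: mx_integrableS itF => //.
  by rewrite lerBlDr addrC -kS.
have itS (k : nat) : mx_integrable `[k%:R * T, k.+1%:R * T] S.
  have [|h1 _] := shiftE n S0 k (k.+1%:R * T) itc; first by rewrite lexx kk.
  have [h2 _] := mx_integral_mul (P k) (P k)^T h1.
  by have [] := eq_mx_integral_endpoint (kk k) (fun u h => esym (SE k u h)) h2.
pose v t := vfield (S t) (w' t); pose v0 t := vfield (S0 t) (w t).
have itvk (k : nat) t : k%:R * T <= t <= k.+1%:R * T ->
    mx_integrable `[k%:R * T, t] v /\
    mx_integral `[k%:R * T, t] v = P k *m mx_integral `[0, t - k%:R * T] v0.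
  move=> h; have [h1 e1] := shiftE 1%N v0 k t itv h.
  have [h2 e2] := mx_integral_mul (P k) (1%:M : 'M[R]_1) h1.
  have /andP[kt tk] := h.
  have vE' u : k%:R * T <= u < t -> P k *m v0 (u - k%:R * T) *m 1%:M = v u.
    by move=> /andP[ku ut]; rewrite mulmx1 /v (vE k)// ku (lt_le_trans ut).
  have [h3 e3] := eq_mx_integral_endpoint kt vE' h2.
  by split => //; rewrite -e3 e2 mulmx1 e1.
have prim : forall T', 0 < T' -> primitive_on T' (w' 0) v w'.
  apply: primitive_on_glue T0 _ _ => [k|k t h].
    by apply: (itvk k _ _).1; rewrite lexx kk.
  rewrite (itvk k t h).2 (w'E k)// (w'E k (k%:R * T)) ?lexx ?kk// subrr -mulmxDr.
  congr (_ *m _); apply: wE; have /andP[h1 h2] := h.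
  by rewrite subr_ge0 h1/= lerBlDr addrC -kS.
have lap0 : lap 0 = 0%N by apply: lapE; rewrite mul0r mul1r lexx.
have w'0 : w' 0 = w 0 by rewrite /w' lap0 mul0r subr0 mul1mx.
have lap_itv t : 0 <= t -> (lap t)%:R * T <= t < (lap t).+1%:R * T.
  by move=> t0; rewrite -ler_pdivlMr// -ltr_pdivrMr// truncn_itv// divr_ge0.
have lapD t : 0 <= t -> lap (t + 2 * T) = (lap t).+2.
  move=> /lap_itv/andP[h1 h2]; apply: lapE; rewrite !kS.
  by rewrite !kS in h2; apply/andP; split; lra.
have shiftP t (k : nat) : t + 2 * T - k.+2%:R * T = t - k%:R * T.
  by rewrite !kS; ring.
have low t : 0 <= t < T -> 0%:R * T <= t < 1%:R * T by rewrite mul0r mul1r.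
have high t : 0 <= t < T -> 1%:R * T <= t + T < 2%:R * T.
  by move=> /andP[h1 h2]; rewrite mul1r; apply/andP; split; lra.
exists c', w'; split.
- split.
  + exists (C + \sum_i \sum_j `|Q i j| * C) => t i.
    have C0 : 0 <= C by exact: le_trans (cC 0 i).
    have s0 k : 0 <= \sum_j `|Q k j| * C by rewrite sumr_ge0// => j _; rewrite mulr_ge0.
    rewrite /c' /P; case: ifP => _.
      rewrite mxE (le_trans (ler_norm_sum _ _ _))// [X in C + X](bigD1 i)//=.
      rewrite addrCA ler_wpDr ?addr_ge0 ?sumr_ge0// ler_sum// => j _.
      by rewrite normrM ler_wpM2l.
    by rewrite mul1mx ler_wpDr ?cC// sumr_ge0.
  + move=> t; apply: contraNneq (c0 (t - (lap t)%:R * T)) => h.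
    by rewrite -[c _]mul1mx -(PP (lap t)) -mulmxA -/(c' t) h mulmx0.
  + by move=> t t0; rewrite /c' lapD// shiftP /P /= negbK.
  + by move=> t t0; rewrite /w' lapD// shiftP /P /= negbK.
- move=> T' T'0; split; last first.
    split; last by have := prim T' T'0; rewrite w'0.
    move=> t /andP[t0 _]; rewrite unit_sphereE /w' dotp_mull mulmxA PTP mul1mx.
    apply/unit_sphereE/w1; have /andP[h1 h2] := lap_itv t t0.
    by rewrite subr_ge0 h1/= lerBlDr addrC -kS ltW.
  have le : T' <= (lap T').+1%:R * T by have /andP[_ /ltW] := lap_itv T' (ltW T'0).
  apply: mx_integrableS (lexx 0) le _.
  elim: (lap T').+1 => [|k IH]; last first.
    by apply: mx_integrable_split IH (itS k) => //; rewrite mulr_ge0.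
  by have := itS 0%N; rewrite mul0r; apply: mx_integrableS; rewrite ?mul1r.
- move=> t tT; rewrite (c'E 0%N) ?low// (w'E 0%N); last first.
    by have /andP[-> /ltW ->] := low t tT.
  by rewrite !mul1mx mul0r subr0.
- move=> t tT; rewrite (c'E 1%N) ?high// (w'E 1%N); last first.
    by have /andP[-> /ltW ->] := high t tT.
  by rewrite mul1r addrK.
- split => //; rewrite (w'E 0%N) ?mul0r ?mul1r ?T0' ?lexx// subr0.
  by rewrite mul1mx.
Qed.

(** The part beyond [p] is a shifted copy of the part over [[0, t]], and the two cancel. *)
Lemma periodic_window_integral R (m n : nat) (p t : R) (F : R -> 'M[R]_(m, n)) :
  0 < p -> 0 <= t -> periodic_on_nonneg p F ->
  (forall T', 0 < T' -> mx_integrable `[0, T'] F) ->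
  mx_integral `[t, t + p] F = mx_integral `[0, p] F.
Proof.
move=> p0 t0 Fp itF; have p0' := ltW p0.
have tp0 : 0 < t + p by rewrite ltr_wpDl.
have tp : t <= t + p by rewrite lerDl.
have pt : p <= t + p by rewrite lerDr.
have := mx_integral_split t0 tp (itF _ tp0).
rewrite (mx_integral_split p0' pt (itF _ tp0)).
have := @mx_integral_shift R m n F p 0 t; rewrite add0r.
case; [by apply: mx_integrableS (itF _ tp0)|move=> _ <-; rewrite addrC].
have -> : mx_integral `[0, t] (fun u => F (u + p)) = mx_integral `[0, t] F.
  apply/matrixP => i j; rewrite !mx_integralE.
  by apply: eq_integ => u /andP[u0 _]; rewrite Fp.
by move/addrI.
Qed.

(** Over the first period the integral is M + Q M Q^T, each summand lying between a Id and b Id as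
    [Q] is orthogonal; every other window reduces to it by periodicity. The second half is the first
    one conjugated by [Q], with equal cost, hence a minimizer too. *)
Lemma periodic_minimizer R (a b T : R) (n : nat) :
  0 < a -> a <= b -> 0 < T -> (0 < n)%N ->
  exists c w : R -> 'cV[R]_n, let S t := c t *m (c t)^T in
    [/\ [/\ exists C, forall t i, `|c t i 0| <= C, forall t, c t != 0,
          periodic_on_nonneg (2 * T) c & periodic_on_nonneg (2 * T) w],
        forall T', 0 < T' ->
          mx_integrable `[0, T'] S /\ sphere_trajectory T' S (w 0) w,
        forall t, 0 <= t ->
          loewner_le (2 * a)%:M (mx_integral `[t, t + 2 * T] S) /\
          loewner_le (mx_integral `[t, t + 2 * T] S) (2 * b)%:M &
        ocp_minimizer a b T S (w 0) /\
        ocp_minimizer a b T (fun t => S (t + T)) (w T)].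
Proof.
move=> a0 ab T0 n0; have T0' := ltW T0.
have [c0 [w0 [cw0 adm0 J0]]] := ocp_rank1_minimizer T0 a0 ab n0.
have [itc0 _ _ [w01 [_ _]]] := cw0.
have T00 : (0 : R) <= 0 <= T by rewrite lexx.
have TT : 0 <= T <= T by rewrite lexx andbT.
have [Q [QT QQ Qw]] := reflection (w01 0 T00) (w01 T TT).
have [c [w [[cC cn0 cp wp] Sw e1 e2 [w0E wTE]]]] := periodic_extension T0 cw0 QT QQ Qw.
pose S t := c t *m (c t)^T; pose S0 t := c0 t *m (c0 t)^T.
have QTQ : Q^T *m Q = 1%:M by rewrite QT.
have SE1 t : 0 <= t < T -> S0 t = S t by move=> /e1[h _]; rewrite /S h.
have SE2 t : 0 <= t < T -> Q *m S0 t *m Q^T = S (t + T).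
  by move=> /e2[h _]; rewrite /S h trmx_mul !mulmxA.
have [it1 I1] := eq_mx_integral_endpoint T0' SE1 itc0.
have [itQ IQ] := mx_integral_mul Q Q^T itc0.
have [it2 I2] := eq_mx_integral_endpoint T0' SE2 itQ.
have qQ M x : qform (Q *m M *m Q^T) x = qform M (Q *m x).
  by rewrite -{1}QT -{2}QT trmxK qform_congr.
have dQ x : dotp (Q *m x) (Q *m x) = dotp x x by rewrite dotp_mull mulmxA QTQ mul1mx.
have [pS0 _ la lb] := adm0.
set M := mx_integral `[0, T] _ in la lb I1 IQ.
have la2 : loewner_le a%:M (Q *m M *m Q^T).
  by move=> x; rewrite qQ qform_scalar -dQ -(qform_scalar a); exact: la.
have lb2 : loewner_le (Q *m M *m Q^T) b%:M.
  by move=> x; rewrite qQ qform_scalar -dQ -(qform_scalar b); exact: lb.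
have iw0 : integrable_on (fun t => qform (S0 t) (w0 t)) 0 T.
  have [_ _ _ [_ pw]] := cw0.
  apply: integrable_on_qform => //; first by move=> i; exact: (primitive_measurable i 0 T0' pw).
  by move=> u i uT; apply/unit_sphere_coord/w01.
have T2 : 0 < 2 * T by rewrite mulr_gt0.
have TT2 : T <= 2 * T by lra.
have Sp : periodic_on_nonneg (2 * T) S by move=> t t0; rewrite /S cp.
have itS2 := (Sw _ T2).1.
have shift2 : mx_integral `[0, T] (fun t => S (t + T)) = mx_integral `[T, 2 * T] S.
  have := @mx_integral_shift R n n S T 0 T.
  rewrite add0r -[T + T](_ : 2 * T = _); last by ring.
  by case=> //; exact: mx_integrableS itS2.
have I12 : mx_integral `[0, 2 * T] S = M + Q *m M *m Q^T.
  by rewrite (mx_integral_split T0' TT2 itS2) -shift2 -I2 IQ I1.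
have Sw' T' : 0 < T' -> mx_integrable `[0, T'] S /\ sphere_trajectory T' S (w0 0) w by exact: Sw.
have cE1 t : 0 <= t < T -> qform (S0 t) (w0 t) = qform (S t) (w t).
  by move=> tT; rewrite -SE1// (e1 t tT).2.
have cE2 t : 0 <= t < T -> qform (S0 t) (w0 t) = qform (S (t + T)) (w (t + T)).
  by move=> tT; rewrite -SE2// (e2 t tT).2 qQ mulmxA QQ mul1mx.
have [_ J1] := eq_integ_endpoint T0' cE1 iw0.
have [_ J2] := eq_integ_endpoint T0' cE2 iw0.
have halfT : sphere_trajectory T (fun t => S (t + T)) (w T) (fun t => w (t + T)).
  have [s1 [s2 s3]] := (Sw' _ T2).2.
  split; first by move=> t /andP[t0 tT]; apply: s1; apply/andP; split; lra.
  have sh t : 0 <= t <= T ->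
      mx_integrable `[0, t] (fun u => vfield (S (u + T)) (w (u + T))) /\
      mx_integral `[0, t] (fun u => vfield (S (u + T)) (w (u + T))) =
      mx_integral `[T, t + T] (fun u => vfield (S u) (w u)).
    move=> /andP[t0 tT].
    have := @mx_integral_shift R n 1 (fun u => vfield (S u) (w u)) T 0 t.
    rewrite add0r; apply; apply: mx_integrableS s2 => //; lra.
  split; first exact: (sh T TT).1.
  move=> t tT; rewrite (sh t tT).2; have /andP[t0 tT'] := tT.
  rewrite s3; last by apply/andP; split; lra.
  rewrite (s3 T) -?addrA; last by apply/andP; split; lra.
  have tT2 : T <= t + T by lra.
  rewrite -(mx_integral_split T0' tT2)//.
  by apply: mx_integrableS s2 => //; lra.
exists c, w; split; [by split|by rewrite w0E| |split; split].
- move=> t t0; rewrite (periodic_window_integral T2 t0 Sp) => [|T' /Sw[]//].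
  rewrite I12; split => x; rewrite qformD qform_scalar.
    by move: (la x) (la2 x); rewrite !qform_scalar; lra.
  by move: (lb x) (lb2 x); rewrite !qform_scalar; lra.
- split; [by move=> t _; exact: psd_outer|exact: it1| |]; first by rewrite -I1.
  by rewrite -I1.
- by rewrite w0E; exact: w01.
- exists w; first by rewrite w0E; exact: (Sw' _ T0).2.
  by rewrite -J0; exact: J1.
- split; [by move=> t _; exact: psd_outer|exact: it2| |]; first by rewrite -I2 IQ.
  by rewrite -I2 IQ.
- by rewrite wTE; exact: w01.
- exists (fun t => w (t + T)); first exact: halfT.
  by rewrite -J0; exact: J2.
Qed.

(** * The flow of the linear equation *)

Lemma continuous_integrable_on R (f : R -> R) (s t : R) :
  continuous f -> integrable_on f s t.
Proof.
move=> cf; apply: continuous_compact_integrable; first exact: segment_compact.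
exact: continuous_subspaceT.
Qed.

Lemma integ_derive R (F f : R -> R) (s t : R) : s <= t ->
  (forall x : R, is_derive x (1 : R) F (f x)) -> continuous f ->
  integrable_on f s t /\ integ f s t = F t - F s.
Proof.
move=> st dF cf; have cF : continuous F.
  by move=> x; apply/differentiable_continuous/derivable1_diffP; have [] := dF x.
split; first exact: continuous_integrable_on.
move: st; rewrite le_eqVlt => /predU1P[->|st]; first by rewrite integ_nil subrr.
rewrite /integ /Rintegral (@continuous_FTC2 R f F)//.
- exact: continuous_subspaceT.
- split; first by move=> x _; have [] := dF x.
  + exact/cvg_at_right_filter/cF.
  + exact/cvg_at_left_filter/cF.
- by move=> x _; rewrite derive1E derive_val.
Qed.

Lemma integ_expR R (L t : R) : 0 < L -> 0 <= t ->
  integrable_on (fun u => expR (L * u)) 0 t /\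
  integ (fun u => expR (L * u)) 0 t = (expR (L * t) - 1) / L.
Proof.
move=> L0 t0.
have dF (x : R) : is_derive x (1 : R) (fun u => L^-1 * expR (L * u)) (expR (L * x)).
  apply: is_derive_eq; rewrite !scaler1.
  by rewrite -[LHS]/(L^-1 * (expR (L * x) * L)) mulrCA mulVf ?mulr1// gt_eqF.
have cf : continuous (fun u => expR (L * u)).
  move=> x; apply: continuous_comp; last exact: continuous_expR.
  by apply: cvgM; [exact: cvg_cst|exact: cvg_id].
have [h ->] := integ_derive t0 dF cf; split => //.
by rewrite mulr0 expR0 mulr1 mulrBl mul1r mulrC.
Qed.

Lemma mx_integralN R (m n : nat) (F : R -> 'M[R]_(m, n)) (s t : R) :
  mx_integrable `[s, t] F ->
  mx_integrable `[s, t] (fun u => - F u) /\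
  mx_integral `[s, t] (fun u => - F u) = - mx_integral `[s, t] F.
Proof.
move=> itF; have E i j u : s <= u <= t -> - 1 * F u i j = (- F u) i j by rewrite mxE mulN1r.
have it i j := integrable_onZ (-1) (itF i j).
split => [i j|]; first by apply: eq_integrable_on (it i j); exact: E.
apply/matrixP => i j; rewrite [RHS]mxE !mx_integralE -mulN1r -(integZ (-1) (itF i j)).
by apply: eq_integ => u h; rewrite E.
Qed.

Lemma mx_integrable_mulmx R (p m n : nat) (S : R -> 'M[R]_(p, m))
    (D : R -> 'M[R]_(m, n)) (C s t : R) :
  mx_integrable `[s, t] S ->
  (forall i j, measurable_fun `[s, t] (fun u => D u i j)) ->
  (forall u i j, s <= u <= t -> `|D u i j| <= C) ->
  mx_integrable `[s, t] (fun u => S u *m D u).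
Proof.
move=> itS mD DC i j.
apply: (@eq_integrable_on _ (fun u => \sum_k S u i k * D u k j)).
  by move=> u _; rewrite mxE.
apply: integrable_on_sum => k _; apply: integrable_onM_bounded (itS i k) (mD k j) _.
by move=> u /DC; apply.
Qed.

(* The weight [expR (L * t)] makes integration against [S] a contraction of
   ratio 1/2 on the whole half-line. *)
Lemma flow_kernel R (n m : nat) (S : R -> 'M[R]_n) (D : R -> 'M[R]_(n, m))
    (L K t : R) : 0 < L -> 0 <= t -> 0 <= K ->
  (forall u i, \sum_j `|S u i j| <= L / 2) ->
  mx_integrable `[0, t] S ->
  (forall i j, measurable_fun `[0, t] (fun u => D u i j)) ->
  (forall u i j, 0 <= u <= t -> `|D u i j| <= K * expR (L * u)) ->
  mx_integrable `[0, t] (fun u => S u *m D u) /\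
  forall i j, `|mx_integral `[0, t] (fun u => S u *m D u) i j| <= K / 2 * (expR (L * t) - 1).
Proof.
move=> L0 t0 K0 SL itS mD DK.
have it : mx_integrable `[0, t] (fun u => S u *m D u).
  apply: (mx_integrable_mulmx (C := K * expR (L * t))) => // u i j /andP[u0 ut].
  by rewrite (le_trans (DK _ i j _)) ?u0// ler_wpM2l// ler_expR ler_wpM2l// ltW.
split => // i j; have [ite ie] := integ_expR L0 t0.
(* The primitive of the exponential brings 1 / L against the row bound L / 2, hence the ratio 1 /
   2. *)
have -> : K / 2 * (expR (L * t) - 1) = integ (fun u => L / 2 * K * expR (L * u)) 0 t.
  by rewrite integZ// ie; field; rewrite gt_eqF.
rewrite mx_integralE; apply: norm_integ_le; [exact: it|exact: integrable_onZ|].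
move=> u ut; rewrite mxE (le_trans (ler_norm_sum _ _ _))//.
apply: (@le_trans _ _ (\sum_k `|S u i k| * (K * expR (L * u)))).
  by apply: ler_sum => k _; rewrite normrM ler_wpM2l// DK.
by rewrite -mulr_suml -mulrA ler_wpM2r// mulr_ge0// expR_ge0.
Qed.

Lemma cvg_geometric_half R (C : R) : (fun k : nat => C / 2 ^+ k) @ \oo --> 0.
Proof.
rewrite -[X in _ --> X](mulr0 C); apply: cvgM; first exact: cvg_cst.
rewrite (_ : (fun k => _) = fun k : nat => 2^-1 ^+ k); last by apply/funext => k; rewrite exprVn.
by apply: cvg_expr; rewrite ger0_norm ?invf_lt1 ?ltr1n.
Qed.

Lemma geometric_bound_eq0 R (x C : R) :
  (forall k : nat, `|x| <= C / 2 ^+ k) -> x = 0.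
Proof.
move=> h; apply/eqP; rewrite -normr_le0.
apply: (@cvg_le R \oo (fun=> `|x|) (fun k => C / 2 ^+ k)) => //; first exact: cvg_cst.
exact: cvg_geometric_half.
Qed.

(** [f] minus and plus the tail 2 C / 2^k are monotone in opposite directions with a common limit;
    this gives convergence and the error bound together. *)
Lemma geometric_cauchy R (f : nat -> R) (C : R) :
  (forall k, `|f k.+1 - f k| <= C / 2 ^+ k) ->
  exists l : R, f @ \oo --> l /\ forall k, `|l - f k| <= 2 * C / 2 ^+ k.
Proof.
move=> h; pose u k := f k - 2 * C / 2 ^+ k; pose v k := f k + 2 * C / 2 ^+ k.
have hS (k : nat) : 2 * C / 2 ^+ k.+1 = C / 2 ^+ k.
  by rewrite exprS; field; rewrite expf_neq0.
have h2 (k : nat) : 2 * C / 2 ^+ k = 2 * (C / 2 ^+ k) by rewrite mulrA.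
have uS k : u k <= u k.+1.
  by rewrite /u hS h2; have := h k; rewrite ler_norml => /andP[? ?]; lra.
have vS k : v k.+1 <= v k.
  by rewrite /v hS h2; have := h k; rewrite ler_norml => /andP[? ?]; lra.
have und : nondecreasing_seq u by apply/nondecreasing_seqP.
have vni : nonincreasing_seq v by apply/nonincreasing_seqP.
have C0 : 0 <= C by have := h 0%N; rewrite divr1; exact: le_trans.
have uv k : u k <= v k by rewrite lerD2l; have := divr_ge0 (mulr_ge0 (ler0n R 2) C0) (exprn_ge0 k (ler0n R 2)); lra.
have uc : cvgn u.
  apply: nondecreasing_is_cvgn => //; exists (v 0%N) => _ [k _ <-].
  exact: le_trans (uv k) (vni _ _ (leq0n k)).
have fl : f @ \oo --> limn u.
  rewrite (_ : f = fun k => u k + 2 * C / 2 ^+ k).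
    by rewrite -[X in _ --> X]addr0; apply: cvgD => //; exact: cvg_geometric_half.
  by apply/funext => k; rewrite /u subrK.
have vl : v @ \oo --> limn u.
  by rewrite -[X in _ --> X]addr0; apply: cvgD => //; exact: cvg_geometric_half.
exists (limn u); split => // k; rewrite ler_distl; apply/andP; split.
  exact: nondecreasing_cvgn_le.
rewrite -(cvg_lim (@Rhausdorff R) vl); apply: nonincreasing_cvgn_ge => //.
by apply/cvg_ex; exists (limn u).
Qed.

(** Iterating the contraction improves the weighted bound to K / 2^k for every k. *)
Lemma flow_unique R (n m : nat) (S : R -> 'M[R]_n) (D : R -> 'M[R]_(n, m))
    (L K T : R) : 0 < L -> 0 <= T -> 0 <= K ->
  (forall u i, \sum_j `|S u i j| <= L / 2) ->
  mx_integrable `[0, T] S ->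
  (forall i j, measurable_fun `[0, T] (fun u => D u i j)) ->
  (forall u i j, 0 <= u <= T -> `|D u i j| <= K * expR (L * u)) ->
  (forall t, 0 <= t <= T -> D t = - mx_integral `[0, t] (fun u => S u *m D u)) ->
  forall t, 0 <= t <= T -> D t = 0.
Proof.
move=> L0 T0 K0 SL itS mD DK DE.
have main (k : nat) : forall t i j, 0 <= t <= T -> `|D t i j| <= K / 2 ^+ k * expR (L * t).
  elim: k => [|k IH] t i j tT; first by rewrite divr1; exact: DK.
  have /andP[t0 tT'] := tT.
  have Kk : 0 <= K / 2 ^+ k by rewrite divr_ge0// exprn_ge0.
  have [||u i' j' /andP[u0 ut]|_ h] := flow_kernel (D := D) L0 t0 Kk SL.
  - exact: mx_integrableS itS.
  - by move=> i' j'; apply: measurable_funS (mD i' j') => //; apply: subset_itv; rewrite bnd_simp.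
  - by apply: IH; rewrite u0 (le_trans ut).
  rewrite (DE t tT) mxE normrN (le_trans (h i j))// exprSr invfM mulrA.
  by rewrite ler_wpM2l ?gerBl// mulr_ge0.
move=> t tT; apply/matrixP => i j; rewrite mxE; apply: (@geometric_bound_eq0 R _ (K * expR (L * t))) => k.
by rewrite mulrAC; exact: main.
Qed.

Fixpoint picard R (n : nat) (S : R -> 'M[R]_n) (k : nat) (t : R) : 'M[R]_n :=
  if k is k'.+1 then 1%:M - mx_integral `[0, t] (fun u => S u *m picard S k' u) else 1%:M.

(** Each Picard iterate reproduces the bound exp(L t), because 1 + (exp(L t) - 1) / 2 <= exp(L t),
    and the weighted bound on consecutive differences is halved at each step. *)
Lemma flow_exists R (n : nat) (S : R -> 'M[R]_n) (L : R) : 0 < L ->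
  (forall u i, \sum_j `|S u i j| <= L / 2) ->
  (forall T, 0 < T -> mx_integrable `[0, T] S) ->
  exists2 Phi : R -> 'M[R]_n, is_flow S Phi &
    forall t i j, 0 <= t -> `|Phi t i j| <= expR (L * t).
Proof.
move=> L0 SL itS0.
have itS t : 0 <= t -> mx_integrable `[0, t] S.
  move=> t0; apply: mx_integrableS (itS0 (t + 1) _) => //; first by rewrite lerDl.
  by rewrite ltr_wpDl.
have e1 t : 0 <= t -> 1 <= expR (L * t).
  by move=> t0; rewrite -expR0 ler_expR mulr_ge0// ltW.
have base i j t : 0 <= t -> `|(1%:M : 'M[R]_n) i j| <= 1 * expR (L * t).
  move=> t0; rewrite mul1r mxE; case: (i == j) => /=; first by rewrite normr1 e1.
  by rewrite normr0 expR_ge0.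
pose M := picard S.
have MS k t : M k.+1 t = 1%:M - mx_integral `[0, t] (fun u => S u *m M k u) by [].
have main k : (forall (t : R) i j, 0 <= t -> measurable_fun `[0, t] (fun u => M k u i j)) /\
    (forall t i j, 0 <= t -> `|M k t i j| <= 1 * expR (L * t)).
  elim: k => [|k [IHm IHb]]; first by split => [t i j _|t i j t0]; [exact: measurable_cst|exact: base].
  have ker t (t0 : 0 <= t) := flow_kernel L0 t0 ler01 SL (itS t t0) (fun i j => IHm t i j t0)
    (fun u i j h => IHb u i j (andP h).1).
  have [prim bnd] : (forall t, 0 <= t -> primitive_on t 1%:M (fun u => - (S u *m M k u)) (M k.+1)) /\
    (forall t i j, 0 <= t -> `|M k.+1 t i j| <= 1 * expR (L * t)).
    split=> [t t0|t i j t0]; have [it hb] := ker t t0.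
      have [itN _] := mx_integralN it; split => // u /andP[u0 ut].
      have [itu _] := ker u u0; have [_ ->] := mx_integralN itu; exact: MS.
    rewrite MS mxE [X in _ + X]mxE (le_trans (ler_normB _ _))//.
    have h1 : `|(1%:M : 'M[R]_n) i j| <= 1.
      by have := base i j 0 (lexx 0); rewrite mulr0 expR0 mulr1.
    rewrite mul1r; have := hb i j; have := e1 t t0; lra.
  by split => // t i j t0; exact: primitive_measurable (prim t t0).
clearbody M.
have mM k (t : R) i j : 0 <= t -> measurable_fun `[0, t] (fun u => M k u i j) by exact: (main k).1.
have bM k t i j : 0 <= t -> `|M k t i j| <= 1 * expR (L * t) by exact: (main k).2.
have itM k t : 0 <= t -> mx_integrable `[0, t] (fun u => S u *m M k u).
  move=> t0; have [] := flow_kernel L0 t0 ler01 SL (itS t t0) (fun i j => mM k t i j t0)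
    (fun u i j h => bM k u i j (andP h).1); by [].
have mx_integralB (F G : R -> 'M[R]_n) t : mx_integrable `[0, t] (fun u => S u *m F u) ->
    mx_integrable `[0, t] (fun u => S u *m G u) ->
    mx_integral `[0, t] (fun u => S u *m F u) - mx_integral `[0, t] (fun u => S u *m G u) =
    mx_integral `[0, t] (fun u => S u *m (F u - G u)).
  move=> iF iG; apply/matrixP => i j; rewrite [LHS]mxE [X in _ + X]mxE !mx_integralE.
  rewrite -(integB (iF i j) (iG i j)); apply: eq_integ => u _.
  by rewrite mulmxBr [RHS]mxE [X in _ = _ + X]mxE.
have step k : forall t i j, 0 <= t -> `|M k.+1 t i j - M k t i j| <= 2 / 2 ^+ k * expR (L * t).
  elim: k => [|k IH] t i j t0.
    rewrite divr1 (le_trans (ler_normB _ _))//.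
    have := bM 1%N t i j t0; have := bM 0%N t i j t0; lra.
  have -> : M k.+2 t i j - M k.+1 t i j =
      - mx_integral `[0, t] (fun u => S u *m (M k.+1 u - M k u)) i j.
    transitivity ((M k.+2 t - M k.+1 t) i j); first by rewrite !mxE.
    transitivity ((- mx_integral `[0, t] (fun u => S u *m (M k.+1 u - M k u))) i j); last by rewrite mxE.
    rewrite -(mx_integralB _ _ _ (itM k.+1 t t0) (itM k t t0)) (MS k.+1) (MS k).
    by congr (fun_of_matrix _ i j); rewrite !opprB addrC subrKA.
  rewrite normrN.
  have k0 : 0 <= 2 / 2 ^+ k :> R by rewrite divr_ge0// exprn_ge0.
  have [||_ h] := flow_kernel (D := fun u => M k.+1 u - M k u) L0 t0 k0 SL (itS t t0).
  - move=> i' j'; apply: (@measurable_eq_on R (fun u => M k.+1 u i' j' - M k u i' j')).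
      by move=> u _; rewrite !mxE.
    by apply: measurable_funB; exact: mM.
  - by move=> u i' j' /andP[u0 _]; rewrite [_ i' j']mxE [X in _ + X]mxE; exact: IH.
  rewrite (le_trans (h i j))// exprSr invfM mulrA.
  by rewrite ler_wpM2l ?gerBl// mulr_ge0.
have /choice[Phi hPhi] : forall t, exists A : 'M[R]_n, 0 <= t -> forall i j,
    (fun k => M k t i j) @ \oo --> A i j /\
    forall k, `|A i j - M k t i j| <= 2 * (2 * expR (L * t)) / 2 ^+ k.
  move=> t; have [t0|t0] := leP 0 t; last by exists 0.
  have /choice[l hl] : forall ij : 'I_n * 'I_n, exists l : R,
      (fun k => M k t ij.1 ij.2) @ \oo --> l /\
      forall k, `|l - M k t ij.1 ij.2| <= 2 * (2 * expR (L * t)) / 2 ^+ k.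
    move=> ij; apply: geometric_cauchy => k.
    by rewrite mulrAC; exact: step.
  by exists (\matrix_(i, j) l (i, j)) => _ i j; rewrite mxE; exact: (hl (i, j)).
have bPhi t i j : 0 <= t -> `|Phi t i j| <= 1 * expR (L * t).
  move=> t0; apply: (@cvg_le R \oo (fun k => `|M k t i j|) (fun=> 1 * expR (L * t))) => //.
  - exact: cvg_norm (hPhi t t0 i j).1.
  - exact: cvg_cst.
  - by move=> k; exact: bM.
have dPhi k t i j : 0 <= t -> `|Phi t i j - M k t i j| <= 4 / 2 ^+ k * expR (L * t).
  move=> t0; rewrite mulrAC (_ : 4 * expR (L * t) = 2 * (2 * expR (L * t))); last by ring.
  exact: (hPhi t t0 i j).2.
have mPhi (t : R) i j : 0 <= t -> measurable_fun `[0, t] (fun u => Phi u i j).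
  move=> t0; apply: (measurable_fun_cvg (h := fun k u => M k u i j)) => [k|u]; first exact: mM.
  by rewrite /= in_itv/= => /andP[u0 _]; exact: (hPhi u u0 i j).1.
have kerP t (t0 : 0 <= t) := flow_kernel L0 t0 ler01 SL (itS t t0) (fun i j => mPhi t i j t0)
    (fun u i j h => bPhi u i j (andP h).1).
have PhiE t : 0 <= t -> Phi t = 1%:M - mx_integral `[0, t] (fun u => S u *m Phi u).
  move=> t0; apply/eqP; rewrite -subr_eq0; apply/eqP/matrixP => i j; rewrite [RHS]mxE.
  (* The defect of [Phi] is bounded by 4 / 2^k in the weighted norm: one half comes from its
     distance to iterate k + 1, the other from the contracted distance to iterate k. *)
  apply: (@geometric_bound_eq0 R _ (4 * expR (L * t))) => k.
  have -> : Phi t - (1%:M - mx_integral `[0, t] (fun u => S u *m Phi u)) =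
      (Phi t - M k.+1 t) + mx_integral `[0, t] (fun u => S u *m (Phi u - M k u)).
    rewrite -(mx_integralB _ _ _ (kerP t t0).1 (itM k t t0)).
    by rewrite (MS k) !opprB -[RHS]addrA; congr (_ + _); rewrite [RHS]addrC subrKA.
  rewrite mxE (le_trans (ler_normD _ _))//.
  have k0 : 0 <= 4 / 2 ^+ k :> R by rewrite divr_ge0// exprn_ge0.
  have [||_ h] := flow_kernel (D := fun u => Phi u - M k u) L0 t0 k0 SL (itS t t0).
  - move=> i' j'; apply: (@measurable_eq_on R (fun u => Phi u i' j' - M k u i' j')).
      by move=> u _; rewrite !mxE.
    by apply: measurable_funB; [exact: mPhi|exact: mM].
  - by move=> u i' j' /andP[u0 _]; rewrite [_ i' j']mxE [X in _ + X]mxE; exact: dPhi.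
  have h1 := dPhi k.+1 t i j t0.
  have -> : (Phi t - M k.+1 t) i j = Phi t i j - M k.+1 t i j by rewrite !mxE.
  have E : 4 / 2 ^+ k.+1 = 4 / 2 ^+ k / 2 :> R by rewrite exprSr invfM mulrA.
  rewrite E in h1; rewrite (le_trans (lerD h1 (h i j)))//.
  rewrite [leRHS]mulrAC; lra.
exists Phi; last by move=> t i j t0; rewrite -[leRHS]mul1r; exact: bPhi.
move=> T T0; have [it _] := kerP T (ltW T0); have [itN _] := mx_integralN it.
split => // t /andP[t0 _]; have [it' _] := kerP t t0; have [_ ->] := mx_integralN it'.
exact: PhiE.
Qed.

(** * The linear lift of a trajectory on the sphere *)

Lemma expRN_second_order R (x : R) : 0 <= x ->
  `|expR (- x) - 1 + x| <= x ^+ 2 /\ 0 <= 1 - expR (- x) <= x.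
Proof.
(* Both estimates rest on exp y >= 1 + y at y = x and y = - x. *)
move=> x0; have h := expR_ge1Dx (- x); have h1 := expR_ge1Dx x.
have h2 : expR (- x) * (1 + x) <= 1.
  have e : expR (- x) * expR x = 1 by rewrite -expRD addNr expR0.
  by apply: (@le_trans _ _ (expR (- x) * expR x)); [rewrite ler_wpM2l ?expR_ge0|rewrite e].
have e0 := expR_ge0 (- x).
split; last by apply/andP; split; nra.
rewrite ger0_norm; last by lra.
have h3 : (expR (- x) - 1 + x - x ^+ 2) * (1 + x) <= 0.
  have -> : (expR (- x) - 1 + x - x ^+ 2) * (1 + x) = (expR (- x) * (1 + x) - 1) - x ^+ 3 by ring.
  by rewrite subr_le0 (@le_trans _ _ 0)// ?subr_le0// exprn_ge0.
have : expR (- x) - 1 + x - x ^+ 2 <= 0 by rewrite -(pmulr_lle0 _ (x := 1 + x))//; lra.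
by rewrite subr_le0.
Qed.

(** The integrating factor is r = exp(- int w^T S w). Since [S] need not be continuous, the product
    rule is replaced by a second-order comparison of increments; the row bound L / 2 makes its
    errors quadratic in t - s. *)
Lemma trajectory_lift R (n : nat) (S : R -> 'M[R]_n) (L T : R)
    (w0 : 'cV[R]_n) (w : R -> 'cV[R]_n) : 0 < L -> 0 <= T ->
  (forall t, psd (S t)) -> (forall u i, \sum_j `|S u i j| <= L / 2) ->
  mx_integrable `[0, T] S -> sphere_trajectory T S w0 w ->
  exists2 r : R -> R, forall t, 0 <= t -> 0 < r t <= 1 &
    primitive_on T w0 (fun t => - (S t *m (r t *: w t))) (fun t => r t *: w t).
Proof.
move=> L0 T0 pS SL itS [w1 wP]; have [itv wE] := wP.
pose B := L / 2; have B0 : 0 <= B by rewrite divr_ge0// ltW.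
pose Kb := n%:R * B; have Kb0 : 0 <= Kb by rewrite mulr_ge0.
pose beta u := qform (S u) (w u).
have wc u i : 0 <= u <= T -> `|w u i 0| <= 1 by move=> /w1/unit_sphere_coord.
have mw i : measurable_fun `[0, T] (fun t => w t i 0) := primitive_measurable i 0 T0 wP.
have itSw : mx_integrable `[0, T] (fun u => S u *m w u).
  apply: (mx_integrable_mulmx (C := 1)) => // [i j|u i j uT]; rewrite (ord1 j); first exact: mw.
  exact: wc.
have Swc u i : 0 <= u <= T -> `|(S u *m w u) i 0| <= B.
  move=> uT; rewrite mxE (le_trans (ler_norm_sum _ _ _))// (le_trans _ (SL u i))//.
  by apply: ler_sum => j _; rewrite normrM ler_piMr// wc.
have beta0 u : 0 <= beta u by exact: (pS u).2.
have betaK u : 0 <= u <= T -> `|beta u| <= Kb.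
  move=> uT; rewrite /beta qform_bform bform_dotp dotpE; apply: norm_sum_le => i.
  by rewrite normrM -[leRHS]mul1r ler_pM// ?wc// Swc.
have itb : integrable_on beta 0 T.
  by apply: integrable_on_qform => // u i uT; exact: wc.
pose b := integ beta 0; pose r t := expR (- b t).
have bD s t : 0 <= s -> s <= t -> t <= T ->
    b t = b s + integ beta s t /\ 0 <= integ beta s t <= Kb * (t - s).
  move=> s0 st tT; split; first by apply: integ_split => //; exact: integrable_onS itb.
  rewrite integ_ge0//=; apply: le_trans (ler_norm _) _; apply: norm_integ_le_cst => //.
    exact: integrable_onS itb.
  by move=> u /andP[su ut]; apply: betaK; rewrite (le_trans s0)// (le_trans ut).
have r01 t : 0 <= t -> 0 < r t <= 1.
  move=> t0; rewrite /r expR_gt0/= -(@expR0 R) ler_expR oppr_le0.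
  exact: integ_ge0.
have mr : measurable_fun `[0, T] r.
  apply: measurableT_comp; first exact: measurable_expR.
  apply: measurable_funN.
  exact: integ_measurable.
have ityw i : integrable_on (fun u => - (S u *m (r u *: w u)) i 0) 0 T.
  apply: (@eq_integrable_on _ (fun u => - 1 * ((S u *m w u) i 0 * r u))).
    by move=> u _; rewrite -scalemxAr [in RHS]mxE mulN1r mulrC.
  apply: integrable_onZ; apply: (integrable_onM_bounded (C := 1) (itSw i 0) mr).
  move=> u /andP[u0 _]; have /andP[h1 h2] := r01 u u0.
  by rewrite ger0_norm// ltW.
have second i s t : 0 <= s -> s <= t -> t <= T ->
    `|(r t *: w t) i 0 - (r s *: w s) i 0 - integ (fun u => - (S u *m (r u *: w u)) i 0) s t|
    <= (Kb * B + Kb * (B + Kb) + Kb ^+ 2) * (t - s) ^+ 2.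
  move=> s0 st tT.
  have inT u : s <= u <= t -> 0 <= u <= T.
    by move=> /andP[su ut]; rewrite (le_trans s0 su) (le_trans ut tT).
  pose g u := (S u *m w u) i 0.
  pose h u := beta u * w u i 0.
  have itg : integrable_on g s t by apply: integrable_onS (itSw i 0).
  have itbs : integrable_on beta s t by apply: integrable_onS itb.
  have sub (f : R -> R) : measurable_fun `[0, T] f -> measurable_fun `[s, t] f.
    by move=> mf; apply: measurable_funS mf => //; apply: subset_itv; rewrite bnd_simp.
  have ith : integrable_on h s t.
    apply: (integrable_onM_bounded (C := 1) itbs); first exact: sub.
    by move=> u /inT; exact: wc.
  have itgr : integrable_on (fun u => g u * r u) s t.
    apply: (integrable_onM_bounded (C := 1) itg); first exact: sub.
    move=> u /inT/andP[u0 _]; have /andP[h1 h2] := r01 u u0.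
    by rewrite ger0_norm// ltW.
  have wts u v j : s <= u -> u <= v -> v <= t -> `|w v j 0 - w u j 0| <= (B + Kb) * (v - u).
    move=> su uv vt; rewrite (primitive_increment _ _ wP (le_trans s0 su) uv (le_trans vt tT)).
    apply: norm_integ_le_cst => //.
      by apply: integrable_onS (itv j 0); [exact: le_trans su|exact: le_trans tT].
    move=> x /andP[ux xv]; rewrite mxE [X in `|X + _|]mxE [X in `|_ + X|]mxE.
    have xT : 0 <= x <= T by apply: inT; rewrite (le_trans su ux) (le_trans xv vt).
    rewrite (le_trans (ler_normD _ _))// normrN lerD ?Swc// normrM -[leRHS]mulr1.
    by rewrite ler_pM// ?wc// betaK.
  have [bE /andP[x0 xK]] := bD s t s0 st tT.
  set x := integ beta s t in bE x0 xK.
  have rE : r t = r s * expR (- x) by rewrite /r bE opprD expRD.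
  have [e2 _] := expRN_second_order x0.
  have wE' : w t i 0 - w s i 0 = - integ g s t + integ h s t.
    rewrite (primitive_increment _ _ wP s0 st tT) -[- integ g s t]mulN1r -integZ// -integD//.
      by apply: eq_integ => u _; rewrite mulN1r mxE [X in X + _]mxE [X in _ + X]mxE.
    exact: integrable_onZ.
  have fE : integ (fun u => - (S u *m (r u *: w u)) i 0) s t = - integ (fun u => g u * r u) s t.
    rewrite -mulN1r -integZ//; apply: eq_integ => u _.
    by rewrite -scalemxAr [in LHS]mxE mulN1r mulrC.
  (* The two parts are small for different reasons: r(u) - r(s) in the first, w(u) - w(t) in the
     second. What is left over is the second-order remainder of the exponential. *)
  pose k u := (g u * r u - r s * g u) + r s * (h u - w t i 0 * beta u).
  have it1 : integrable_on (fun u => g u * r u - r s * g u) s t.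
    by apply: integrable_onB => //; exact: integrable_onZ.
  have it2 : integrable_on (fun u => h u - w t i 0 * beta u) s t.
    by apply: integrable_onB => //; exact: integrable_onZ.
  have kE : integ k s t = integ (fun u => g u * r u) s t - r s * integ g s t
      + r s * (integ h s t - w t i 0 * x).
    rewrite integD//; last exact: integrable_onZ.
    rewrite integB//; last exact: integrable_onZ.
    by rewrite !integZ// integB ?integZ//; exact: integrable_onZ.
  have -> : (r t *: w t) i 0 - (r s *: w s) i 0 -
      integ (fun u => - (S u *m (r u *: w u)) i 0) s t =
      integ k s t + r s * (expR (- x) - 1 + x) * w t i 0.
    have scE (a : R) (v : 'cV[R]_n) : (a *: v) i 0 = a * v i 0 by rewrite mxE.
    rewrite fE kE !scE rE.
    have -> : integ h s t = w t i 0 - w s i 0 + integ g s t by rewrite wE'; ring.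
    ring.
  have /andP[rs0 rs1] := r01 s s0; have rs0' := ltW rs0.
  have ts0 : 0 <= t - s by rewrite subr_ge0.
  have kB : `|integ k s t| <= (Kb * B + Kb * (B + Kb)) * (t - s) * (t - s).
    apply: norm_integ_le_cst => //; first by apply: integrable_onD => //; exact: integrable_onZ.
    move=> u /[dup] su /andP[su1 su2]; rewrite /k mulrDl.
    have uT := inT u su.
    rewrite (le_trans (ler_normD _ _))// lerD//.
      have [bE' /andP[y0 yK]] := bD s u s0 su1 (le_trans su2 tT).
      have [_ /andP[h1 h2]] := expRN_second_order y0.
      rewrite (_ : _ - _ = - (r s * (1 - expR (- integ beta s u)) * g u)); last first.
        rewrite /r bE' opprD expRD mulrC -/(r s); set e := expR _; set p := r s; ring.
      rewrite normrN normrM mulrAC ler_pM// ?Swc//.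
      rewrite ger0_norm ?mulr_ge0// -[leRHS]mul1r ler_pM//.
      by rewrite (le_trans h2)// (le_trans yK)// ler_wpM2l// lerD2r.
    rewrite (_ : h u - _ = beta u * (w u i 0 - w t i 0)); last by rewrite /h; ring.
    rewrite normrM -[leRHS]mul1r ler_pM// ?(ger0_norm rs0')//.
    rewrite normrM -mulrA ler_pM// ?betaK// distrC.
    rewrite (le_trans (wts u t i su1 su2 (lexx t)))//.
    by rewrite ler_wpM2l ?addr_ge0// lerD2l lerN2.
  rewrite (le_trans (ler_normD _ _))// mulrDl lerD//; first by rewrite [X in _ * X]expr2 mulrA.
  rewrite !normrM (ger0_norm rs0') -[leRHS]mulr1 ler_pM ?mulr_ge0// ?wc ?(le_trans s0 st)//.
  rewrite -[leRHS]mul1r ler_pM// (le_trans e2)// -exprMn.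
  by rewrite lerXn2r// nnegrE mulr_ge0.
exists r => //; split => [i j|t tT].
  rewrite (ord1 j); apply: eq_integrable_on (ityw i) => u _; by rewrite [RHS]mxE.
apply/colP => i; rewrite [RHS]mxE mx_integralE.
rewrite (primitive_of_second_order T0 (ityw i) (second i) tT).
have w00 := primitive_start T0 wP.
rewrite /r /b integ_nil oppr0 expR0 scale1r w00; congr (_ + _).
by apply: eq_integ => u _; rewrite [RHS]mxE.
Qed.

(** Phi w0 and r w solve the same linear equation, hence coincide by [flow_unique]; as [w] has norm
    1 and r > 0, normalizing returns [w]. *)
Lemma flow_trajectory R (n : nat) (S Phi : R -> 'M[R]_n) (L : R)
    (w0 : 'cV[R]_n) (w : R -> 'cV[R]_n) : 0 < L ->
  (forall t, psd (S t)) -> (forall u i, \sum_j `|S u i j| <= L / 2) ->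
  (forall T, 0 < T -> mx_integrable `[0, T] S) ->
  (forall T, 0 < T -> sphere_trajectory T S w0 w) ->
  is_flow S Phi -> (forall t i j, 0 <= t -> `|Phi t i j| <= expR (L * t)) ->
  forall t, 0 <= t -> w t = (enorm (Phi t *m w0))^-1 *: (Phi t *m w0).
Proof.
move=> L0 pS SL itS0 wS flow PhiB t t0; pose T := t + 1.
have T0 : 0 < T by rewrite ltr_wpDl. have T0' := ltW T0.
have tT : 0 <= t <= T by rewrite t0 /T lerDl ler01.
have itS := itS0 T T0; have [w1 wP] := wS T T0; have [itP PhiE] := flow T T0.
have w0E := primitive_start T0' wP.
have w01 : unit_sphere w0 by rewrite -w0E; apply: w1; rewrite lexx.
have [r r01 [ity yE]] := trajectory_lift L0 T0' pS SL itS (wS T T0).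
pose y u := r u *: w u; pose z u := Phi u *m w0.
have primz : primitive_on T w0 (fun u => - (S u *m z u)) z.
  have zE u : - (S u *m z u) = 1%:M *m (- (S u *m Phi u)) *m w0.
    by rewrite mul1mx mulNmx mulmxA.
  split.
    have [h _] := mx_integral_mul (1%:M : 'M[R]_n) w0 itP.
    by move=> i j; apply: eq_integrable_on (h i j) => u _; rewrite zE.
  move=> u uT; have /andP[u0 uT'] := uT.
  have [_ h] := mx_integral_mul (1%:M : 'M[R]_n) w0 (mx_integrableS (lexx 0) uT' itP).
  rewrite /z PhiE// mulmxDl mul1mx; congr (_ + _); rewrite -[X in X *m w0]mul1mx -h.
  by apply/matrixP => i j; rewrite !mx_integralE; apply: eq_integ => v _; rewrite zE.
have [itz zE] := primz.
have e1 u : 0 <= u -> 1 <= expR (L * u).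
  by move=> u0; rewrite -expR0 ler_expR mulr_ge0// ltW.
have zy : z t - y t = 0.
  have K0 : 0 <= n%:R + 1 :> R by rewrite addr_ge0.
  apply: (@flow_unique R n 1 S (fun u => z u - y u) L (n%:R + 1) T L0 T0' K0 SL itS) => //.
  - move=> i j; apply: (@measurable_eq_on R (fun u => z u i j - y u i j)).
      by move=> u _; rewrite !mxE.
    apply: measurable_funB; [exact: primitive_measurable primz|].
    by apply: (primitive_measurable (x := y)); [exact: T0'|split; [exact: ity|exact: yE]].
  - move=> u i j /[dup] uT /andP[u0 _]; rewrite (ord1 j) mxE mulrDl (le_trans (ler_normD _ _))//.
    rewrite lerD//.
      rewrite mxE; apply: norm_sum_le => l; rewrite normrM -[leRHS]mulr1 ler_pM// ?PhiB//.
      exact: unit_sphere_coord.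
    rewrite mxE normrN mul1r mxE normrM; have /andP[r0 r1] := r01 u u0.
    rewrite (le_trans _ (e1 u u0))// -[leRHS]mulr1 ler_pM// ?(ger0_norm (ltW r0))//.
    exact/unit_sphere_coord/w1.
  - move=> u /[dup] uT /andP[u0 uT']; rewrite zE// [y u]yE// opprD addrACA subrr add0r.
    have h1 := mx_integrableS (lexx 0) uT' itz; have h2 := mx_integrableS (lexx 0) uT' ity.
    apply/matrixP => i j; rewrite [LHS]mxE [X in _ + X]mxE [RHS]mxE !mx_integralE.
    have oppE (A : 'cV[R]_n) : (- A) i j = - A i j by rewrite mxE.
    have addE (A A' : 'cV[R]_n) : (A + A') i j = A i j + A' i j by rewrite mxE.
    have E v : (S v *m (z v - y v)) i j = - 1 * ((- (S v *m z v)) i j - (- (S v *m y v)) i j).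
      by rewrite mulmxBr addE !oppE; ring.
    have it := integrable_onB (h1 i j) (h2 i j).
    rewrite -(integB (h1 i j) (h2 i j)).
    transitivity (- 1 * integ (fun v => - 1 * ((- (S v *m z v)) i j - (- (S v *m y v)) i j)) 0 u).
      by rewrite integZ// mulrA mulrNN mulr1 mul1r.
    by rewrite mulN1r; congr (- _); apply: eq_integ => v _; rewrite E.
have zyE : Phi t *m w0 = r t *: w t by apply/eqP; rewrite -subr_eq0; exact/eqP.
have /andP[r0 _] := r01 t t0.
have wt1 : dotp (w t) (w t) = 1 by exact/unit_sphereE/w1.
rewrite zyE enormE dotpZl dotpZr wt1 mulr1 -expr2 sqrtr_sqr (ger0_norm (ltW r0)).
by rewrite scalerA mulVf ?scale1r// gt_eqF.
Qed.

(** * The upper bound *)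

Lemma continuous_trig_affine R (th lam : R) :
  continuous (fun u : R => cos (th + lam * u)) /\ continuous (fun u : R => sin (th + lam * u)).
Proof.
have h (u : R) : {for u, continuous (fun u : R => th + lam * u)}.
  by apply: cvgD; [exact: cvg_cst|apply: cvgM; [exact: cvg_cst|exact: cvg_id]].
by split => u; apply: continuous_comp (h u) _; [exact: continuous_cos|exact: continuous_sin].
Qed.

(** [H] is a primitive, in the angle, of (A cos + B sin)^2. *)
Lemma integ_rotation R (th lam A B s t : R) : s <= t ->
  let H x := A ^+ 2 * (2^-1 * (x + sin x * cos x)) + A * B * sin x ^+ 2
             + B ^+ 2 * (2^-1 * (x - sin x * cos x)) in
  let f u := lam * (A * cos (th + lam * u) + B * sin (th + lam * u)) ^+ 2 in
  integrable_on f s t /\ integ f s t = H (th + lam * t) - H (th + lam * s).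
Proof.
move=> st H f; have [cc cs] := continuous_trig_affine th lam.
apply: (@integ_derive R (fun u => H (th + lam * u)) f s t st).
  move=> x; rewrite /H; apply: is_derive_eq.
  rewrite /f; set y := th + lam * x; have := cos2Dsin2 y; set C := cos y; set S := sin y.
  move=> CS; have sc (a b : R^o) : a *: b = a * b by [].
  rewrite !sc; apply/eqP; rewrite -subr_eq0; apply/eqP.
  transitivity (lam * (A ^+ 2 + B ^+ 2) / 2 * (1 - (C ^+ 2 + S ^+ 2))); last by rewrite CS subrr mulr0.
  by field.
have lin (u : R) : {for u, continuous (fun u => A * cos (th + lam * u) + B * sin (th + lam * u))}.
  by apply: cvgD; apply: cvgM; [exact: cvg_cst|exact: cc|exact: cvg_cst|exact: cs].
move=> u; apply: cvgM; first exact: cvg_cst.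
by rewrite /f; apply: cvgM; exact: lin.
Qed.

Lemma sin_le_id R (x : R) : 0 <= x -> sin x <= x.
Proof.
move=> x0; rewrite -subr_ge0.
have d (y : R) : is_derive y (1 : R) (fun y => y - sin y) (1 - cos y).
  by apply: is_derive_eq.
have c : continuous (fun y : R => 1 - cos y).
  by move=> y; apply: cvgB; [exact: cvg_cst|exact: continuous_cos].
have [_ h] := integ_derive x0 d c.
rewrite sin0 !subr0 in h; rewrite -h; apply: integ_ge0 => y _.
by rewrite subr_ge0 cos_le1.
Qed.

(** The derivative cos y - 1/2 = 1/2 - 2 sin(y / 2)^2 is nonnegative on [[0, 1]], as sin(y / 2) <= y
    / 2. *)
Lemma sin_ge_half R (x : R) : 0 <= x <= 1 -> x / 2 <= sin x.
Proof.
move=> /andP[x0 x1]; rewrite -subr_ge0.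
have d (y : R) : is_derive y (1 : R) (fun y => sin y - 2^-1 * y) (cos y - 2^-1).
  by apply: is_derive_eq; rewrite -[_%:A]/(2^-1 * 1) mulr1.
have c : continuous (fun y : R => cos y - 2^-1).
  by move=> y; apply: cvgB; [exact: continuous_cos|exact: cvg_cst].
have [_ h] := integ_derive x0 d c.
rewrite sin0 mulr0 !subr0 [2^-1 * x]mulrC in h; rewrite -h; apply: integ_ge0 => y /andP[y0 yx].
have hy : 0 <= y / 2 by rewrite divr_ge0.
have s1 := sin_le_id hy.
have s0 : 0 <= sin (y / 2).
  apply: sin_ge0_pi; rewrite hy/=; have := pi_ge2 R; lra.
have -> : cos y = cos (y / 2 *+ 2) by rewrite mulr2n -splitr.
rewrite cos_mulr2n cos2sin2; nra.
Qed.

(** Integrate 1 - cos y = 2 sin(y / 2)^2 >= y^2 / 8, which follows from sin(y / 2) >= y / 4. *)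
Lemma sub_sin_ge R (x : R) : 0 <= x <= 1 -> x ^+ 3 / 24 <= x - sin x.
Proof.
move=> /andP[x0 x1]; rewrite -subr_ge0.
have d (y : R) : is_derive y (1 : R) (fun y => y - sin y - 24^-1 * y ^+ 3) (1 - cos y - y ^+ 2 / 8).
  apply: is_derive_eq; have sc (a b : R^o) : a *: b = a * b by [].
  by rewrite !sc; field.
have c : continuous (fun y : R => 1 - cos y - y ^+ 2 / 8).
  move=> y; apply: cvgB; first by apply: cvgB; [exact: cvg_cst|exact: continuous_cos].
  by apply: cvgM; [exact: exprn_continuous|exact: cvg_cst].
have [_ h] := integ_derive x0 d c.
rewrite sin0 expr0n/= mulr0 !subr0 [24^-1 * _]mulrC in h; rewrite -h; apply: integ_ge0 => y /andP[y0 yx].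
have s1 : y / 4 <= sin (y / 2).
  have := @sin_ge_half R (y / 2); rewrite -mulrA -invfM.
  by rewrite -[2 * 2](_ : 4 = _ :> R); [apply; lra|ring].
have -> : cos y = cos (y / 2 *+ 2) by rewrite mulr2n -splitr.
rewrite cos_mulr2n cos2sin2; nra.
Qed.

Lemma bessel2 R (n : nat) (e f x : 'cV[R]_n) :
  dotp e e = 1 -> dotp f f = 1 -> dotp e f = 0 ->
  dotp e x ^+ 2 + dotp f x ^+ 2 <= dotp x x.
Proof.
move=> ee ff ef; have := dotp_ge0 (x - dotp e x *: e - dotp f x *: f).
rewrite !dotpBl !dotpBr !dotpZl !dotpZr ee ff ef (dotpC f e) ef (dotpC x e) (dotpC x f).
by move=> h; lra.
Qed.

(** The state turns in the plane of [e] and [f] from angle - th to th at constant speed, and the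
    cost is 2 th al. In that plane the integral of the control has eigenvalues (al + 1 / al) m and
    (al + 1 / al) p, whence the two assumptions; on the orthogonal complement it is a times the
    identity. *)
Lemma rotating_control R (n : nat) (e f : 'cV[R]_n) (a b T th al : R) :
  dotp e e = 1 -> dotp f f = 1 -> dotp e f = 0 ->
  0 < T -> 0 < a -> a <= b -> 0 < th -> 0 < al ->
  let p := th + sin th * cos th in let m := th - sin th * cos th in
  m <= p -> a <= (al + al^-1) * m -> (al + al^-1) * p <= b ->
  ocp_inf a b n T <= 2 * th * al.
Proof.
move=> ee ff ef T0 a0 ab th0 al0 p m mp am pb; have T0' := ltW T0.
have fe : dotp f e = 0 by rewrite dotpC.
pose lam := 2 * th / T.
have lam0 : 0 < lam by rewrite divr_gt0// mulr_gt0.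
pose ph t := - th + lam * t.
pose w t := cos (ph t) *: e + sin (ph t) *: f.
pose v t := - sin (ph t) *: e + cos (ph t) *: f.
(* As <c, w> = al, the control satisfies S w = lam c, and the field at [w] is lam v, the velocity of
   the rotation. *)
pose c t := al *: w t - v t.
pose Pi : 'M[R]_n := 1%:M - e *m e^T - f *m f^T.
pose S t := (lam / al) *: (c t *m (c t)^T) + (a / T) *: Pi.
have CS t := cos2Dsin2 (ph t).
have ww t : dotp (w t) (w t) = 1.
  by rewrite -(CS t) /w !dotpDl !dotpDr !dotpZl !dotpZr ee ff ef fe; ring.
have wv t : dotp (v t) (w t) = 0.
  by rewrite /w /v !dotpDl !dotpDr !dotpZl !dotpZr ee ff ef fe; ring.
have cw t : dotp (c t) (w t) = al by rewrite /c dotpBl dotpZl ww wv; ring.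
have PiE x : Pi *m x = x - dotp e x *: e - dotp f x *: f.
  by rewrite /Pi !mulmxBl mul1mx !mul_outer.
have Piw t : Pi *m w t = 0.
  rewrite PiE /w !dotpDr !dotpZr ee ff ef fe !mulr0 !mulr1 addr0 add0r.
  by rewrite -addrA -opprD subrr.
have qPi x : qform Pi x = dotp x x - (dotp e x ^+ 2 + dotp f x ^+ 2).
  by rewrite /Pi !qformB qform_scalar mul1r !qform_outer opprD addrA.
have pPi : psd Pi.
  split; last by move=> x; rewrite qPi subr_ge0 bessel2.
  by rewrite /Pi !linearB /= trmx1 !trmx_mul !trmxK.
have pS t : psd (S t).
  apply: psdD; apply: psdZ => //; first by rewrite divr_ge0// ltW.
    exact: psd_outer.
  by rewrite divr_ge0// ltW.
have Sw t : S t *m w t = lam *: c t.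
  rewrite /S mulmxDl -!scalemxAl mul_outer Piw scaler0 addr0 cw scalerA.
  by rewrite divfK ?gt_eqF.
have qw t : qform (S t) (w t) = lam * al.
  by rewrite qform_bform bform_dotp Sw dotpZr dotpC cw.
have vf t : vfield (S t) (w t) = lam *: v t.
  by rewrite /vfield Sw qw -scalerA -scalerN -scalerDr /c opprB subrK.
have [cc cs] := continuous_trig_affine (- th) lam.
have wi t i : w t i 0 = cos (ph t) * e i 0 + sin (ph t) * f i 0 by rewrite !mxE.
have vi t i : v t i 0 = - sin (ph t) * e i 0 + cos (ph t) * f i 0 by rewrite !mxE.
have cvi i : continuous (fun t => v t i 0).
  rewrite (_ : (fun t => _) = fun t => - sin (ph t) * e i 0 + cos (ph t) * f i 0).
    move=> t; apply: cvgD; apply: cvgM; try exact: cvg_cst; last exact: cc.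
    by apply: cvgN; exact: cs.
  by apply/funext => t; rewrite vi.
have cci i : continuous (fun t => c t i 0).
  rewrite (_ : (fun t => _) = fun t => al * (cos (ph t) * e i 0 + sin (ph t) * f i 0) - v t i 0).
    move=> t; apply: cvgB; last exact: cvi.
    apply: cvgM; first exact: cvg_cst.
    by apply: cvgD; apply: cvgM; try exact: cvg_cst; [exact: cc|exact: cs].
  by apply/funext => t; rewrite -wi !mxE.
have itS : mx_integrable `[0, T] S.
  move=> i j; apply: continuous_integrable_on.
  rewrite (_ : (fun t => _) = fun t => lam / al * (c t i 0 * c t j 0) + (a / T) * Pi i j).
    move=> t; apply: cvgD; last exact: cvg_cst.
    by apply: cvgM; [exact: cvg_cst|apply: cvgM; exact: cci].
  apply/funext => t.
  have -> : S t i j = lam / al * (c t *m (c t)^T) i j + a / T * Pi i j.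
    by rewrite [LHS]mxE [X in X + _]mxE [X in _ + X]mxE.
  by rewrite [X in _ * X + _]mxE big_ord1 [(c t)^T _ _]mxE.
have wS : sphere_trajectory T S (w 0) w.
  split; first by move=> t _; apply/unit_sphereE.
  have key i t : 0 <= t -> integ (fun u => vfield (S u) (w u) i 0) 0 t = w t i 0 - w 0 i 0.
    move=> t0; have [||_ <-] := @integ_derive R (fun t => w t i 0) (fun t => lam * v t i 0) 0 t t0.
    - move=> x; rewrite (_ : (fun t => _) = fun t => cos (ph t) * e i 0 + sin (ph t) * f i 0).
        rewrite /ph; apply: is_derive_eq; have sc (r s : R^o) : r *: s = r * s by [].
        by rewrite !sc vi; ring.
      by apply/funext => u; rewrite wi.
    - by move=> u; apply: cvgM; [exact: cvg_cst|exact: cvi].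
    - by apply: eq_integ => u _; rewrite vf mxE.
  split.
    move=> i j; rewrite (ord1 j).
    have E u : lam * v u i 0 = (- (S u *m w u) + qform (S u) (w u) *: w u) i 0.
      by rewrite -[RHS]/(vfield (S u) (w u) i 0) vf [RHS]mxE.
    apply: (eq_integrable_on (fun u _ => E u)).
    by apply: continuous_integrable_on => u; apply: cvgM; [exact: cvg_cst|exact: cvi].
  move=> t /andP[t0 _]; apply/colP => i; rewrite [RHS]mxE mx_integralE.
  by rewrite [integ _ _ _]key// addrC subrK.
have phT : ph T = th by rewrite /ph /lam divfK ?gt_eqF//; ring.
have ph0 : ph 0 = - th by rewrite /ph mulr0 addr0.
have qI x : qform (mx_integral `[0, T] S) x =
    al^-1 * ((al * dotp e x - dotp f x) ^+ 2 * p + (dotp e x + al * dotp f x) ^+ 2 * m)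
    + a * (dotp x x - (dotp e x ^+ 2 + dotp f x ^+ 2)).
  have [_ ->] := qform_integral x itS.
  pose A := al * dotp e x - dotp f x; pose B := dotp e x + al * dotp f x.
  pose g u := lam * (A * cos (ph u) + B * sin (ph u)) ^+ 2.
  have [it1 e1] := integ_rotation (- th) lam A B T0'.
  rewrite -/(ph T) -/(ph 0) phT ph0 in e1.
  (* The cross term A B sin^2 is even in the angle, so it cancels between - th and th. *)
  have {}e1 : integ g 0 T = A ^+ 2 * p + B ^+ 2 * m.
    by rewrite [LHS]e1 sinN cosN /p /m; field.
  have {}it1 : integrable_on g 0 T by [].
  rewrite -/A -/B.
  transitivity (integ (fun u => al^-1 * g u + a / T * qform Pi x) 0 T).
    apply: eq_integ => u _; rewrite /S qformD !qformZ qform_outer; congr (_ + _).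
    rewrite /c /w /v dotpBl dotpZl !dotpDl !dotpZl /A /B.
    by rewrite /g /A /B; field; rewrite gt_eqF.
  rewrite integD; [|exact: integrable_onZ|exact: integrable_on_cst].
  rewrite (integZ al^-1 it1) e1 integ_cst// subr0 -qPi; congr (_ + _).
  by rewrite mulrAC divfK ?gt_eqF.
have al1 : 0 < al^-1 by rewrite invr_gt0.
(* The vectors (al, -1) and (1, al) are orthogonal and of equal length, so the form is diagonal
   along them; m <= p bounds it on either side. *)
have kE x : al^-1 * ((al * dotp e x - dotp f x) ^+ 2 * p + (dotp e x + al * dotp f x) ^+ 2 * m)
    = (al + al^-1) * m * (dotp e x ^+ 2 + dotp f x ^+ 2) + (p - m) / al * (al * dotp e x - dotp f x) ^+ 2.
  by field; rewrite gt_eqF.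
have kE' x : al^-1 * ((al * dotp e x - dotp f x) ^+ 2 * p + (dotp e x + al * dotp f x) ^+ 2 * m)
    = (al + al^-1) * p * (dotp e x ^+ 2 + dotp f x ^+ 2) - (p - m) / al * (dotp e x + al * dotp f x) ^+ 2.
  by field; rewrite gt_eqF.
have D0 : 0 <= (p - m) / al by rewrite divr_ge0 ?subr_ge0// ltW.
have adm : admissible a b T S.
  split => // x; rewrite qform_scalar qI; have bs := bessel2 x ee ff ef.
    set X := dotp e x ^+ 2 + dotp f x ^+ 2 in bs kE *; have X0 : 0 <= X by rewrite addr_ge0// sqr_ge0.
    have h1 := ler_wpM2r X0 am; have h2 := mulr_ge0 D0 (sqr_ge0 (al * dotp e x - dotp f x)).
    rewrite kE -/X; move: h1 h2; set Y := _ * m * X; set Z := _ / al * _ => h1 h2.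
    by lra.
  set X := dotp e x ^+ 2 + dotp f x ^+ 2 in bs kE' *; have X0 : 0 <= X by rewrite addr_ge0// sqr_ge0.
  have h1 := ler_wpM2r X0 pb; have h2 := mulr_ge0 D0 (sqr_ge0 (dotp e x + al * dotp f x)).
  have h3 : a * (dotp x x - X) <= b * (dotp x x - X) by rewrite ler_wpM2r// subr_ge0.
  rewrite kE' -/X; move: h1 h2; set Y := _ * p * X; set Z := _ / al * _ => h1 h2.
  by lra.
have w0s : unit_sphere (w 0) by apply/unit_sphereE.
apply: le_trans (ocp_inf_le adm w0s wS) _.
rewrite /cost -/(integ _ 0 T) (eq_integ (g := fun=> lam * al)) => [|t _]; last exact: qw.
by rewrite integ_cst// subr0 mulrAC /lam divfK ?gt_eqF.
Qed.

(** For b < 4 the constant control suffices. For larger [b], a rotation with (al + 1 / al) p = b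
    saturates the upper constraint and has al <= 2 p / b, while a half angle of order sqrt (a / b)
    meets the lower one. *)
Lemma ocp_inf_upper_bound R (a b : R) (n : nat) (T : R) :
  0 < a -> a <= b -> (2 <= n)%N -> 0 < T ->
  ocp_inf a b n T <= 2000 * a / (1 + b ^+ 2).
Proof.
case: n => [//|[//|n]] a0 ab _ T0; have b0 : 0 < b by exact: lt_le_trans ab.
have d0 : 0 < 1 + b ^+ 2 by rewrite ltr_wpDr// sqr_ge0.
rewrite ler_pdivlMr//.
(* The threshold 4 ensures b / p >= 2 below, as p <= 2; under it, 1 + b^2 <= 17. *)
have [b4|b4] := ltP b 4.
  have h : ocp_inf a b n.+2 T <= a.
    have [S [w0 [adm w01 [w wS aE]]]] := ocp_inf_constant T0 a0 ab (ltn0Sn n.+1).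
    rewrite [leRHS]aE.
    exact: ocp_inf_le adm w01 wS.
  apply: (@le_trans _ _ (a * (1 + b ^+ 2))); first by rewrite ler_pM2r.
  have : b ^+ 2 <= 16 by nra.
  by move=> h2; nra.
have b16 : 16 <= b ^+ 2 by move: b4; clear; nra.
pose e : 'cV[R]_n.+2 := delta_mx 0 0; pose f : 'cV[R]_n.+2 := delta_mx 1 0.
have dd (i j : 'I_n.+2) : dotp (delta_mx i 0 : 'cV[R]_n.+2) (delta_mx j 0) = (i == j)%:R.
  by have := bform_delta (1%:M : 'M[R]_n.+2) i j; rewrite bform_dotp mul1mx mxE.
have ee : dotp e e = 1 by exact: dd.
have ff : dotp f f = 1 by exact: dd.
have ef : dotp e f = 0 by exact: dd.
(* If 48 a <= b, take 2 th = x with x^2 = 48 a / b: then m = (x - sin x) / 2 >= x^3 / 48 = x a / b,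
   while p <= x. Otherwise th = pi / 2 gives m = p, and (2 th)^2 <= 16 <= 768 a / b; hence 768 = 16
   * 48. *)
have [th [th0 th2 [p0 mp p2 am] ] ] : exists th : R, [/\ 0 < th, (2 * th) ^+ 2 <= 768 * a / b &
    let p := th + sin th * cos th in let m := th - sin th * cos th in
    [/\ 0 < p, m <= p, p <= 2 /\ p <= 2 * th & a * p <= b * m]].
  have [ab48|ab48] := leP (48 * a) b.
    pose x : R := Num.sqrt (48 * a / b).
    have q0 : 0 < 48 * a / b by rewrite divr_gt0// mulr_gt0.
    have x0 : 0 < x by rewrite sqrtr_gt0.
    have x2 : x ^+ 2 = 48 * a / b by rewrite sqr_sqrtr// ltW.
    have x1 : x <= 1.
      by rewrite /x -[leRHS]sqrtr1 ler_sqrt// ler_pdivrMr// mul1r.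
    exists (x / 2); split; first by rewrite divr_gt0.
      by rewrite mulrC divfK// x2 -!mulrA ler_pM2r ?mulr_gt0 ?invr_gt0//; lra.
    have sE : sin (x / 2) * cos (x / 2) = sin x / 2.
      have -> : sin x = 2 * (cos (x / 2) * sin (x / 2)).
        by rewrite {1}(splitr x) -mulr2n sin_mulr2n mulr_natl.
      by field.
    have x01 : 0 <= x <= 1 by rewrite ltW.
    rewrite /= sE; have h1 := sin_ge_half x01; have h2 := sub_sin_ge x01.
    have h3 := sin_le_id (ltW x0).
    split; [by lra|by lra|by split; lra|].
    have h4 : x ^+ 3 / 24 = 2 * x * (a / b) by rewrite exprS x2; field; rewrite gt_eqF.
    rewrite h4 in h2.
    have h5 : b * (2 * x * (a / b)) = 2 * x * a by field; rewrite gt_eqF.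
    have h6 := ler_wpM2l (ltW b0) h2; rewrite h5 in h6.
    have h7 : a * (sin x) <= a * x by rewrite ler_pM2l.
    by lra.
  have pi2 := pi_ge2 R; have pi4 := pihalf_lt2 R.
  exists (pi / 2); rewrite cos_pihalf mulr0 subr0 addr0; split; first by lra.
    rewrite mulrC divfK// -mulrA (_ : 768 = 16 * 48 :> R); last by ring.
    have : 1 <= 48 * (a / b) by rewrite mulrA ler_pdivlMr// mul1r ltW.
    have : pi ^+ 2 <= 16 :> R by nra.
    by lra.
  by split; [lra|lra|split; lra|rewrite ler_pM2r//; lra].
move: p0 mp p2 am; set p := th + _; set m := th - _ => p0 mp [p2 p2t] am.
pose k := b / p.
have k2 : 2 <= k by rewrite ler_pdivlMr//; lra.
have k0 : 0 < k by lra.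
(* [al] will be the smaller root of al + 1 / al = k, written in rationalized form; it is at most 2 /
   k. *)
pose s := Num.sqrt (k ^+ 2 - 4).
have s2 : s ^+ 2 = k ^+ 2 - 4 by rewrite sqr_sqrtr// subr_ge0; nra.
have s0 : 0 <= s by exact: sqrtr_ge0.
have ks0 : 0 < k + s by lra.
pose al := 2 / (k + s).
have al0 : 0 < al by rewrite divr_gt0.
have alE : al + al^-1 = k.
  rewrite /al invf_div; apply: (mulIf (x := 2 * (k + s))); first by rewrite mulf_neq0 ?gt_eqF.
  have -> : (2 / (k + s) + (k + s) / 2) * (2 * (k + s)) = 4 + (k + s) ^+ 2.
    by field; rewrite gt_eqF.
  by rewrite sqrrD s2; ring.
have alk : al <= 2 * p / b.
  by rewrite -mulrA -invf_div -/k /al ler_pM2l// lef_pV2 ?posrE//; lra.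
have h : ocp_inf a b n.+2 T <= 2 * th * al.
  apply: (rotating_control ee ff ef T0 a0 ab th0 al0) => //; rewrite alE /k.
    by rewrite mulrAC ler_pdivlMr.
  by rewrite divfK// gt_eqF.
have h1 : 2 * th * al <= 2 * (2 * th) ^+ 2 / b.
  apply: (@le_trans _ _ (2 * th * (2 * p / b))); first by rewrite ler_wpM2l// mulr_ge0// ltW.
  rewrite !mulrA ler_pM2r ?invr_gt0//; nra.
have h2 : 2 * (2 * th) ^+ 2 / b <= 1536 * a / b ^+ 2.
  have -> : 1536 * a / b ^+ 2 = 2 * (768 * a / b) / b by field; rewrite gt_eqF.
  by rewrite ler_pM2r ?invr_gt0// ler_pM2l.
(* As b^2 >= 16, the product of 1536 a / b^2 and 1 + b^2 is at most (96 + 1536) a, below 2000 a. *)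
have q16 : a / b ^+ 2 <= a / 16 by rewrite ler_pM2l// lef_pV2 ?posrE ?exprn_gt0.
have E : 1536 * a / b ^+ 2 * (1 + b ^+ 2) = 1536 * (a / b ^+ 2) + 1536 * a.
  by field; rewrite gt_eqF.
have h3 : ocp_inf a b n.+2 T <= 1536 * a / b ^+ 2 := le_trans h (le_trans h1 h2).
have h4 := ler_wpM2r (ltW d0) h3; rewrite E in h4.
apply: (le_trans h4); move: q16 a0; set q := a / b ^+ 2; clear; lra.
Qed.

Unset Implicit Arguments.

Theorem proposition1p6 (R : realType) :
  (exists2 C0 : R, 0 < C0 &
     forall (a b : R) (n : nat) (T : R),
       0 < a -> a <= b -> (2 <= n)%N -> 0 < T ->
       ocp_inf a b n T <= C0 * a / (1 + b ^+ 2)) /\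
  (forall (a b T : R) (n : nat),
     0 < a -> a <= b -> 0 < T -> (2 <= n)%N ->
     exists (c : R -> 'cV[R]_n) (S Phi : R -> 'M[R]_n)
            (w0 : 'cV[R]_n) (w : R -> 'cV[R]_n),
       (* the control on [0, +oo[ *)
       [/\ forall t : R, 0 <= t -> S t = c t *m (c t)^T /\ \rank (S t) = 1%N,
           forall T' : R, 0 < T' -> mx_integrable `[0, T'] S,
           periodic_on_nonneg (2 * T) S &
           forall t : R, 0 <= t ->
             loewner_le (2 * a)%:M (mx_integral `[t, t + 2 * T] S) /\
             loewner_le (mx_integral `[t, t + 2 * T] S) (2 * b)%:M] /\
       (* the trajectory *)
       [/\ unit_sphere w0,
           is_flow S Phi,
           forall t : R, 0 <= t -> w t = (enorm (Phi t *m w0))^-1 *: (Phi t *m w0),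
           forall T' : R, 0 < T' -> sphere_trajectory T' S w0 w &
           periodic_on_nonneg (2 * T) w] /\
       (* both halves of the period are optimal *)
       ocp_minimizer a b T S w0 /\
       ocp_minimizer a b T (fun t => S (t + T)) (w T)).
Proof.
split.
  exists 2000; first by rewrite ltr0n.
  by move=> a b n T a0 ab n2 T0; exact: ocp_inf_upper_bound.
move=> a b T n a0 ab T0 n2; have n0 : (0 < n)%N by exact: ltn_trans n2.
have [c [w [[[C cC] c0 cp wp] Sw win [min1 min2]]]] := periodic_minimizer a0 ab T0 n0.
(* The entries of c c^T are at most C^2, so row sums are at most n C^2; adding 1 keeps [L]
   positive. *)
pose S t := c t *m (c t)^T; pose L := 2 * (n%:R * `|C| ^+ 2 + 1).
have L0 : 0 < L by rewrite mulr_gt0// ltr_wpDl// mulr_ge0// exprn_ge0.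
have SL u i : \sum_j `|S u i j| <= L / 2.
  rewrite /L mulrAC divff// mul1r ler_wpDr//.
  rewrite -[leLHS]ger0_norm ?sumr_ge0//; apply: norm_sum_le => j.
  have cC' k : `|c u k 0| <= `|C| by rewrite (le_trans (cC u k))// ler_norm.
  by rewrite normr_id mxE big_ord1 mxE normrM expr2 ler_pM.
have itS T' : 0 < T' -> mx_integrable `[0, T'] S by move=> /Sw[].
have trS T' : 0 < T' -> sphere_trajectory T' S (w 0) w by move=> /Sw[].
have pS t : psd (S t) by exact: psd_outer.
have [Phi flow PhiB] := flow_exists L0 SL itS.
have w01 : unit_sphere (w 0) by have [h _] := trS T T0; apply: h; rewrite lexx ltW.
exists c, S, Phi, (w 0), w; split; [split|split; [split|split]].
- by move=> t _; split; [|exact: rank_outer].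
- exact: itS.
- by move=> t t0; rewrite /S cp.
- exact: win.
- exact: w01.
- exact: flow.
- exact: flow_trajectory L0 pS SL itS trS flow PhiB.
- exact: trS.
- exact: wp.
- exact: min1.
- exact: min2.
Qed.
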